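(* Let $R$ be a commutative regular local ring. Then the following are equivalent: (i) all finitely generated projective $R[t]$-modules are free; (ii) all finitely generated projective $R[t,t^{-1}]$-modules are free; (iii) all finitely generated projective $R\langle t\rangle$-modules are free; (iv) all finitely generated projective $R(\!(t)\!)$-modules are free.
   Context: For a commutative ring $R$: $R[t,t^{-1}]$ is the ring of Laurent polynomials; $R\langle t\rangle$ is the localization of $R[t]$ at the multiplicative set of monic polynomials; $R(\!(t)\!)=R[[t]]_t$ is the ring of formal Laurent series in one variable, i.e. the localization of the formal power series ring $R[[t]]$ at $\{1,t,t^2,\ldots\}$. *)

(* Defs.v *)
From HB Require Import structures.
From mathcomp Require Import all_boot all_order all_algebra.
From mathcomp Require Import ring.
From mathcomp Require Import boolp.

Set Implicit Arguments.
Unset Strict Implicit.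
Unset Printing Implicit Defensive.

Import GRing.Theory.
Local Open Scope ring_scope.
Local Open Scope quotient_scope.

(** * Localization of a commutative ring at a multiplicative set *)

Section Localization.
Variables (A : comPzRingType) (S : mulrClosed A).

(* [A] is not assumed to be a domain, hence the extra factor [u]; for the same
   reason the localization may be the zero ring and is a [comPzRingType]. *)
Definition loc_frac : Type := (A * {s : A | s \in S})%type.
Implicit Types x y z : loc_frac.

Definition loc_den x : A := sval x.2.
Lemma loc_denP x : loc_den x \in S. Proof. exact: (svalP x.2). Qed.

Definition loc_mkfrac (a s : A) (sS : s \in S) : loc_frac := (a, exist _ s sS).

Definition loc_equivf x y :=
  `[< exists2 u, u \in S & u * (x.1 * loc_den y) = u * (y.1 * loc_den x) >].

Lemma loc_equivf_refl : reflexive loc_equivf.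
Proof. by move=> x; apply/asboolP; exists 1 => //; exact: rpred1. Qed.

Lemma loc_equivf_sym : symmetric loc_equivf.
Proof.
by move=> x y; apply/asboolP/asboolP => -[u uS e]; exists u.
Qed.

Lemma loc_equivf_trans : transitive loc_equivf.
Proof.
move=> y x z /asboolP[u uS e] /asboolP[v vS f]; apply/asboolP.
exists (u * v * loc_den y); first by rewrite !rpredM ?loc_denP.
have -> : u * v * loc_den y * (x.1 * loc_den z)
          = (u * (x.1 * loc_den y)) * (v * loc_den z).
  by ring.
have -> : u * v * loc_den y * (z.1 * loc_den x)
          = (v * (z.1 * loc_den y)) * (u * loc_den x).
  by ring.
by rewrite e -f; ring.
Qed.

Canonical loc_equivf_equiv :=
  EquivRel loc_equivf loc_equivf_refl loc_equivf_sym loc_equivf_trans.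

Definition localization := {eq_quot loc_equivf}.
HB.instance Definition _ : EqQuotient _ loc_equivf localization :=
  EqQuotient.on localization.
HB.instance Definition _ := Choice.on localization.

Definition loc_cls x : localization := \pi x.

Lemma loc_cls_eq x y :
  loc_cls x = loc_cls y <->
  exists2 u, u \in S & u * (x.1 * loc_den y) = u * (y.1 * loc_den x).
Proof. by split=> [/eqmodP/asboolP|e]; [|apply/eqmodP/asboolP]. Qed.

Lemma loc_clsW (P : localization -> Prop) :
  (forall x, P (loc_cls x)) -> forall a, P a.
Proof. by move=> h; elim/quotW. Qed.

Definition loc_addf x y : loc_frac :=
  loc_mkfrac (x.1 * loc_den y + y.1 * loc_den x)
    (rpredM (loc_denP x) (loc_denP y)).
Definition loc_oppf x : loc_frac := loc_mkfrac (- x.1) (loc_denP x).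
Definition loc_mulf x y : loc_frac :=
  loc_mkfrac (x.1 * y.1) (rpredM (loc_denP x) (loc_denP y)).
Definition loc_constf (a : A) : loc_frac := loc_mkfrac a (rpred1 S).

Definition loc_add (a b : localization) := loc_cls (loc_addf (repr a) (repr b)).
Definition loc_opp (a : localization) := loc_cls (loc_oppf (repr a)).
Definition loc_mul (a b : localization) := loc_cls (loc_mulf (repr a) (repr b)).

Lemma loc_repr_cls x :
  exists2 u, u \in S & u * ((repr (loc_cls x)).1 * loc_den x)
                       = u * (x.1 * loc_den (repr (loc_cls x))).
Proof. by apply/loc_cls_eq; rewrite /loc_cls reprK. Qed.

Lemma loc_addE x y : loc_add (loc_cls x) (loc_cls y) = loc_cls (loc_addf x y).
Proof.
have [u uS e] := loc_repr_cls x; have [v vS f] := loc_repr_cls y.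
apply/loc_cls_eq; exists (u * v); first exact: rpredM.
rewrite /loc_addf /loc_den /=; move: e f; rewrite /loc_den.
set a := (repr _).1; set b := sval (repr _).2.
set c := (repr _).1; set d := sval (repr _).2 => e f.
transitivity ((u * (a * sval x.2)) * (v * d * sval y.2)
            + (v * (c * sval y.2)) * (u * b * sval x.2)); first by ring.
by rewrite e f; ring.
Qed.

Lemma loc_mulE x y : loc_mul (loc_cls x) (loc_cls y) = loc_cls (loc_mulf x y).
Proof.
have [u uS e] := loc_repr_cls x; have [v vS f] := loc_repr_cls y.
apply/loc_cls_eq; exists (u * v); first exact: rpredM.
rewrite /loc_mulf /loc_den /=; move: e f; rewrite /loc_den.
set a := (repr _).1; set b := sval (repr _).2.
set c := (repr _).1; set d := sval (repr _).2 => e f.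
transitivity ((u * (a * sval x.2)) * (v * (c * sval y.2))); first by ring.
by rewrite e f; ring.
Qed.

Lemma loc_oppE x : loc_opp (loc_cls x) = loc_cls (loc_oppf x).
Proof.
have [u uS e] := loc_repr_cls x.
apply/loc_cls_eq; exists u => //.
rewrite /loc_oppf /loc_den /=; move: e; rewrite /loc_den => e.
by rewrite !mulNr !mulrN e.
Qed.

Lemma loc_cls_eq1 x y :
  x.1 * loc_den y = y.1 * loc_den x -> loc_cls x = loc_cls y.
Proof. by move=> e; apply/loc_cls_eq; exists 1; rewrite ?rpred1 ?e. Qed.

Local Ltac loc_ring := apply: loc_cls_eq1;
  rewrite /loc_mulf /loc_addf /loc_oppf /loc_constf /loc_den /=; ring.

Lemma loc_addA : associative loc_add.
Proof.
elim/loc_clsW=> x; elim/loc_clsW=> y; elim/loc_clsW=> z; rewrite !loc_addE.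
by loc_ring.
Qed.

Lemma loc_addC : commutative loc_add.
Proof.
elim/loc_clsW=> x; elim/loc_clsW=> y; rewrite !loc_addE.
by loc_ring.
Qed.

Lemma loc_add0 : left_id (loc_cls (loc_constf 0)) loc_add.
Proof.
elim/loc_clsW=> x; rewrite !loc_addE.
by loc_ring.
Qed.

Lemma loc_addN : left_inverse (loc_cls (loc_constf 0)) loc_opp loc_add.
Proof.
elim/loc_clsW=> x; rewrite loc_oppE !loc_addE.
by loc_ring.
Qed.

HB.instance Definition _ :=
  GRing.isZmodule.Build localization loc_addA loc_addC loc_add0 loc_addN.

Lemma loc_mulA : associative loc_mul.
Proof.
elim/loc_clsW=> x; elim/loc_clsW=> y; elim/loc_clsW=> z; rewrite !loc_mulE.
by loc_ring.
Qed.

Lemma loc_mulC : commutative loc_mul.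
Proof.
elim/loc_clsW=> x; elim/loc_clsW=> y; rewrite !loc_mulE.
by loc_ring.
Qed.

Lemma loc_mul1 : left_id (loc_cls (loc_constf 1)) loc_mul.
Proof.
elim/loc_clsW=> x; rewrite !loc_mulE.
by loc_ring.
Qed.

Lemma loc_mulDl : left_distributive loc_mul loc_add.
Proof.
elim/loc_clsW=> x; elim/loc_clsW=> y; elim/loc_clsW=> z.
rewrite !(loc_addE, loc_mulE).
by loc_ring.
Qed.

HB.instance Definition _ :=
  GRing.Zmodule_isComPzRing.Build localization
    loc_mulA loc_mulC loc_mul1 loc_mulDl.

Definition toloc (a : A) : localization := loc_cls (loc_constf a).

Lemma toloc_is_zmod_morphism : zmod_morphism toloc.
Proof.
move=> a b; rewrite /toloc -[RHS]/(loc_add _ (loc_opp _)) loc_oppE loc_addE.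
by loc_ring.
Qed.
HB.instance Definition _ :=
  GRing.isZmodMorphism.Build A localization toloc toloc_is_zmod_morphism.

Lemma toloc_is_monoid_morphism : monoid_morphism toloc.
Proof.
split=> // a b; rewrite /toloc -[RHS]/(loc_mul _ _) loc_mulE.
by loc_ring.
Qed.
HB.instance Definition _ :=
  GRing.isMonoidMorphism.Build A localization toloc toloc_is_monoid_morphism.

Lemma toloc_inv (s : A) : s \in S -> exists v, toloc s * v = 1.
Proof.
move=> sS; exists (loc_cls (loc_mkfrac 1 sS)).
rewrite -[LHS]/(loc_mul _ _) loc_mulE.
by loc_ring.
Qed.

Lemma toloc_frac (x : localization) :
  exists a, exists2 s, s \in S & x * toloc s = toloc a.
Proof.
elim/loc_clsW: x => x; exists x.1, (loc_den x); first exact: loc_denP.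
rewrite -[LHS]/(loc_mul _ _) loc_mulE.
by loc_ring.
Qed.

Lemma toloc_eq (a b : A) :
  toloc a = toloc b <-> exists2 s, s \in S & s * a = s * b.
Proof.
rewrite loc_cls_eq /loc_den /=.
by split=> -[s sS e]; exists s => //; move: e; rewrite !mulr1.
Qed.

End Localization.

Section Powers.
Variables (A : comPzRingType) (x : A).

Definition powers : {pred A} := fun y => `[< exists n : nat, y = x ^+ n >].

Lemma powers_mulr_closed : mulr_closed powers.
Proof.
split; first by apply/asboolP; exists 0%N; rewrite expr0.
move=> _ _ /asboolP[m ->] /asboolP[n ->].
by apply/asboolP; exists (m + n)%N; rewrite exprD.
Qed.
HB.instance Definition _ :=
  GRing.isMulClosed.Build A powers powers_mulr_closed.

End Powers.

(** * Formal power series *)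

Record fps (R : Type) := Fps { coefs : nat -> R }.

Section FpsRing.
Variable R : comNzRingType.
Implicit Types f g h : fps R.

HB.instance Definition _ := gen_eqMixin (fps R).
HB.instance Definition _ := gen_choiceMixin (fps R).

Lemma fpsP f g : (forall n, coefs f n = coefs g n) -> f = g.
Proof. by case: f g => [f] [g] /= /funext->. Qed.

Definition fps_zero : fps R := Fps (fun=> 0).
Definition fps_one : fps R := Fps (fun n => (n == 0%N)%:R).
Definition fps_add f g := Fps (fun n => coefs f n + coefs g n).
Definition fps_opp f := Fps (fun n => - coefs f n).
Definition fps_mul f g :=
  Fps (fun n => \sum_(i < n.+1) coefs f i * coefs g (n - i)).

Lemma fps_addA : associative fps_add.
Proof. by move=> f g h; apply: fpsP => n /=; rewrite addrA. Qed.
Lemma fps_addC : commutative fps_add.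
Proof. by move=> f g; apply: fpsP => n /=; rewrite addrC. Qed.
Lemma fps_add0 : left_id fps_zero fps_add.
Proof. by move=> f; apply: fpsP => n /=; rewrite add0r. Qed.
Lemma fps_addN : left_inverse fps_zero fps_opp fps_add.
Proof. by move=> f; apply: fpsP => n /=; rewrite addNr. Qed.
HB.instance Definition _ :=
  GRing.isZmodule.Build (fps R) fps_addA fps_addC fps_add0 fps_addN.

(* The ring axioms are transported from polynomials by truncation. *)
Let tr m f : {poly R} := \poly_(i < m) coefs f i.

Let tr_mul m f g n :
  (n < m)%N -> coefs (fps_mul f g) n = (tr m f * tr m g)`_n.
Proof.
move=> nm; rewrite coefM; apply: eq_bigr => i _; rewrite !coef_poly.
by rewrite (leq_ltn_trans (leq_ord i) nm) (leq_ltn_trans (leq_subr i n) nm).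
Qed.

Let coef_tr m f n : (n < m)%N -> (tr m f)`_n = coefs f n.
Proof. by move=> nm; rewrite coef_poly nm. Qed.

Lemma fps_mulC : commutative fps_mul.
Proof.
by move=> f g; apply: fpsP => n; rewrite !(@tr_mul n.+1) // mulrC.
Qed.

Lemma fps_mulA : associative fps_mul.
Proof.
move=> f g h; apply: fpsP => n.
transitivity ((tr n.+1 f * (tr n.+1 g * tr n.+1 h))`_n).
  rewrite coefM; apply: eq_bigr => i _.
  by rewrite coef_tr // (@tr_mul n.+1) // ltnS leq_subr.
rewrite mulrA coefM; apply: eq_bigr => i _.
by rewrite (@tr_mul n.+1) // coef_tr // ltnS leq_subr.
Qed.

Lemma fps_mul1 : left_id fps_one fps_mul.
Proof.
move=> f; apply: fpsP => n /=.
rewrite big_ord_recl /= mul1r subn0 big1 ?addr0 // => i _.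
by rewrite mul0r.
Qed.

Lemma fps_mulDl : left_distributive fps_mul fps_add.
Proof.
move=> f g h; apply: fpsP => n /=.
by rewrite -big_split; apply: eq_bigr => i _; rewrite mulrDl.
Qed.

Lemma fps_one_neq0 : fps_one != 0.
Proof.
by apply/eqP => /(congr1 (fun f => coefs f 0%N)) /= /eqP; rewrite oner_eq0.
Qed.

HB.instance Definition _ :=
  GRing.Zmodule_isComNzRing.Build (fps R)
    fps_mulA fps_mulC fps_mul1 fps_mulDl fps_one_neq0.

End FpsRing.

Definition fpsX (R : comNzRingType) : fps R := Fps (fun n => (n == 1%N)%:R).

(** * The rings R[t,t^-1], R<t> and R((t)) *)

(* R[t,t^-1] is taken to be R[t]_t. *)
Definition laurent_poly (R : comNzRingType) : comPzRingType :=
  localization (powers ('X : {poly R})).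

Definition monic_loc (R : comNzRingType) : comPzRingType :=
  localization (@monic_pred R : {pred {poly R}}).

Definition laurent_series (R : comNzRingType) : comPzRingType :=
  localization (powers (fpsX R)).

(** * Modules *)

Section Modules.
Variable A : pzRingType.
Implicit Type M : lmodType A.

Definition fin_gen M :=
  exists (n : nat) (g : 'I_n -> M),
    forall x : M, exists c : 'I_n -> A, x = \sum_i c i *: g i.

Definition projective (P : lmodType A) :=
  forall (M N : lmodType A) (p : {linear M -> N}) (f : {linear P -> N}),
    (forall y : N, exists x : M, p x = y) ->
    exists h : {linear P -> M}, forall x : P, p (h x) = f x.

(* A module is free when it has a basis, of arbitrary cardinality. *)
Definition is_basis M (I : eqType) (b : I -> M) :=
  (forall (s : seq I) (c : I -> A), uniq s ->
     \sum_(i <- s) c i *: b i = 0 -> forall i, i \in s -> c i = 0)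
  /\ (forall x : M, exists (s : seq I) (c : I -> A),
        x = \sum_(i <- s) c i *: b i).

Definition is_free M := exists (I : eqType) (b : I -> M), is_basis b.

Definition fg_projectives_free :=
  forall P : lmodType A, fin_gen P -> projective P -> is_free P.

End Modules.

(** * Regular local rings *)

Section RegularLocal.
Variable R : comNzRingType.
Implicit Types I J P : {pred R}.

(* Ideals are the submodules of [R]; the library's [idealr_closed] also
   requires properness. *)
Definition is_ideal I := submod_closed (I : {pred R^o}).

Definition is_prime P := idealr_closed P /\ prime_idealr_closed P.

Definition is_maximal I :=
  idealr_closed I /\
  forall J, idealr_closed J -> {subset I <= J} -> {subset J <= I}.

Definition generated_by I (n : nat) :=
  exists2 g : 'I_n -> R, (forall i, g i \in I) &
    forall x, x \in I -> exists c : 'I_n -> R, x = \sum_i c i * g i.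

Definition noetherian := forall I, is_ideal I -> exists n, generated_by I n.

Definition prime_chain (n : nat) :=
  exists2 P : nat -> {pred R}, (forall i, (i <= n)%N -> is_prime (P i)) &
    forall i, (i < n)%N ->
      {subset P i <= P i.+1} /\ exists2 x, x \in P i.+1 & x \notin P i.

Definition krull_dim (n : nat) :=
  prime_chain n /\ forall m, prime_chain m -> (m <= n)%N.

(* The smallest number of generators of the maximal ideal is the dimension. *)
Definition regular_local :=
  noetherian /\
  exists m : {pred R},
    [/\ is_maximal m,
        forall m' : {pred R}, is_maximal m' -> m' =i m
      & exists n, [/\ krull_dim n, generated_by m n
                    & forall k, generated_by m k -> (n <= k)%N]].

End RegularLocal.

(* Main.v *)
(** Write L = R((t)), s = 1/t, and let m be the maximal ideal of R.

    R[t] => R((t)). The maximal ideal is generated by a regular sequence, so finitely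
    generated R-modules, and hence saturated submodules of R[[t]]^n, have finite free
    resolutions; thus projective L-modules are stably free, and only the complement of a
    unimodular row a over L matters. By elementary operations some entry of a becomes 0 mod m.
    Truncating modulo t^N and adding t^N to this entry and to another one multiplies a by an
    invertible matrix and yields polynomials of degree at most N, one of them monic of
    degree N. The ideal J they generate contains t^k (1 + t w), and R[t]/J is finite over R
    with t nilpotent modulo m, so 1 + t w is invertible in it and t^k lies in J. Hence the row
    t^-N a has entries in R[s], where it is unimodular: its ideal contains a power of s and
    an element 1 + s w'.

    R((t)) => R<s>. A basis over L can be approximated by vectors over R<s>; their pairing
    with an approximate dual basis has a determinant in 1 + t R[[t]], which is a unit of R<s>.

    R<s> => R[s]. This is Horrocks' theorem. Over the residue field k, the projective module
    is free, and the gluing datum at infinity is a matrix over k(s) which lifts to an invertible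
    matrix over R<s>. After this correction the bundle on the projective line is trivial on the
    closed fibre, hence trivial.

    R[t,1/t] => R[t]. A module which becomes free over R[t,1/t] becomes free over R<t>.

    R[t] and R((t)) => R[t,1/t]. Approximating a basis as before, the determinant is now some
    g in 1 + t R[t], and the module is patched with a free one along g to a projective
    R[t]-module. *)

From HB Require Import structures.
Require Import Defs.
From mathcomp Require Import all_boot all_algebra.
From mathcomp Require Import perm ring zify boolp.

Set Implicit Arguments.
Unset Strict Implicit.
Unset Printing Implicit Defensive.

Import GRing.Theory.
Local Open Scope ring_scope.
Local Open Scope quotient_scope.

(** * Projective modules as idempotent matrices *)

(* Finitely generated projective modules are images of idempotent matrices [e]; the image
   of [e] is free of rank [r] when the identity of [A^r] factors through [e] as below. *)
Definition free_idem (A : comPzRingType) n (e : 'M[A]_n) :=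
  exists r (u : 'M[A]_(n, r)) (v : 'M[A]_(r, n)), u *m v = e /\ v *m u = 1%:M.

Definition idem_free (A : comPzRingType) :=
  forall n (e : 'M[A]_n), e *m e = e -> free_idem e.

Section RowSpace.
Variables (A : comPzRingType) (n : nat) (e : 'M[A]_n).

(** For an idempotent [e] the fixed rows are the row space of [e], that is, the projective module
    which [e] presents. *)
Definition fixed_rows : {pred 'rV[A]_n} := fun v => v *m e == v.

Lemma fixed_rows_submod : submod_closed fixed_rows.
Proof.
split; first by rewrite /fixed_rows !unfold_in mul0mx.
move=> a u v; rewrite !unfold_in => /eqP eu /eqP ev.
by rewrite mulmxDl -scalemxAl eu ev.
Qed.
HB.instance Definition _ :=
  GRing.isSubmodClosed.Build A 'rV[A]_n fixed_rows fixed_rows_submod.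

Record row_module :=
  RowModule { row_val :> 'rV[A]_n; row_valP : row_val \in fixed_rows }.
HB.instance Definition _ := [isSub for row_val].
HB.instance Definition _ := [Choice of row_module by <:].
HB.instance Definition _ := [SubChoice_isSubLmodule of row_module by <:].

Lemma row_val_sum I (s : seq I) (c : I -> A) (b : I -> row_module) :
  row_val (\sum_(i <- s) c i *: b i) = \sum_(i <- s) c i *: row_val (b i).
Proof. by elim/big_ind2: _ => // _ x _ y <- <-. Qed.

End RowSpace.

Lemma mul_row_sum (A : pzRingType) n (M : lmodType A) (g : 'I_n -> M) :
  linear (fun x : 'rV[A]_n => \sum_i x 0 i *: g i).
Proof.
move=> a x y; rewrite scaler_sumr -big_split /=; apply: eq_bigr => i _.
by rewrite !mxE scalerDl scalerA.
Qed.

Lemma linear_bundle (A : pzRingType) (M N : lmodType A) (f : M -> N) :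
  linear f -> exists g : {linear M -> N}, g =1 f.
Proof.
move=> fl.
by exists (HB.pack_for {linear M -> N} f (GRing.isLinear.Build _ _ _ _ f fl)).
Qed.

(** A section [h] of a surjection [p] from A^n makes P the image of the idempotent matrix of [h]
    after [p]. If this matrix is [u *m v] with [v *m u = 1%:M], the images under [p] of the rows of
    [v] form a basis. *)
Lemma idem_free_fg (A : comPzRingType) : idem_free A -> fg_projectives_free A.
Proof.
move=> Afree P [n [g gP]] projP.
have [p pE] := linear_bundle (mul_row_sum g).
have psurj (y : P) : exists x, p x = y.
  have [c ->] := gP y; exists (\row_i c i); rewrite pE.
  by apply: eq_bigr => i _; rewrite mxE.
have [h ph] := projP _ _ p idfun psurj.
pose e : 'M[A]_n := \matrix_i h (g i).
have mulE x : x *m e = h (p x).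
  rewrite pE linear_sum; apply/rowP => j; rewrite !mxE summxE.
  by apply: eq_bigr => i _; rewrite linearZ !mxE.
have phE x : p (h x) = x by rewrite ph.
have ee : e *m e = e.
  by apply/row_matrixP => i; rewrite row_mul mulE rowK phE.
have [r [u [v [uv vu]]]] := Afree _ _ ee.
exists 'I_r, (fun j => p (row j v)).
have bE (c : 'I_r -> A) : \sum_j c j *: p (row j v) = p ((\row_j c j) *m v).
  rewrite mulmx_sum_row linear_sum; apply: eq_bigr => j _.
  by rewrite linearZ mxE.
split=> [s c us|x].
  rewrite big_uniq //= => sc0 j js.
  pose c' i := if i \in s then c i else 0.
  have : \sum_i c' i *: p (row i v) = 0.
    rewrite -[RHS]sc0 [RHS]big_mkcond; apply: eq_bigr => i _.
    by rewrite /c'; case: ifP => // _; rewrite scale0r.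
  rewrite bE => /(congr1 h); rewrite -mulE linear0 -mulmxA => /(congr1 (mulmx^~ u)).
  rewrite mul0mx -mulmxA -uv -2!mulmxA vu mulmx1 vu mulmx1.
  by move/rowP/(_ j); rewrite !mxE /c' js.
exists (enum 'I_r), (fun j => (h x *m u) 0 j).
rewrite big_enum bE /=.
have -> : \row_j (h x *m u) 0 j = h x *m u by apply/rowP => j; rewrite mxE.
by rewrite -mulmxA uv mulE !phE.
Qed.

(** The spanning half of [is_basis] allows repetitions in [s]; [c'] adds up the coefficients of
    equal indices, so that independence can be used over duplicate-free lists. *)
Lemma basis_sum_widen (A : pzRingType) (M : lmodType A) (I : eqType) (b : I -> M)
    (s : seq I) (c : I -> A) :
  exists c' : I -> A, forall t : seq I, uniq t -> {subset s <= t} ->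
    \sum_(i <- s) c i *: b i = \sum_(i <- t) c' i *: b i.
Proof.
elim: s => [|i s [c' IH]].
  by exists (fun=> 0) => t _ _; rewrite big_nil big1 // => j _; rewrite scale0r.
exists (fun j => (if j == i then c i else 0) + c' j) => t ut st.
rewrite big_cons (IH t) => // [|j js]; last by apply: st; rewrite inE js orbT.
under [RHS]eq_bigr do rewrite scalerDl.
rewrite big_split /=; congr (_ + _).
rewrite (bigD1_seq i) ?st ?mem_head //= eqxx big1 ?addr0 // => j /negbTE->.
by rewrite scale0r.
Qed.

Lemma basis_finite_span (A : pzRingType) (M : lmodType A) (I : eqType)
    (b : I -> M) n (x : 'I_n -> M) :
  is_basis b -> exists2 s : seq I, uniq s &
    forall i, exists c : I -> A, x i = \sum_(j <- s) c j *: b j.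
Proof.
move=> [_ bspan].
have /choice[s0 s0P] i : exists s : seq I, exists c : I -> A,
    x i = \sum_(j <- s) c j *: b j by [].
exists (undup (flatten (codom s0))); first exact: undup_uniq.
move=> i; have [c ->] := s0P i.
have [c' c'P] := basis_sum_widen b (s0 i) c; exists c'.
apply: c'P; first exact: undup_uniq.
move=> j js; rewrite mem_undup; apply/flattenP; exists (s0 i) => //.
exact: codom_f.
Qed.

(** The rows of [e] generate its fixed rows, and a map defined on these generators extends because a
    fixed row is its own coefficient vector. The finitely many basis vectors that express the
    generators give [v], the coefficients give [u]. *)
Lemma fg_idem_free (A : comPzRingType) : fg_projectives_free A -> idem_free A.
Proof.
move=> Afree n e ee; pose P : lmodType A := row_module e.
have valE (x : P) : row_val x *m e = row_val x.
  by apply/eqP; exact: (row_valP x).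
have gP i : row i e \in fixed_rows e.
  by rewrite unfold_in -row_mul ee.
pose g i : P := RowModule (gP i).
have xE (x : P) : x = \sum_i row_val x 0 i *: g i.
  apply: val_inj; rewrite /= row_val_sum -{1}valE mulmx_sum_row.
  by [].
have Pfg : fin_gen P by exists n, g => x; exists (row_val x 0); exact: xE.
have Pproj : projective P.
  move=> M N p f psurj.
  have /choice[m mP] i : exists y, p y = f (g i) by exact: psurj.
  pose h0 (x : P) : M := \sum_i row_val x 0 i *: m i.
  have h0lin : linear h0.
    by move=> a x y; rewrite /h0 -(mul_row_sum m a (val x) (val y)).
  have [h hE] := linear_bundle h0lin; exists h => x.
  rewrite hE /h0 linear_sum [in RHS](xE x) linear_sum; apply: eq_bigr => i _.
  by rewrite !linearZ /= mP.
have [I [b bP]] := Afree P Pfg Pproj.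
have [s us] := basis_finite_span g bP; move=> /choice[c cP].
pose r := size s; pose tI := in_tuple s.
exists r, (\matrix_(i, j) c i (tnth tI j)), (\matrix_j row_val (b (tnth tI j))).
set u := \matrix_(i, j) c i _; set v := \matrix_j _.
have sumE (d : I -> A) :
    row_val (\sum_(i <- s) d i *: b i) = (\row_j d (tnth tI j)) *m v.
  rewrite row_val_sum mulmx_sum_row (big_tnth _ _ s); apply: eq_bigr => j _.
  by rewrite rowK mxE.
have uv : u *m v = e.
  apply/row_matrixP => i; rewrite row_mul.
  rewrite (_ : row i u = \row_j c i (tnth tI j)); last by apply/rowP => j; rewrite !mxE.
  by rewrite -sumE -cP.
split=> //.
have ve : v *m e = v by apply/row_matrixP => j; rewrite row_mul rowK valE.
apply/eqP; rewrite -subr_eq0; apply/eqP/row_matrixP => i; rewrite row0.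
(* Each row of [w] is a linear relation between the basis vectors that make up [v], hence zero. *)
set w := v *m u - 1%:M.
have wv : w *m v = 0 by rewrite mulmxBl mul1mx -mulmxA uv ve subrr.
have [ind _] := bP; have tinj : injective (tnth tI) by apply/tuple_uniqP.
pose d (k : I) := \sum_(j | tnth tI j == k) w i j.
have dE j : d (tnth tI j) = w i j.
  by rewrite /d (big_pred1 j) // => k; rewrite /= (inj_eq tinj).
have d0 := ind s d us; apply/rowP => j; rewrite mxE [RHS]mxE -dE; apply: d0.
  apply: val_inj; rewrite [LHS]sumE (_ : \row_j _ = row i w).
    by rewrite -row_mul wv row0.
  by apply/rowP => k; rewrite mxE dE [RHS]mxE.
exact: mem_tnth.
Qed.

(** * Determinants and Nakayama's lemma *)

(** [O] and [I] are arbitrary predicates because two cases occur: [I] an ideal of the whole ring,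
    and [I] the fractions of negative degree inside the fractions [O] of nonpositive degree. *)
Lemma det_congr (A : comPzRingType) (O I : A -> Prop) n (X Y : 'M[A]_n) :
  O 1 -> (forall x y, O x -> O y -> O (x * y)) ->
  I 0 -> (forall x y, I x -> I y -> I (x + y)) -> (forall x, I x -> I (- x)) ->
  (forall x y, O x -> I y -> I (x * y)) ->
  (forall i j, O (X i j)) -> (forall i j, O (Y i j)) ->
  (forall i j, I (X i j - Y i j)) -> I (\det X - \det Y).
Proof.
move=> O1 OM I0 ID IN OI OX OY XY; rewrite /determinant -sumrB.
elim/big_ind: _ => // s _; rewrite -mulrBr mulr_sign.
suff h : I (\prod_i X i (s i)
            - \prod_i Y i (s i)).
  by case: ifP => // _; exact: IN.
suff [] : I (\prod_i X i (s i)
            - \prod_i Y i (s i))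
  /\ O (\prod_i Y i (s i)) by [].
elim/big_rec2: _ => [|i y x _ [xy Oy]]; first by rewrite subrr.
split; last exact: OM.
move: (X i _) (Y i _) (OX i (s i)) (OY i (s i)) (XY i (s i)) => a b Oa Ob ab.
rewrite (_ : _ - _ = a * (x - y) + y * (a - b)); last by ring.
by apply: ID; apply: OI.
Qed.

Section Nakayama.
Variables (R B : comPzRingType) (f : {rmorphism R -> B}) (V : lmodType B).
Variable N : V -> Prop.
Hypothesis N0 : N 0.
Hypothesis ND : forall x y, N x -> N y -> N (x + y).
Hypothesis NZ : forall a x, N x -> N (f a *: x).

(** Cramer's rule modulo [N]: the relations are combined with the coefficients of the adjugate of
    [D]. *)
Lemma det_kill l (y : 'I_l -> V) (D : 'M[R]_l) :
  (forall i, N (\sum_j f (D i j) *: y j)) -> forall i, N (f (\det D) *: y i).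
Proof.
move=> Dy i.
suff -> : f (\det D) *: y i
          = \sum_k f ((\adj D) i k) *: \sum_j f (D k j) *: y j.
  by elim/big_ind: _ => // k _; apply: NZ.
transitivity (\sum_j f ((\adj D *m D) i j) *: y j).
  rewrite mul_adj_mx (bigD1 i) //= mxE eqxx mulr1n big1 ?addr0 // => j ji.
  by rewrite mxE eq_sym (negbTE ji) rmorph0 scale0r.
under [RHS]eq_bigr do rewrite scaler_sumr.
rewrite exchange_big /=; apply: eq_bigr => j _.
rewrite mxE rmorph_sum scaler_suml; apply: eq_bigr => k _.
by rewrite scalerA rmorphM.
Qed.

Variable m : R -> Prop.
Hypothesis m0 : m 0.
Hypothesis mD : forall x y, m x -> m y -> m (x + y).
Hypothesis mM : forall a x, m x -> m (a * x).
Hypothesis m_rad : forall x, m x -> exists y, y * (1 - x) = 1.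

(** The determinant of 1 - M is 1 modulo [m], hence a unit, and it multiplies every [y i] into [N].
    Here [N] is only an R-submodule of the B-module [V], since [V] is later taken over R[s] or
    R<s>. *)
Lemma nakayama (J : finType) (y : J -> V) (M : J -> J -> R) :
  (forall i j, m (M i j)) ->
  (forall i, N (y i - \sum_j f (M i j) *: y j)) -> forall i, N (y i).
Proof.
move=> Mm My.
pose D : 'M[R]_#|J| := 1%:M - \matrix_(i, j) M (enum_val i) (enum_val j).
have dm : m (1 - \det D).
  rewrite -(det1 R #|J|); apply: (@det_congr _ (fun=> True)) => //.
    by move=> x /(mM (-1)); rewrite mulN1r.
  by move=> x z _; exact: mM.
  by move=> i j; rewrite !mxE opprB addrC subrK; exact: Mm.
have [c] := m_rad dm; rewrite opprB addrC subrK => cD.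
have kill := @det_kill _ (fun i => y (enum_val i)) D.
move=> i; rewrite -[i]enum_rankK -[y _]scale1r -(rmorph1 f) -cD rmorphM -scalerA.
apply: NZ; apply: kill => {}i.
move: (My (enum_val i)).
rewrite (reindex (fun k : 'I_#|J| => enum_val k)) /=; last first.
  by apply: onW_bij; apply: enum_val_bij.
congr N; under [RHS]eq_bigr do rewrite !mxE rmorphB scalerBl.
rewrite sumrB; congr (_ - _); rewrite (bigD1 i) //= eqxx rmorph1 scale1r.
by rewrite big1 ?addr0 // => j; rewrite eq_sym => /negbTE->; rewrite rmorph0 scale0r.
Qed.

End Nakayama.

(** * The principal ideal theorem *)

Section Ideals.
Variable R : comNzRingType.
Implicit Types (I J P Q T : R -> Prop) (N : nat -> R -> Prop).

Definition idealP I :=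
  [/\ I 0, forall x y, I x -> I y -> I (x + y) & forall a x, I x -> I (a * x)].

Definition primeP I :=
  [/\ idealP I, ~ I 1 & forall x y, I (x * y) -> I x \/ I y].

Lemma idealN I x : idealP I -> I x -> I (- x).
Proof. by case=> _ _ IM; rewrite -mulN1r; exact: IM. Qed.

Lemma idealB I x y : idealP I -> I x -> I y -> I (x - y).
Proof. by move=> II Ix Iy; have [_ ID _] := II; apply: ID => //; exact: idealN. Qed.

Lemma ideal_sum I (K : Type) (s : seq K) (c g : K -> R) :
  idealP I -> (forall i, I (g i)) -> I (\sum_(i <- s) c i * g i).
Proof.
by case=> I0 ID IM Ig; elim/big_ind: _ => // i _; exact: IM.
Qed.

Lemma primeX P x n : primeP P -> P (x ^+ n) -> P x.
Proof.
case=> _ P1 PM; elim: n => [|n IH]; first by rewrite expr0 => /P1.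
by rewrite exprS => /PM[].
Qed.

Definition add_principal I z : R -> Prop :=
  fun a => exists i r, I i /\ a = i + r * z.

Lemma add_principal_ideal I z : idealP I -> idealP (add_principal I z).
Proof.
case=> I0 ID IM; split.
- by exists 0, 0; rewrite mul0r addr0.
- move=> _ _ [i [r [Ii ->]]] [j [s [Ij ->]]].
  by exists (i + j), (r + s); split; [exact: ID | ring].
- move=> a _ [i [r [Ii ->]]].
  by exists (a * i), (a * r); split; [exact: IM | ring].
Qed.

Lemma sub_add_principal I z a : I a -> add_principal I z a.
Proof. by move=> Ia; exists a, 0; rewrite mul0r addr0. Qed.

Lemma mem_add_principal I z : idealP I -> add_principal I z z.
Proof. by case=> I0 _ _; exists 0, 1; rewrite mul1r add0r. Qed.

Lemma add_principal_sub I J z :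
  idealP J -> (forall a, I a -> J a) -> J z -> forall a, add_principal I z a -> J a.
Proof.
by move=> [_ JD JM] IJ Jz _ [i [r [Ii ->]]]; apply: JD; [exact: IJ | exact: JM].
Qed.

Definition noetherianP :=
  forall I, idealP I -> exists n (g : 'I_n -> R),
    (forall i, I (g i)) /\ forall x, I x -> exists c : 'I_n -> R, x = \sum_i c i * g i.

Hypothesis noeth : noetherianP.

(** A counterexample starts a strictly increasing sequence of counterexamples. Its union is finitely
    generated, and the generators already lie in the stage [K], so the sequence stops there. *)
Lemma noetherian_ind (F : (R -> Prop) -> Prop) :
  (forall I, idealP I ->
     (forall J, idealP J -> (forall x, I x -> J x) ->
        (exists x, J x /\ ~ I x) -> F J) -> F I) ->
  forall I, idealP I -> F I.
Proof.
move=> step I0 I0I; apply: contrapT => nF.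
pose bad := {I : R -> Prop | idealP I /\ ~ F I}.
have /choice[next nextP] (b : bad) : exists b' : bad,
    (forall x, sval b x -> sval b' x) /\ exists x, sval b' x /\ ~ sval b x.
  case: b => I [II nFI]; apply: contrapT => h; apply: (nFI); apply: step => // J JI IJ sJ.
  by apply: contrapT => nFJ; apply: h; exists (exist _ J (conj JI nFJ)).
pose c n := iter n next (exist _ I0 (conj I0I nF) : bad).
have mono k n : (k <= n)%N -> forall x, sval (c k) x -> sval (c n) x.
  elim: n => [|n IH]; first by rewrite leqn0 => /eqP->.
  rewrite leq_eqVlt => /orP[/eqP->//|/IH h] x /h.
  exact: (nextP (c n)).1.
have cI n : idealP (sval (c n)) by case: (svalP (c n)).
pose U x := exists n, sval (c n) x.
have UI : idealP U.
  split; first by exists 0%N; case: (cI 0%N).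
    move=> x y [i xi] [j yj]; exists (maxn i j).
    case: (cI (maxn i j)) => _ ID _; apply: ID.
      exact: (mono i _ (leq_maxl _ _)).
    exact: (mono j _ (leq_maxr _ _)).
  by move=> a x [i xi]; exists i; case: (cI i) => _ _; exact.
have [n [g [/choice[k kP] gen]]] := noeth UI.
pose K := \max_i k i.
have [x [xK1 nxK]] := (nextP (c K)).2; apply: nxK.
have [d ->] := gen x (ex_intro _ K.+1 xK1).
by apply: ideal_sum => // i; apply: (mono _ _ (leq_bigmax i)).
Qed.

Lemma colon_ideal I z : idealP I -> idealP (fun a => I (a * z)).
Proof.
case=> I0 ID IM; split; first by rewrite mul0r.
  by move=> x y Ix Iy; rewrite mulrDl; exact: ID.
by move=> a x Ix; rewrite -mulrA; exact: IM.
Qed.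

(** An associated prime of R/I. If (I : z) is not prime because of x y, then (I : y z) is strictly
    larger, as it contains x, and noetherian induction continues with y z. *)
Lemma exists_prime_colon I :
  idealP I -> ~ I 1 -> exists2 z, ~ I z & primeP (fun a => I (a * z)).
Proof.
move=> II I1.
have := @noetherian_ind (fun J => forall z, ~ I z -> (forall a, J a <-> I (a * z)) ->
  exists2 z, ~ I z & primeP (fun a => I (a * z))).
move=> h; refine (h _ _ (colon_ideal 1 II) 1 I1 _) => // {h} J JI IH z Iz Jz.
have [pr|npr] := pselect (primeP (fun a => I (a * z))); first by exists z.
have [x [y [xy nx ny]]] : exists x y, [/\ I (x * y * z), ~ I (x * z) & ~ I (y * z)].
  apply: contrapT => h; apply: npr; split; first exact: colon_ideal.
    by rewrite mul1r.
  move=> x y xy; apply: contrapT => /not_orP[nx ny].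
  by apply: h; exists x, y.
have [_ _ IM] := II.
apply: (IH _ (colon_ideal (y * z) II)) (ny) _ => //.
  by move=> a /Jz; rewrite mulrCA; exact: IM.
exists x; split; first by rewrite mulrA.
by rewrite Jz.
Qed.

(** The preimage in R of the extension of [I] to the localization at the prime [T]. Saturated ideals
    replace the ideals of that localization. *)
Definition saturation T I : R -> Prop := fun a => exists2 s, ~ T s & I (s * a).
Definition saturated T I := forall s a, ~ T s -> I (s * a) -> I a.

Lemma sub_saturation T I a : primeP T -> I a -> saturation T I a.
Proof. by case=> _ T1 _ Ia; exists 1; rewrite ?mul1r. Qed.

Lemma saturation_ideal T I : primeP T -> idealP I -> idealP (saturation T I).
Proof.
move=> [_ T1 TM] [I0 ID IM]; split.
- by exists 1; rewrite ?mulr0.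
- move=> x y [s Ts sx] [t Tt ty]; exists (s * t); first by move=> /TM[].
  rewrite mulrDr; apply: ID; last by rewrite -mulrA; exact: IM.
  by rewrite mulrAC mulrC; exact: IM.
- by move=> a x [s Ts sx]; exists s => //; rewrite mulrCA; exact: IM.
Qed.

Lemma saturation_saturated T I : primeP T -> saturated T (saturation T I).
Proof.
move=> [_ T1 TM] s a Ts [t Tt tsa]; exists (t * s); last by rewrite -mulrA.
by move=> /TM[].
Qed.

Definition stationary N :=
  exists n0, forall n, (n0 <= n)%N -> forall a, N n a -> N n.+1 a.

(* Noetherian induction on [I]: adjoin to [I] an element [z] with [(I : z) = T];
   there is no saturated ideal strictly between [I] and [sat (I + Rz)]. *)
Lemma minimal_over_dcc T I0 :
  primeP T -> idealP I0 ->
  (forall Q, primeP Q -> (forall a, I0 a -> Q a) -> (forall a, Q a -> T a) ->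
     forall a, T a -> Q a) ->
  forall I, idealP I -> saturated T I -> (forall a, I0 a -> I a) ->
  forall N, (forall n, idealP (N n)) -> (forall n, saturated T (N n)) ->
    (forall n a, I a -> N n a) -> (forall n a, N n.+1 a -> N n a) -> stationary N.
Proof.
move=> Tp I0I Tmin I II; elim/noetherian_ind: I / II => I II IH satI I0sub N NI satN IN dec.
have [I1|I1] := pselect (I 1).
  exists 0%N => n _ a _; rewrite -[a]mulr1.
  by have [_ _ h] := NI n.+1; apply: h; exact: IN.
have [z Iz Ipr] := exists_prime_colon II I1.
have [_ _ IM] := II.
have TI a : T a -> I (a * z).
  apply: (Tmin (fun a => I (a * z))) => // {}a; first by move=> /I0sub; rewrite mulrC; exact: IM.
  by move=> Iaz; apply: contrapT => Ta; apply: Iz; exact: (satI a).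
pose J K := saturation T (add_principal K z).
have JI K : idealP K -> idealP (J K).
  by move=> KI; apply: saturation_ideal => //; exact: add_principal_ideal.
have subJ K a : K a -> J K a by move=> /(sub_add_principal z)/(sub_saturation Tp).
have monoJ K K' : (forall a, K a -> K' a) -> forall a, J K a -> J K' a.
  by move=> KK' a [s Ts [i [r [Ki e]]]]; exists s => //; exists i, r; split=> //; exact: KK'.
have IHJ : forall N', (forall n, idealP (N' n)) -> (forall n, saturated T (N' n)) ->
    (forall n a, J I a -> N' n a) -> (forall n a, N' n.+1 a -> N' n a) -> stationary N'.
  apply: IH => //; [exact: JI | by move=> a; exact: subJ | | |].
  - by exists z; split=> //; apply: sub_saturation => //; exact: mem_add_principal.
  - exact: saturation_saturated.
  - by move=> a /I0sub; exact: subJ.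
have mono k n : (k <= n)%N -> forall a, N n a -> N k a.
  elim: n => [|n IHn]; first by rewrite leqn0 => /eqP->.
  by rewrite leq_eqVlt => /orP[/eqP->//|/IHn h] a /dec /h.
have [Nz|/existsNP[n1 Nz]] := pselect (forall n, N n z).
  apply: IHJ => // n a [s Ts sa]; apply: (satN n s) => //.
  by apply: add_principal_sub sa => // b; exact: IN.
have [n2 n2P] : stationary (fun n => J (N n)).
  apply: IHJ => // n; first exact: JI.
  - exact: saturation_saturated.
  - by apply: monoJ; exact: IN.
  - by apply: monoJ; exact: dec.
(* Past [n1] the element [z] is outside [N n]. In s a = b + r z with b in [N n.+1], saturation
   forces r into [T], so r z lies in [I] and s a in [N n.+1]. *)
exists (maxn n1 n2) => n; rewrite geq_max => /andP[n1n n2n] a Na.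
have [s Ts [b [r [Nb sa]]]] := n2P n n2n a (subJ _ _ Na).
have [_ ND NM] := NI n.
have Nrz : N n (r * z).
  rewrite (_ : r * z = s * a - b); last by rewrite sa; ring.
  by apply: idealB => //; [exact: NM | exact: dec].
have Tr : T r.
  by apply: contrapT => Tr; apply: Nz; apply: (mono _ _ n1n); exact: (satN n r).
apply: (satN n.+1 s) => //; rewrite sa.
by have [_ h _] := NI n.+1; apply: h => //; apply: IN; exact: TI.
Qed.

(** Nakayama's lemma in the localization at [T], with cleared denominators: [S] is the product of
    the [s i], and the determinant of [D] is a power of [S] modulo [T], hence outside [T]. *)
Lemma saturation_nakayama T K L x :
  primeP T -> idealP K -> idealP L -> saturated T L -> T x ->
  (forall a, K a -> exists s r, [/\ ~ T s, K r & L (s * a - x * r)]) ->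
  forall a, K a -> L a.
Proof.
move=> Tp KI LI satL Tx KL a Ka.
have [l [g [Kg gen]]] := noeth KI; have [c ->] := gen a Ka; apply: ideal_sum => // {c}.
have /choice[s /choice[r sr]] i : exists s r, [/\ ~ T s, K r & L (s * g i - x * r)].
  exact: KL.
have [TI T1 TM] := Tp; have [_ TD TMl] := TI; have [L0 LD LM] := LI.
pose S := \prod_i s i.
have TS : ~ T S.
  by rewrite /S; elim/big_ind: _ => // [u v Tu Tv /TM[]|i _] //; case: (sr i).
have /choice[C CP] i : exists C : 'I_l -> R, (\prod_(j | j != i) s j) * r i = \sum_j C j * g j.
  by apply: gen; have [_ _ h] := KI; apply: h; case: (sr i).
pose D : 'M[R]_l := S%:M - x *: \matrix_(i, j) C i j.
have TD' : ~ T (\det D).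
  move=> TdD; apply: TS; apply: (@primeX _ _ l) => //.
  rewrite -det_scalar -(subrK (\det D) (\det S%:M)); apply: (TD) => //.
  apply: (@det_congr _ (fun=> True)) => //.
  - by case: TI.
  - by move=> u; exact: idealN.
  - by move=> u v _; exact: TMl.
  - move=> i j; rewrite !mxE opprB addrC subrK.
    by rewrite mulrC; exact: TMl.
move=> i; apply: (satL (\det D)) => //.
apply: (@det_kill R R idfun R^o L) => // {}i.
rewrite (_ : \sum_j _ = S * g i - x * \sum_j C i j * g j).
  rewrite -CP /S (bigD1 i) //=; have [_ _ h] := sr i.
  rewrite (_ : _ - _ = (\prod_(j | j != i) s j) * (s i * g i - x * r i)); last by ring.
  exact: LM.
rewrite mulr_sumr.
have -> : S * g i = \sum_j (S%:M : 'M[R]_l) i j * g j.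
  rewrite (bigD1 i) //= mxE eqxx big1 ?addr0 // => j.
  by rewrite mxE eq_sym => /negbTE->; rewrite mul0r.
rewrite -sumrB; apply: eq_bigr => j _.
by rewrite !mxE /GRing.scale /= mulrBl mulrA.
Qed.

(** Krull's argument. [N n] is the ideal P + (y^n) saturated at Q. Minimality of T over P + (x)
    makes the ideals N n + (x) stationary at T, and Nakayama then gives that [N n] is contained in
    [N n.+1]. So y^n (s - r y) lies in P with s outside Q, which is absurd as y lies in Q but not in
    P. *)
Lemma principal_ideal_theorem P Q T x y :
  primeP P -> primeP Q -> primeP T ->
  (forall a, P a -> Q a) -> (forall a, Q a -> T a) ->
  Q y -> ~ P y -> T x -> ~ Q x ->
  (forall Q', primeP Q' -> (forall a, P a -> Q' a) -> Q' x ->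
     (forall a, Q' a -> T a) -> forall a, T a -> Q' a) ->
  False.
Proof.
move=> Pp Qp Tp PQ QT Qy Py Tx Qx Tmin.
have [PI _ PM] := Pp; have [QI Q1 QM] := Qp; have [TI T1 TM] := Tp.
pose N n := saturation Q (add_principal P (y ^+ n)).
have NI n : idealP (N n) by apply: saturation_ideal => //; exact: add_principal_ideal.
have Nsat n : saturated Q (N n) by exact: saturation_saturated.
have dec n a : N n.+1 a -> N n a.
  case=> s Qs [p [r [Pp' e]]]; exists s => //; exists p, (r * y); split=> //.
  by rewrite e exprS mulrA.
pose NT n := saturation T (add_principal (N n) x).
have [n nP] : stationary NT.
  apply: (@minimal_over_dcc T (add_principal P x) _ _ _
            (saturation T (add_principal P x))) => //.
  - exact: add_principal_ideal.
  - move=> Q' Q'p sub Q'T; apply: Tmin => //.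
      by move=> a Pa; apply: sub; exact: sub_add_principal.
    by apply: sub; exact: mem_add_principal.
  - by apply: saturation_ideal => //; exact: add_principal_ideal.
  - exact: saturation_saturated.
  - by move=> a; exact: sub_saturation.
  - by move=> k; apply: saturation_ideal => //; exact: add_principal_ideal.
  - by move=> k; exact: saturation_saturated.
  - move=> k a [s Ts [p [r [Pp' e]]]]; exists s => //; exists p, r; split=> //.
    by apply: sub_saturation => //; exact: sub_add_principal.
  - by move=> k a [s Ts [p [r [Pp' e]]]]; exists s => //; exists p, r; split=> //; exact: dec.
have NS : forall a, N n a -> N n.+1 a.
  apply: (@saturation_nakayama T _ _ x) => //.
    by move=> s a Ts; apply: Nsat => /QT.
  move=> a Na.
  have [s Ts [b [r [Nb sa]]]] : NT n.+1 a.
    by apply: nP => //; apply: sub_saturation => //; exact: sub_add_principal.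
  exists s, r; split=> //; last by rewrite sa (_ : _ - _ = b) //; ring.
  apply: (Nsat n x) => //; rewrite (_ : x * r = s * a - b); last by rewrite sa; ring.
  by apply: idealB => //; [case: (NI n) => _ _; exact | exact: dec].
have [|s Qs [p [r [Pp' e]]]] := NS (y ^+ n).
  by apply: sub_saturation => //; exact: mem_add_principal.
have : P (y ^+ n * (s - r * y)).
  by rewrite (_ : _ * _ = p) // mulrBr mulrC e exprS; ring.
case/PM => [/(primeX Pp)//|/PQ h]; apply: Qs.
rewrite -(subrK (r * y) s); have [_ QD QMl] := QI.
by apply: QD => //; exact: QMl.
Qed.

Lemma exists_intermediate_prime P Q T x :
  primeP P -> primeP Q -> primeP T ->
  (forall a, P a -> Q a) -> (forall a, Q a -> T a) ->
  (exists y, Q y /\ ~ P y) -> T x -> ~ Q x ->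
  exists Q', [/\ primeP Q', forall a, P a -> Q' a, Q' x, forall a, Q' a -> T a
    & exists t, T t /\ ~ Q' t].
Proof.
move=> Pp Qp Tp PQ QT [y [Qy Py]] Tx Qx; apply: contrapT => h.
apply: (principal_ideal_theorem Pp Qp Tp PQ QT Qy Py Tx Qx) => Q' Q'p PQ' Q'x Q'T a Ta.
by apply: contrapT => Q'a; apply: h; exists Q'; split=> //; exists a.
Qed.

End Ideals.

(** * Regular local rings *)

Section Dimension.
Variable R : comNzRingType.
Implicit Types (I J P Q T : R -> Prop) (C : nat -> R -> Prop).

Definition chainP n C :=
  (forall i, (i <= n)%N -> primeP (C i)) /\
  (forall i, (i < n)%N -> (forall a, C i a -> C i.+1 a) /\ exists a, C i.+1 a /\ ~ C i a).

Definition chain_set n C T := fun i => if (i <= n)%N then C i else T.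

Lemma chain_append n C T : chainP n C -> primeP T ->
  (forall a, C n a -> T a) -> (exists a, T a /\ ~ C n a) -> chainP n.+1 (chain_set n C T).
Proof.
move=> [Cp Cs] Tp CT sCT; split=> i; rewrite /chain_set.
  by case: ifP => // h _; exact: Cp.
rewrite ltnS => h; rewrite h; case: ifP => [h'|/negbT]; first exact: Cs.
rewrite -leqNgt => h'; have -> : i = n by apply/eqP; rewrite eqn_leq h.
by [].
Qed.

Lemma chain_prefix n C : chainP n.+1 C -> chainP n C.
Proof.
move=> [Cp Cs]; split=> i h; first by apply: Cp; exact: leqW.
by apply: Cs; exact: leqW.
Qed.

Definition chain_cons T C := fun i => if i is i'.+1 then C i' else T.

Lemma chain_prepend n C T : chainP n C -> primeP T ->
  (forall a, T a -> C 0%N a) -> (exists a, C 0%N a /\ ~ T a) -> chainP n.+1 (chain_cons T C).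
Proof.
move=> [Cp Cs] Tp TC sTC; split=> -[|i] //= h; [exact: (Cp i) | exact: (Cs i)].
Qed.

Hypothesis noeth : noetherianP R.

(** Passing to the quotient by [x] shortens a chain by at most one. From the top down, a prime that
    misses [x] is exchanged for one that contains it, by [exists_intermediate_prime]. *)
Lemma chain_through n C x : chainP n.+1 C -> C n.+1 x ->
  exists D, [/\ chainP n D, forall a, D n a <-> C n.+1 a,
                forall a, C 0%N a -> D 0%N a & D 0%N x].
Proof.
elim: n C => [|n IH] C Cc Cx.
  exists (fun=> C 1%N); split=> //; last exact: (Cc.2 0%N _).1.
  by split=> // i _; exact: (Cc.1 1%N).
have [Cp Cs] := Cc.
have [sub1 ex1] := Cs n.+1 (ltnSn _); have [sub0 ex0] := Cs n (leqnSn _).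
have [M [Mc Mx MT [t [Tt Mt]] M0]] : exists M, [/\ chainP n.+1 M, M n.+1 x,
    forall a, M n.+1 a -> C n.+2 a, exists t, C n.+2 t /\ ~ M n.+1 t
  & forall a, C 0%N a -> M 0%N a].
  have [Cx1|Cx1] := pselect (C n.+1 x).
    by exists C; split=> //; exact: chain_prefix.
  have [Q [Qp PQ Qx QT Qt]] : exists Q', [/\ primeP Q', forall a, C n a -> Q' a,
      Q' x, forall a, Q' a -> C n.+2 a & exists t, C n.+2 t /\ ~ Q' t].
    apply: (exists_intermediate_prime noeth (Q := C n.+1)) => //; apply: Cp => //.
    by rewrite leqW.
  exists (chain_set n C Q); split.
  - apply: chain_append => //; first by do 2!apply: chain_prefix.
    by exists x; split=> // /sub0.
  - by rewrite /chain_set ltnn.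
  - by move=> a; rewrite /chain_set ltnn; exact: QT.
  - by rewrite /chain_set ltnn.
  - by move=> a; rewrite /chain_set.
have [D [Dc DM D0 Dx]] := IH M Mc Mx.
exists (chain_set n D (C n.+2)); split.
- apply: chain_append => //; first exact: Cp.
    by move=> a /DM; exact: MT.
  by exists t; split=> // /DM.
- by move=> a; rewrite /chain_set ltnn.
- by move=> a /M0/D0; rewrite /chain_set.
- by rewrite /chain_set.
Qed.

Variable m : R -> Prop.

Definition local_at := primeP m /\ forall x, ~ m x -> exists y, y * x = 1.

Hypothesis mloc : local_at.

Lemma local_rad x : m x -> exists y, y * (1 - x) = 1.
Proof.
move=> mx; apply: mloc.2 => m1; have [[_ mD _] nm1 _] := mloc.1.
by apply: nm1; rewrite -(subrK x 1); exact: mD.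
Qed.

Lemma ideal_sub_local I : idealP I -> ~ I 1 -> forall a, I a -> m a.
Proof.
move=> [_ _ IM] I1 a Ia; apply: contrapT => /mloc.2[y ya].
by apply: I1; rewrite -ya; exact: IM.
Qed.

Definition add_all I (xs : seq R) := foldl (@add_principal R) I xs.

(** Stronger than the usual notion: each ideal to which an element is adjoined is prime, so that
    regularity of [x] only means that [x] is outside it, and the last ideal is [m]. *)
Fixpoint regular_sequence I (xs : seq R) : Prop :=
  if xs is x :: xs' then
    [/\ primeP I, ~ I x, m x & regular_sequence (add_principal I x) xs']
  else forall a, I a <-> m a.

Lemma prime_chain_regular (xs : seq R) I n C :
  idealP I -> (forall a, I a -> m a) -> {in xs, forall x, m x} ->
  (forall a, m a -> add_all I xs a) ->
  chainP n C -> (forall a, I a -> C 0%N a) ->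
  (n <= size xs)%N /\ (n = size xs -> regular_sequence I xs).
Proof.
elim: xs I n C => [|x xs IH] I n C II Im xsm gen Cc IC /=.
  have Ieq a : I a <-> m a by split; [exact: Im | exact: gen].
  split=> //; case: n Cc => // n Cc.
  have [Cp Cs] := Cc; have [sub [a [C1a C0a]]] := Cs 0%N isT.
  exfalso; apply: C0a; apply/IC/Ieq; have [CI C11 _] := Cp 1%N isT.
  exact: (ideal_sub_local CI C11).
case: n Cc => // n Cc.
have mx : m x by apply: xsm; exact: mem_head.
have [Cp Cs] := Cc.
have Cm i a : (i <= n.+1)%N -> C i a -> m a.
  by move=> /Cp[CI C1 _]; exact: ideal_sub_local.
have [D [Dc _ D0 Dx]] : exists D, [/\ chainP n D, forall a, D n a <-> m a,
                forall a, C 0%N a -> D 0%N a & D 0%N x].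
  have [sub [a [Ca1 Ca]]] := Cs n (ltnSn n).
  have := @chain_through n (chain_set n C m) x _ _; rewrite {2 3}/chain_set ltnn /=.
  case=> [|//|D]; last by rewrite /chain_set leq0n; exists D.
  apply: chain_append => //; [exact: chain_prefix | exact: mloc.1 | |].
    by move=> b; apply: Cm.
  by exists a; split=> //; exact: (Cm n.+1).
pose I' := add_principal I x.
have I'I : idealP I' by exact: add_principal_ideal.
have ID : forall k E, chainP k E -> (forall a, I' a -> E 0%N a) ->
    (k <= size xs)%N /\ (k = size xs -> regular_sequence I' xs).
  move=> k E Ec I'E; apply: (IH I' k E) => //.
    by apply: add_principal_sub => //; case: mloc.1.
  by move=> y yxs; apply: xsm; rewrite inE yxs orbT.
have prime_ideal k E : chainP k E -> idealP (E 0%N) by case=> /(_ 0%N isT)[].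
have I'D : forall a, I' a -> D 0%N a.
  by apply: add_principal_sub => //; [exact: prime_ideal Dc | move=> a /IC/D0].
have [le reg] := ID _ _ Dc I'D; split=> // -[eqn].
(* Otherwise all of [C], which is longer than [xs], would be a chain over I + Rx. *)
have C0x : ~ C 0%N x.
  move=> C0x; have [] := ID _ _ Cc; last by rewrite eqn ltnn.
  by apply: add_principal_sub => //; exact: prime_ideal Cc.
(* Otherwise [I'] is a prime strictly below [D 0], and prepending it makes the chain too long. *)
have D0I' : forall a, D 0%N a -> I' a.
  move=> a Da; apply: contrapT => I'a.
  have I'p : primeP I'.
    have := reg eqn; case: (xs) => [I'm|? ? []//].
    exfalso; apply/I'a/I'm; have [Dp _] := Dc.
    by have [DI D1 _] := Dp 0%N isT; exact: (ideal_sub_local DI D1).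
  have [] := ID n.+1 (chain_cons I' D); last by rewrite eqn ltnn.
    by apply: chain_prepend => //; exists a.
  by [].
have C0p : primeP (C 0%N) by exact: Cp.
have [C0I C01 C0M] := C0p.
(* An element i + r x of [C 0] has r in [C 0], since x is not there. So [C 0] is contained in I + x
   C 0, and Nakayama's lemma gives I = C 0. *)
have C0sub : forall a, C 0%N a -> I a.
  apply: (@saturation_nakayama R noeth m _ _ x) => //; first exact: mloc.1.
    move=> s a /mloc.2[t ts] Isa; rewrite -[a]mul1r -ts -mulrA.
    by have [_ _ IM] := II; exact: IM.
  move=> a Ca; have [i [r [Ii e]]] := D0I' _ (D0 _ Ca).
  exists 1, r; split; first by case: mloc.1.
    have : C 0%N (r * x).
      rewrite (_ : r * x = a - i); last by rewrite e; ring.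
      by apply: idealB => //; exact: IC.
    by case/C0M.
  by rewrite e (_ : _ - _ = i) //; ring.
have Ieq : I = C 0%N.
  by apply/funext => a; apply/propext; split; [exact: IC | exact: C0sub].
by split=> //; rewrite ?Ieq // -Ieq; exact: reg.
Qed.

Lemma mem_add_all I n (g : 'I_n -> R) (c : 'I_n -> R) (s : seq 'I_n) i :
  I i -> add_all I [seq g j | j <- s] (i + \sum_(j <- s) c j * g j).
Proof.
elim: s I i => [|j s IH] I i Ii /=; first by rewrite big_nil addr0.
by rewrite big_cons addrA; apply: IH; exists i, (c j).
Qed.

End Dimension.

Lemma noetherian_noetherianP (R : comNzRingType) : noetherian R -> noetherianP R.
Proof.
move=> Rn I [I0 ID IM].
pose p : {pred R} := fun x => `[< I x >].
have pI : is_ideal p.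
  split; first exact/asboolP.
  by move=> a x y /asboolP Ix /asboolP Iy; apply/asboolP; apply: ID => //; exact: IM.
have [n [g gp gen]] := Rn p pI; exists n, g; split=> [i|x Ix]; first exact/asboolP/gp.
by apply: gen; exact/asboolP.
Qed.

(** By noetherian induction every proper ideal lies in a maximal one, which is [m] by uniqueness;
    this is applied to the multiples of a nonunit. *)
Lemma is_maximal_units (R : comNzRingType) (m : {pred R}) :
  noetherian R -> is_maximal m -> (forall m' : {pred R}, is_maximal m' -> m' =i m) ->
  forall x, x \notin m -> exists y, y * x = 1.
Proof.
move=> /noetherian_noetherianP Rn mmax muniq x xm; apply: contrapT => nu.
have := @noetherian_ind R Rn (fun I => ~ I 1 -> forall a, I a -> a \in m).
move=> ind; move/negP: xm; apply.
apply: (ind _ (fun a => exists y, a = y * x)).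
- move=> {ind nu x} I [I0 ID IM] IH I1 a Ia.
  pose p : {pred R} := fun x => `[< I x >].
  have pI : idealr_closed p.
    split; [exact/asboolP | exact/asboolP |] => b u v /asboolP Iu /asboolP Iv.
    by apply/asboolP; apply: ID => //; exact: IM.
  have [pmax|npmax] := pselect (is_maximal p).
    by rewrite -(muniq p pmax); exact/asboolP.
  have [J [JI pJ Jp]] : exists J, [/\ idealr_closed J, {subset p <= J} & ~ {subset J <= p}].
    apply: contrapT => h; apply: npmax; split=> // J JI pJ.
    by apply: contrapT => Jp; apply: h; exists J.
  have [J0 J1 JM] := JI.
  apply: (IH (fun b => b \in J)) => //.
  + split=> // [u v Ju Jv|b u Ju]; first by rewrite -[u]mul1r JM.
    by rewrite -[b * u]addr0 JM.
  + by move=> b Ib; apply: pJ; exact/asboolP.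
  + apply: contrapT => h; apply: Jp => b Jb; apply/asboolP; apply: contrapT => Ib.
    by apply: h; exists b.
  + by rewrite (negbTE J1).
  + by apply: pJ; exact/asboolP.
- split; first by exists 0; rewrite mul0r.
    by move=> _ _ [y ->] [z ->]; exists (y + z); rewrite mulrDl.
  by move=> a _ [y ->]; exists (a * y); rewrite mulrA.
- by case=> y /esym yx; apply: nu; exists y.
- by exists 1; rewrite mul1r.
Qed.

(** Regularity provides a prime chain as long as the list of generators of the maximal ideal: the
    case of equality in [prime_chain_regular] over the zero ideal. *)
Lemma regular_local_sequence (R : comNzRingType) : regular_local R ->
  noetherianP R /\ exists m : R -> Prop, local_at m /\
    exists xs, regular_sequence m (fun a => a = 0) xs.
Proof.
move=> [Rn [mp [mmax muniq [n [[[C Cp Cs] _] [g gm gen] _]]]]].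
have noeth := noetherian_noetherianP Rn; split=> //.
have units := is_maximal_units Rn mmax muniq.
have [[m0 m1 mM] _] := mmax.
have mpid : idealP (fun a => a \in mp).
  split=> // [u v mu mv|b u mu]; first by rewrite -[u]mul1r mM.
  by rewrite -[b * u]addr0 mM.
have mpr : primeP (fun a => a \in mp).
  split=> //; first by rewrite (negbTE m1).
  move=> x y xy; apply/orP; apply: contraT; rewrite negb_or => /andP[/units[u ux] /units[v vy]].
  case/negP: m1; have -> : 1 = u * v * (x * y).
    by rewrite mulrACA ux vy mulr1.
  by have [_ _] := mpid; exact.
have mloc : local_at (fun a => a \in mp) by split=> // x /negP; exact: units.
exists (fun a => a \in mp); split=> //; pose xs := [seq g j | j <- enum 'I_n].
have Cc : chainP n (fun i a => a \in C i).
  split=> [i /Cp[[C0 C1 CM] Cpr]|i /Cs[sub [x xC xnC]]].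
    split; last by move=> x y /Cpr/orP.
      split=> // [u v Cu Cv|b u Cu]; first by rewrite -[u]mul1r CM.
      by rewrite -[b * u]addr0 CM.
    by rewrite (negbTE C1).
  by split=> //; exists x; split=> //; exact/negP.
have sz : size xs = n by rewrite size_map size_enum_ord.
exists xs; have := @prime_chain_regular R noeth _ mloc xs (fun a => a = 0) n _ _ _ _ _ Cc.
rewrite sz => h; apply h => //.
- split=> // [_ _ -> ->|a _ ->]; first by rewrite addr0.
  by rewrite mulr0.
- by move=> a ->.
- by move=> _ /mapP[j _ ->].
- move=> a /gen[c ->]; rewrite -[X in add_all _ _ X]add0r.
  by rewrite -big_enum; exact: mem_add_all.
- by move=> a ->; have [[]] := Cp 0%N isT.
Qed.

(** * The residue field of a local ring *)

Definition residue_map (R : comNzRingType) (m : R -> Prop) (k : fieldType)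
    (p : {rmorphism R -> k}) :=
  (forall x, p x = 0 <-> m x) /\ (forall y, exists x, p x = y).

Section ResidueField.
Variables (R : comNzRingType) (m : R -> Prop) (mloc : local_at m).

Definition local_pred : {pred R} := fun x => `[< m x >].

Lemma local_pred_ideal : idealr_closed local_pred.
Proof.
have [[[m0 mD mM] m1 _] _] := mloc.
split; [exact/asboolP | exact/asboolP | move=> a u v /asboolP mu /asboolP mv].
by apply/asboolP; apply: mD => //; exact: mM.
Qed.
HB.instance Definition _ := isIdealr.Build R local_pred local_pred_ideal.

Definition residue_quot := {ideal_quot local_pred}.
HB.instance Definition _ := GRing.ComNzRing.on residue_quot.

Definition residue_pi (x : R) : residue_quot := \pi_{ideal_quot local_pred} x.

Lemma residue_piD : zmod_morphism residue_pi.
Proof. by move=> x y; rewrite /residue_pi !piE. Qed.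
HB.instance Definition _ := GRing.isZmodMorphism.Build R residue_quot residue_pi residue_piD.
Lemma residue_piM : monoid_morphism residue_pi.
Proof. by split=> [|x y]; rewrite /residue_pi !piE. Qed.
HB.instance Definition _ := GRing.isMonoidMorphism.Build R residue_quot residue_pi residue_piM.

Lemma residue_pi_eq0 x : residue_pi x = 0 <-> m x.
Proof.
rewrite -(rmorph0 residue_pi) /residue_pi; split.
  by move/eqP; rewrite -Quotient.idealrBE subr0 => /asboolP.
by move=> mx; apply/eqP; rewrite -Quotient.idealrBE subr0; exact/asboolP.
Qed.

Lemma residue_pi_surj y : exists x, residue_pi x = y.
Proof. by exists (repr y); rewrite /residue_pi reprK. Qed.

Lemma residue_field : exists (k : fieldType) (p : {rmorphism R -> k}), residue_map m p.
Proof.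
have /choice[inv invP] (x : residue_quot) :
    exists y : residue_quot, (x != 0 -> y * x = 1) /\ (x = 0 -> y = 0).
  have [->|x0] := eqVneq x 0; first by exists 0.
  have [a ax] := residue_pi_surj x.
  have [|b ba] := mloc.2 a; first by rewrite -residue_pi_eq0 ax; exact/eqP.
  exists (residue_pi b); split=> [_|/eqP]; last by rewrite (negbTE x0).
  by rewrite -ax -rmorphM ba rmorph1.
pose fact := GRing.ComNzRing_isField.Build residue_quot
  (fun x => (invP x).1) ((invP 0).2 erefl).
pose k : fieldType := HB.pack_for fieldType residue_quot fact.
exists k, (residue_pi : {rmorphism R -> residue_quot}); split.
  exact: residue_pi_eq0.
exact: residue_pi_surj.
Qed.

End ResidueField.

(** * Free resolutions *)

Section Resolutions.
Variable A : comPzRingType.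
Implicit Types (I : A -> Prop).

Definition mx_in I p q (M : 'M[A]_(p, q)) := forall i j, I (M i j).

(** Matrices over A taken modulo [I] stand for matrices over A / I, so that [I] can vary along a
    regular sequence without quotient rings. *)
Definition row_kernel I p q (G : 'M[A]_(p, q)) p' (G' : 'M[A]_(p', p)) :=
  mx_in I (G' *m G) /\
  forall c : 'rV_p, mx_in I (c *m G) -> exists d : 'rV_p', mx_in I (c - d *m G').

(* A free resolution of length [l] over [A / I]
   of the cokernel of [G], acting on row vectors. *)
Fixpoint resolution I l p q (G : 'M[A]_(p, q)) : Prop :=
  if l is l'.+1 then
    exists p' (G' : 'M[A]_(p', p)), row_kernel I G G' /\ resolution I l' G'
  else forall c : 'rV_p, mx_in I (c *m G) -> mx_in I c.

End Resolutions.

Section MxIn.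
Variables (A : comNzRingType) (I : A -> Prop).
Hypothesis II : idealP I.

Lemma mx_in0 p q : mx_in I (0 : 'M[A]_(p, q)).
Proof. by move=> i j; rewrite mxE; case: II. Qed.

Lemma mx_inD p q (M N : 'M[A]_(p, q)) : mx_in I M -> mx_in I N -> mx_in I (M + N).
Proof. by move=> IM IN i j; rewrite mxE; have [_ ID _] := II; exact: ID. Qed.

Lemma mx_inN p q (M : 'M[A]_(p, q)) : mx_in I M -> mx_in I (- M).
Proof. by move=> IM i j; rewrite mxE; exact: idealN. Qed.

Lemma mx_inB p q (M N : 'M[A]_(p, q)) : mx_in I M -> mx_in I N -> mx_in I (M - N).
Proof. by move=> IM IN; apply: mx_inD => //; exact: mx_inN. Qed.

Lemma mx_inMr p q r (M : 'M[A]_(p, q)) (N : 'M[A]_(q, r)) :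
  mx_in I N -> mx_in I (M *m N).
Proof. by move=> IN i j; rewrite mxE; apply: ideal_sum. Qed.

Lemma mx_inMl p q r (M : 'M[A]_(p, q)) (N : 'M[A]_(q, r)) :
  mx_in I M -> mx_in I (M *m N).
Proof.
by move=> IM i j; rewrite mxE; under eq_bigr do rewrite mulrC; apply: ideal_sum.
Qed.

Lemma mx_in_trans p q (M N P : 'M[A]_(p, q)) :
  mx_in I (M - N) -> mx_in I (N - P) -> mx_in I (M - P).
Proof. by move=> MN NP; rewrite -(subrK N M) -addrA; exact: mx_inD. Qed.

Lemma mx_in_congr p q (M N : 'M[A]_(p, q)) : mx_in I (M - N) -> mx_in I N -> mx_in I M.
Proof. by move=> MN NI; rewrite -(subrK N M); exact: mx_inD. Qed.

Lemma mx_in_congrC p q (M N : 'M[A]_(p, q)) : mx_in I (M - N) -> mx_in I (N - M).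
Proof. by move=> h; rewrite -opprB; exact: mx_inN. Qed.

Lemma mx_in_add_principal x p q (M : 'M[A]_(p, q)) :
  mx_in (add_principal I x) M <-> exists N, mx_in I (M - x *: N).
Proof.
split=> [h|[N h] i j]; last first.
  exists (M i j - x * N i j), (N i j); split; last by ring.
  by have := h i j; rewrite !mxE.
have /choice[r rP] (ij : 'I_p * 'I_q) : exists r, I (M ij.1 ij.2 - x * r).
  have [a [r [Ia ->]]] := h ij.1 ij.2; exists r.
  by rewrite (_ : _ - _ = a) //; ring.
by exists (\matrix_(i, j) r (i, j)) => i j; rewrite !mxE; exact: (rP (i, j)).
Qed.

Lemma resolution_congr l p q (G H : 'M[A]_(p, q)) :
  mx_in I (G - H) -> resolution I l G -> resolution I l H.
Proof.
move=> GH; have eqv r (c : 'M_(r, p)) : mx_in I (c *m G) <-> mx_in I (c *m H).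
  have h : mx_in I (c *m G - c *m H) by rewrite -mulmxBr; exact: mx_inMr.
  by split; apply: mx_in_congr => //; exact: mx_in_congrC.
case: l => [|l] /=; first by move=> h c /eqv; exact: h.
move=> [p' [G' [[h1 h2] h3]]]; exists p', G'; split=> //; split; first exact/eqv.
by move=> c /eqv; exact: h2.
Qed.

End MxIn.

(** * Lifting resolutions along a regular element *)

Section Lift.
Variables (A : comNzRingType) (I : A -> Prop) (x : A).
Hypothesis II : idealP I.
Local Notation Ix := (add_principal I x).

Hypothesis x_regular : forall a, I (x * a) -> I a.
Hypothesis kernels_fg : forall p q (G : 'M[A]_(p, q)),
  exists p' (G' : 'M[A]_(p', p)), row_kernel I G G'.
(** This form of Nakayama's lemma is assumed here because it is supplied in two ways: for x in the
    maximal ideal of a noetherian local ring, and for the variable of R[[t]] by successive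
    approximation. *)
Hypothesis kernel_nakayama : forall p q (G : 'M[A]_(p, q)) p' (G' : 'M[A]_(p', p)),
  mx_in I (G' *m G) ->
  (forall c : 'rV_p, mx_in I (c *m G) -> exists d c',
     mx_in I (c' *m G) /\ mx_in I (c - d *m G' - x *: c')) ->
  forall c : 'rV_p, mx_in I (c *m G) -> exists d : 'rV_p', mx_in I (c - d *m G').

Let mx_in_scale p q (M : 'M[A]_(p, q)) : mx_in I (x *: M) -> mx_in I M.
Proof. by move=> h i j; apply: x_regular; have := h i j; rewrite mxE. Qed.

(** The cokernel of [G] over A / I has no x-torsion. *)
Definition row_saturated p q (G : 'M[A]_(p, q)) :=
  forall (c : 'rV_p) (d : 'rV_q), mx_in I (c *m G - x *: d) ->
    exists e : 'rV_p, mx_in I (d - e *m G).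

Lemma row_kernel_saturated p q (G : 'M[A]_(p, q)) p' (G' : 'M[A]_(p', p)) :
  row_kernel I G G' -> row_saturated G'.
Proof.
move=> [G'G span] c d cd; apply: span; apply: mx_in_scale.
rewrite scalemxAl; apply: (mx_in_congr II (N := c *m G' *m G)).
  rewrite -mulmxBl; apply: (mx_inMl II); exact: mx_in_congrC.
by rewrite -mulmxA; exact: mx_inMr.
Qed.

(** Without x-torsion in the cokernel, syzygies modulo x lift: G' G is x D modulo I, saturation
    gives D = E G, and H = G' - x E kills G. By Nakayama's lemma [H] generates the kernel. *)
Lemma resolution_lift l p q (G : 'M[A]_(p, q)) :
  row_saturated G -> resolution Ix l G -> resolution I l G.
Proof.
have sub r s (M : 'M[A]_(r, s)) : mx_in I M -> mx_in Ix M.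
  by move=> h i j; exact: sub_add_principal.
elim: l p q G => [|l IH] p q G sat /=.
  (* The kernel is x times itself here, so Nakayama's lemma is applied with an empty list of
     generators. *)
  move=> inj c cG; have := @kernel_nakayama p q G 0 0 _ _ c cG; case.
  - by rewrite mul0mx; exact: mx_in0.
  - move=> {cG}c cG; have /mx_in_add_principal[c' cc'] := inj c (sub _ _ _ cG).
    exists 0, c'; rewrite mul0mx subr0; split=> //; apply: mx_in_scale.
    rewrite scalemxAl; apply: (mx_in_congr II) cG.
    by rewrite -mulmxBl; apply: (mx_inMl II); exact: mx_in_congrC.
  - by move=> d; rewrite mulmx0 subr0.
move=> [p' [G' [[G'G span] res]]].
have /mx_in_add_principal[D D1] := G'G.
have /choice[E E1] i : exists e : 'rV_p, mx_in I (row i D - e *m G).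
  apply: (sat (row i G')); rewrite -row_mul => a b.
  by have := D1 i b; rewrite !mxE.
pose H := G' - x *: \matrix_i E i.
have HG : mx_in I (H *m G).
  rewrite mulmxBl -scalemxAl; apply: (mx_in_trans II D1) => i j.
  have := E1 i 0 j; rewrite -{1}(rowK E i) -row_mul !mxE => h.
  by rewrite -mulrBr; have [_ _ IM] := II; exact: IM.
have kerH : row_kernel I G H.
  split=> //; apply: kernel_nakayama => // c cG.
  have [d /mx_in_add_principal[c'' cc'']] := span c (sub _ _ _ cG).
  pose c' := c'' + d *m \matrix_i E i.
  have cc' : mx_in I (c - d *m H - x *: c').
    move: cc''; congr (mx_in I _); rewrite mulmxBr -scalemxAr /c' scalerDr.
    by apply/rowP => j; rewrite !mxE; ring.
  exists d, c'; split=> //; apply: mx_in_scale; rewrite scalemxAl.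
  apply: (mx_in_congr II (N := (c - d *m H) *m G)).
    by rewrite -mulmxBl; apply: (mx_inMl II); exact: mx_in_congrC.
  by rewrite mulmxBl; apply: (mx_inB II) => //; rewrite -mulmxA; exact: mx_inMr.
exists p', H; split=> //; apply: IH; first exact: row_kernel_saturated kerH.
apply: resolution_congr res; first exact: add_principal_ideal.
apply/mx_in_add_principal; exists (\matrix_i E i); rewrite subKr subrr; exact: mx_in0.
Qed.

(** A cokernel may have x-torsion, but the cokernel of its syzygy matrix has none; the additional
    step pays for this. *)
Lemma resolution_step l :
  (forall p q (G : 'M[A]_(p, q)), resolution Ix l G) ->
  forall p q (G : 'M[A]_(p, q)), resolution I l.+1 G.
Proof.
move=> res p q G; have [p' [G' kerG]] := kernels_fg G.
by exists p', G'; split=> //; apply: resolution_lift => //; exact: row_kernel_saturated kerG.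
Qed.

End Lift.

Notation zero_ideal := (fun a => a = 0).

Lemma zero_idealP (A : comNzRingType) : @idealP A zero_ideal.
Proof. by split=> // [_ _ -> ->|a _ ->]; rewrite ?addr0 ?mulr0. Qed.

Lemma mx_in_zero (A : comPzRingType) p q (M : 'M[A]_(p, q)) :
  mx_in zero_ideal M <-> M = 0.
Proof.
split=> [h|-> i j]; last by rewrite mxE.
by apply/matrixP => i j; rewrite h mxE.
Qed.

Section Transfer.
Variables (A B : comPzRingType) (I : A -> Prop) (f : {rmorphism A -> B}).
Hypothesis f_ker : forall a, f a = 0 <-> I a.
Hypothesis f_surj : forall b, exists a, f a = b.

Lemma map_mx_in p q (M : 'M[A]_(p, q)) : map_mx f M = 0 <-> mx_in I M.
Proof.
split=> [/matrixP h i j|h]; first by apply/f_ker; have := h i j; rewrite !mxE.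
by apply/matrixP => i j; rewrite !mxE; apply/f_ker.
Qed.

Lemma map_mx_lift p q (M : 'M[B]_(p, q)) : exists N, map_mx f N = M.
Proof.
have /choice[s sK] := f_surj.
by exists (map_mx s M); apply/matrixP => i j; rewrite !mxE sK.
Qed.

Lemma resolution_pullback l p q (G : 'M[A]_(p, q)) :
  resolution zero_ideal l (map_mx f G) -> resolution I l G.
Proof.
elim: l p q G => [|l IH] p q G /=.
  move=> inj c /map_mx_in h; apply/map_mx_in/mx_in_zero/inj/mx_in_zero.
  by rewrite -map_mxM.
move=> [p' [G0 [[h1 h2] h3]]]; have [G' G'E] := map_mx_lift G0; exists p', G'.
split; last by apply: IH; rewrite G'E.
split=> [|c /map_mx_in cG].
  by apply/map_mx_in; rewrite map_mxM G'E; exact/mx_in_zero.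
have [|d0 h] := h2 (map_mx f c); first by apply/mx_in_zero; rewrite -map_mxM.
have [d dE] := map_mx_lift d0; exists d; apply/map_mx_in.
by rewrite map_mxB map_mxM dE G'E; exact/mx_in_zero.
Qed.

End Transfer.

Lemma field_resolution (k : fieldType) p q (G : 'M[k]_(p, q)) :
  resolution zero_ideal 1 G.
Proof.
exists (\rank (kermx G)), (row_base (kermx G)); split.
  split=> [|c /mx_in_zero cG].
    by apply/mx_in_zero/sub_kermxP; rewrite eq_row_base.
  have /submxP[d ->] : (c <= row_base (kermx G))%MS by rewrite eq_row_base; exact/sub_kermxP.
  by exists d; apply/mx_in_zero; rewrite subrr.
move=> c /mx_in_zero h; apply/mx_in_zero; apply: (row_free_inj (row_base_free (kermx G))).
by rewrite h mul0mx.
Qed.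

(** * Row modules over noetherian rings, and resolutions over regular local rings *)

Section NoetherianRows.
Variable R : comNzRingType.
Hypothesis noeth : noetherianP R.

Definition row_submodule p (N : 'rV[R]_p -> Prop) :=
  [/\ N 0, forall x y, N x -> N y -> N (x + y) & forall a x, N x -> N (a *: x)].

Lemma row_submodule_mul p (N : 'rV[R]_p -> Prop) q (G : 'M_(q, p)) (d : 'rV_q) :
  row_submodule N -> (forall i, N (row i G)) -> N (d *m G).
Proof.
move=> [N0 ND NZ] NG; rewrite mulmx_sum_row; elim/big_ind: _ => // i _; exact: NZ.
Qed.

(** The first coordinate is split off: generators of the ideal of first entries are lifted, and
    induction generates the elements with first entry 0. *)
Lemma row_submodule_fg p (N : 'rV[R]_p -> Prop) : row_submodule N ->
  exists q (G : 'M_(q, p)), (forall i, N (row i G)) /\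
    forall c, N c -> exists d, c = d *m G.
Proof.
elim: p N => [|p IH] N NN.
  exists 0, 0; split=> [[]//|c _]; exists 0; rewrite mulmx0.
  by apply/rowP => -[].
have [N0 ND NZ] := NN.
pose I a := exists2 c, N c & c 0 0 = a.
have II : idealP I.
  split; first by exists 0; rewrite ?mxE.
    by move=> _ _ [c Nc <-] [d Nd <-]; exists (c + d); [exact: ND | rewrite mxE].
  by move=> a _ [c Nc <-]; exists (a *: c); [exact: NZ | rewrite mxE].
have [n [g [gI gen]]] := noeth II.
have /choice[c cP] i : exists c : 'rV[R]_(1 + p), N c /\ c 0 0 = g i.
  by have [c Nc cg] := gI i; exists c.
have [|q [G [NG spanG]]] := IH (fun c' => N (row_mx (0 : 'rV_1) c' : 'rV_(1 + p))).
  split=> [|u v Nu Nv|a u Nu]; first by rewrite row_mx0.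
    by rewrite -[0](addr0 0) -add_row_mx; exact: ND.
  by rewrite -(scaler0 _ a) -scale_row_mx; exact: NZ.
pose C : 'M_(n, 1 + p) := \matrix_i c i.
have NC i : N (row i C) by rewrite rowK; exact: (cP i).1.
exists (n + q)%N, (col_mx C (row_mx (0 : 'cV_q) G)); split.
  move=> i; rewrite -(splitK i); case: split => {}i /=; first by rewrite rowKu.
  rewrite rowKd (_ : row i _ = row_mx 0 (row i G) :> 'rV_(1 + p)) //.
  by rewrite (@row_row_mx _ q 1 p) row0.
move=> v Nv; have [|d vd] := gen (v 0 0); first by exists v.
pose w : 'rV_(1 + p) := v - (\row_i d i) *m C.
have Nw : N w.
  by apply: ND => //; rewrite -scaleN1r; apply: NZ; exact: row_submodule_mul.
have wE : w = row_mx 0 (rsubmx w).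
  rewrite -{1}(hsubmxK w); congr row_mx; apply/rowP => i; rewrite !mxE.
  rewrite (_ : lshift p i = 0); last by apply: val_inj; case: i => -[].
  rewrite vd; apply/eqP; rewrite subr_eq0; apply/eqP; apply: eq_bigr => j _.
  by rewrite !mxE (cP j).2.
have [|e eE] := spanG (rsubmx w); first by rewrite -wE.
exists (row_mx (\row_i d i) e); rewrite mul_row_col -(subrK ((\row_i d i) *m C) v) addrC.
by congr (_ + _); rewrite -/w wE eE (@mul_mx_row _ _ _ 1 p) mulmx0.
Qed.

Lemma noetherian_kernel_fg I p q (G : 'M[R]_(p, q)) : idealP I ->
  exists p' (G' : 'M[R]_(p', p)), row_kernel I G G'.
Proof.
move=> II.
have [|p' [G' [KG' span]]] := @row_submodule_fg p (fun c => mx_in I (c *m G)).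
  split=> [|x y Kx Ky|a x Kx]; first by rewrite mul0mx; exact: mx_in0.
    by rewrite mulmxDl; exact: mx_inD.
  by rewrite -scalemxAl -mul_scalar_mx; exact: mx_inMr.
exists p', G'; split.
  by move=> i j; have := KG' i 0 j; rewrite -row_mul mxE.
by move=> c /span[d ->]; exists d; rewrite subrr; exact: mx_in0.
Qed.

Variable m : R -> Prop.
Hypothesis mloc : local_at m.

Lemma local_kernel_nakayama I x p q (G : 'M[R]_(p, q)) p' (G' : 'M[R]_(p', p)) :
  idealP I -> m x ->
  mx_in I (G' *m G) ->
  (forall c : 'rV_p, mx_in I (c *m G) -> exists d c',
     mx_in I (c' *m G) /\ mx_in I (c - d *m G' - x *: c')) ->
  forall c : 'rV_p, mx_in I (c *m G) -> exists d : 'rV_p', mx_in I (c - d *m G').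
Proof.
move=> II mx G'G h.
have [|n [K [KG span]]] := @row_submodule_fg p (fun c => mx_in I (c *m G)).
  split=> [|u v Ku Kv|a u Ku]; first by rewrite mul0mx; exact: mx_in0.
    by rewrite mulmxDl; exact: mx_inD.
  by rewrite -scalemxAl -mul_scalar_mx; exact: mx_inMr.
pose N (c : 'rV[R]_p) := exists d : 'rV_p', mx_in I (c - d *m G').
have NN : row_submodule N.
  split; first by exists 0; rewrite mul0mx subrr; exact: mx_in0.
    move=> u v [d du] [e ev]; exists (d + e); rewrite mulmxDl opprD addrACA.
    exact: mx_inD.
  move=> a u [d du]; exists (a *: d); rewrite -scalemxAl -scalerBr -mul_scalar_mx.
  exact: mx_inMr.
have [N0 ND NZ] := NN.
have /choice[C CP] i : exists C : 'rV_n, N (row i K - x *: (C *m K)).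
  have [d [c' [Kc' hc]]] := h _ (KG i); have [C cE] := span _ Kc'.
  by exists C, d; rewrite -cE addrAC.
suff NK i : N (row i K).
  by move=> c /span[d ->]; exact: (@row_submodule_mul p N).
have [[m0 mD mM] _ _] := mloc.1.
apply: (@nakayama R R idfun 'rV[R]_p N N0 ND NZ m m0 mD mM (local_rad mloc) _
  (fun i => row i K) (fun i j => x * C i 0 j)) => {}i.
  by move=> j; rewrite mulrC; exact: mM.
move: (CP i); rewrite mulmx_sum_row scaler_sumr; congr (N (_ - _)).
by apply: eq_bigr => j _; rewrite scalerA.
Qed.

(** The length is 1 over the residue field, and each step from I + Rx back to I adds one. *)
Lemma regular_sequence_resolution xs I : idealP I -> regular_sequence m I xs ->
  forall p q (G : 'M[R]_(p, q)), resolution I (size xs).+1 G.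
Proof.
elim: xs I => [|x xs IH] I II.
  move=> Im p q G; have [k [f [fker fsurj]]] := residue_field mloc.
  apply: (@resolution_pullback _ _ I f) => //; last exact: field_resolution.
  by move=> a; rewrite fker; split=> /Im.
move=> [[_ _ Ip] Ix mx reg].
apply: (resolution_step II (x := x)).
- by move=> a /Ip[].
- by move=> p q G; exact: noetherian_kernel_fg.
- by move=> p q G p' G'; exact: local_kernel_nakayama.
- by apply: IH => //; exact: add_principal_ideal.
Qed.

End NoetherianRows.

(** * Power series *)

Section PowerSeries.
Variable R : comNzRingType.
Implicit Types (f g : fps R).
Local Notation t := (fpsX R).

Lemma coefsD f g n : coefs (f + g) n = coefs f n + coefs g n. Proof. by []. Qed.
Lemma coefsN f n : coefs (- f) n = - coefs f n. Proof. by []. Qed.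
Lemma coefsM f g n : coefs (f * g) n = \sum_(i < n.+1) coefs f i * coefs g (n - i).
Proof. by []. Qed.

Lemma coefsXM f n : coefs (t * f) n = if n is n'.+1 then coefs f n' else 0.
Proof.
rewrite coefsM; case: n => [|n]; first by rewrite big_ord1 mul0r.
rewrite (bigD1 (lift ord0 ord0)) //= mul1r subn1 big1 ?addr0 // => i.
by rewrite -val_eqE /= => /negbTE->; rewrite mul0r.
Qed.

Lemma coefsXnM k f n : coefs (t ^+ k * f) n = if (n < k)%N then 0 else coefs f (n - k).
Proof.
elim: k n => [|k IH] n; first by rewrite expr0 mul1r subn0.
by rewrite exprS -mulrA coefsXM; case: n => [|n] //; rewrite IH ltnS subSS.
Qed.

Definition fps_coef0 f := coefs f 0.
Arguments fps_coef0 f : simpl never.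
Lemma coef0_zmod : zmod_morphism fps_coef0. Proof. by []. Qed.
HB.instance Definition _ := GRing.isZmodMorphism.Build (fps R) R fps_coef0 coef0_zmod.
Lemma coef0_monoid : monoid_morphism fps_coef0.
Proof. by split=> // f g; rewrite /fps_coef0 coefsM big_ord1 subn0. Qed.
HB.instance Definition _ := GRing.isMonoidMorphism.Build (fps R) R fps_coef0 coef0_monoid.

Definition fps_poly (p : {poly R}) : fps R := Fps (fun n => p`_n).
Lemma fps_poly_zmod : zmod_morphism fps_poly.
Proof. by move=> p q; apply: fpsP => n; rewrite coefsD coefsN /= coefB. Qed.
HB.instance Definition _ :=
  GRing.isZmodMorphism.Build {poly R} (fps R) fps_poly fps_poly_zmod.
Lemma fps_poly_monoid : monoid_morphism fps_poly.
Proof.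
split=> [|p q]; apply: fpsP => n; first by rewrite /= coef1.
by rewrite coefsM /= coefM.
Qed.
HB.instance Definition _ :=
  GRing.isMonoidMorphism.Build {poly R} (fps R) fps_poly fps_poly_monoid.

Lemma fps_polyX : fps_poly 'X = t.
Proof. by apply: fpsP => n; rewrite /= coefX. Qed.

Lemma fps_poly_inj : injective fps_poly.
Proof.
by move=> p q /(congr1 (@coefs R)) e; apply/polyP => i; exact: (congr1 (@^~ i) e).
Qed.

Lemma coef0_polyC c : fps_coef0 (fps_poly c%:P) = c.
Proof. by rewrite /fps_coef0 /= coefC. Qed.

Definition fps_shift k f : fps R := Fps (fun n => coefs f (k + n)).
Definition fps_trunc k f : {poly R} := \poly_(i < k) coefs f i.

Lemma fps_truncP k f : f = fps_poly (fps_trunc k f) + t ^+ k * fps_shift k f.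
Proof.
apply: fpsP => n; rewrite coefsD coefsXnM /= coef_poly.
by case: ltnP => h; rewrite ?addr0 // add0r subnKC.
Qed.

Lemma fps_divX f : fps_coef0 f = 0 -> f = t * fps_shift 1 f.
Proof.
by move=> f0; apply: fpsP => -[|n]; rewrite coefsXM.
Qed.

Lemma fpsX_reg f g : t * f = t * g -> f = g.
Proof. by move=> e; apply: fpsP => n; have := congr1 (fun h => coefs h n.+1) e; rewrite !coefsXM. Qed.

Lemma fpsXn_reg k f g : t ^+ k * f = t ^+ k * g -> f = g.
Proof. by elim: k => [|k IH]; rewrite ?expr0 ?mul1r // exprS -!mulrA => /fpsX_reg/IH. Qed.

(** [e 0] is divisible by every power of t. This replaces convergence: an error term that is t times
    its successor vanishes. *)
Lemma fpsX_tail (e : nat -> fps R) : (forall n, e n = t * e n.+1) -> e 0%N = 0.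
Proof.
move=> eS; apply: fpsP => k; elim: k (0%N) => [|k IH] n; by rewrite eS coefsXM ?IH.
Qed.

(** Long division of 1 by [f]: [r n] is the remainder after n steps, its constant term times [u] the
    n-th coefficient of the inverse, and [g n] the part of the inverse from there on. The error r n
    - g n f is t times its successor. *)
Lemma fps_inverse f u : u * fps_coef0 f = 1 -> exists g, g * f = 1.
Proof.
move=> uf; pose next r := fps_shift 1 (r - fps_poly (fps_coef0 r * u)%:P * f).
have nextP r : r = fps_poly (fps_coef0 r * u)%:P * f + t * next r.
  rewrite -fps_divX; first by rewrite addrC subrK.
  by rewrite rmorphB rmorphM /= coef0_polyC -mulrA uf mulr1 subrr.
have [r r0 rS] : exists2 r : nat -> fps R, r 0%N = 1 & forall n, r n.+1 = next (r n).
  by exists (fun n => iter n next 1).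
pose g n := Fps (fun k => fps_coef0 (r (n + k)%N) * u).
have gS n : g n = fps_poly (fps_coef0 (r n) * u)%:P + t * g n.+1.
  apply: fpsP => k; rewrite coefsD coefsXM /= coefC.
  by case: k => [|k]; rewrite ?addn0 ?addr0 // add0r addnS.
exists (g 0%N); apply/esym/eqP; rewrite -subr_eq0 -r0; apply/eqP.
apply: (fpsX_tail (e := fun n => r n - g n * f)) => n.
have {1}-> := nextP (r n); rewrite -rS gS mulrDl.
move: (_ * f) (r n.+1) (g n.+1) => a b c.
by rewrite opprD addrACA subrr add0r mulrBr mulrA.
Qed.

Lemma coef0_ker f : fps_coef0 f = 0 <-> add_principal zero_ideal t f.
Proof.
split=> [/fps_divX->|[_ [r [-> ->]]]]; first by exists 0, (fps_shift 1 f); rewrite add0r mulrC.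
by rewrite add0r rmorphM /= mulr0.
Qed.

Lemma coef0_surj b : exists f, fps_coef0 f = b.
Proof. by exists (fps_poly b%:P); rewrite coef0_polyC. Qed.

Lemma fps_mx_divX p q (M : 'M[fps R]_(p, q)) :
  map_mx fps_coef0 M = 0 -> exists N, M = t *: N.
Proof.
move=> /matrixP M0; exists (map_mx (fps_shift 1) M); apply/matrixP => i j; rewrite !mxE.
by apply: fps_divX; have := M0 i j; rewrite !mxE.
Qed.

Lemma fps_mx_constP p q (M : 'M[fps R]_(p, q)) :
  exists N, M = map_mx (fun c => fps_poly c%:P) (map_mx fps_coef0 M) + t *: N.
Proof.
set C := map_mx _ _; have [|N e] := @fps_mx_divX _ _ (M - C).
  by apply/matrixP => i j; rewrite !mxE rmorphB /= coef0_polyC subrr.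
by exists N; rewrite -e addrC subrK.
Qed.

Lemma fps_scale_eq0 p q (M : 'M[fps R]_(p, q)) : t *: M = 0 -> M = 0.
Proof.
move=> /matrixP h; apply/matrixP => i j; rewrite !mxE; apply: fpsX_reg.
by have := h i j; rewrite !mxE mulr0.
Qed.

(** Repeated division writes c as (constants) G' plus t times another kernel element; the constants
    of all stages are the coefficients of the row [D 0]. *)
Lemma fps_kernel_nakayama p q (G : 'M[fps R]_(p, q)) p' (G' : 'M[fps R]_(p', p)) :
  G' *m G = 0 ->
  (forall c : 'rV_p, c *m G = 0 -> exists d c', c' *m G = 0 /\ c = d *m G' + t *: c') ->
  forall c : 'rV_p, c *m G = 0 -> exists d : 'rV_p', c = d *m G'.
Proof.
move=> G'G h c cG; pose K := {c : 'rV_p | c *m G = 0}.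
pose cst (d : 'rV[R]_p') := map_mx (fun x => fps_poly x%:P) d.
have /choice[next nextP] (x : K) :
    exists y : 'rV[R]_p' * K, sval x = cst y.1 *m G' + t *: sval y.2.
  case: x => x xG; have [d [c' [c'G /= ->]]] := h x xG.
  have [N dE] := fps_mx_constP d.
  have yG : (N *m G' + c') *m G = 0 by rewrite mulmxDl -mulmxA G'G mulmx0 c'G addr0.
  exists (map_mx fps_coef0 d, exist (fun c : 'rV_p => c *m G = 0) _ yG) => /=.
  by rewrite {1}dE mulmxDl -scalemxAl scalerDr addrA.
have [s s0 sS] : exists2 s : nat -> K,
    s 0%N = exist (fun c : 'rV_p => c *m G = 0) c cG & forall n, s n.+1 = (next (s n)).2.
  by exists (fun n => iter n (fun x => (next x).2) (exist (fun c : 'rV_p => c *m G = 0) c cG)).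
pose D n : 'rV[fps R]_p' := \row_j Fps (fun k => (next (s (n + k)%N)).1 0 j).
have DS n : D n = cst (next (s n)).1 + t *: D n.+1.
  apply/rowP => j; rewrite !mxE; apply: fpsP => k; rewrite coefsD coefsXM /= coefC.
  by case: k => [|k]; rewrite ?addn0 ?addr0 // add0r addnS.
have eS n : sval (s n) - D n *m G' = t *: (sval (s n.+1) - D n.+1 *m G').
  have {1}-> := nextP (s n); rewrite -sS DS mulmxDl -scalemxAl.
  by rewrite opprD addrACA subrr add0r scalerBr.
exists (D 0%N); apply/eqP; rewrite -subr_eq0; apply/eqP/rowP => j; rewrite [RHS]mxE.
have := @fpsX_tail (fun n => (sval (s n) - D n *m G') 0 j) _; rewrite s0 /=; apply=> n.
by rewrite eS mxE.
Qed.

Hypothesis noeth : noetherianP R.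

(** The constant terms of kernel elements form a finitely generated module over R. Lifts of its
    generators generate the kernel, which is closed under division by t. *)
Lemma fps_kernel_fg p q (G : 'M[fps R]_(p, q)) :
  exists p' (G' : 'M[fps R]_(p', p)), row_kernel zero_ideal G G'.
Proof.
pose K0 (v : 'rV[R]_p) := exists2 c : 'rV_p, c *m G = 0 & map_mx fps_coef0 c = v.
have [|p' [G0 [KG0 span]]] := @row_submodule_fg R noeth p K0.
  split; first by exists 0; rewrite ?mul0mx ?map_mx0.
    move=> _ _ [c cG <-] [d dG <-]; exists (c + d); last by rewrite map_mxD.
    by rewrite mulmxDl cG dG addr0.
  move=> a _ [c cG <-]; exists (fps_poly a%:P *: c); first by rewrite -scalemxAl cG scaler0.
  by rewrite map_mxZ /= coef0_polyC.
have /choice[c cP] i : exists c : 'rV_p, c *m G = 0 /\ map_mx fps_coef0 c = row i G0.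
  by have [c] := KG0 i; exists c.
pose G' := \matrix_i c i.
have G'G : G' *m G = 0 by apply/row_matrixP => i; rewrite row_mul rowK (cP i).1 row0.
have G'0 : map_mx fps_coef0 G' = G0.
  by apply/row_matrixP => i; rewrite -(cP i).2 -map_row rowK.
exists p', G'; split=> [|v /mx_in_zero vG]; first exact/mx_in_zero.
suff [d ->] : exists d : 'rV_p', v = d *m G' by exists d; apply/mx_in_zero; rewrite subrr.
apply: fps_kernel_nakayama vG => // {}v vG.
have [|d dE] := span (map_mx fps_coef0 v); first by exists v.
pose D := map_mx (fun x => fps_poly x%:P) d.
have [|N vE] := @fps_mx_divX _ _ (v - D *m G').
  rewrite map_mxB map_mxM G'0 dE -map_mx_comp (_ : map_mx _ d = d) ?subrr //.
  by apply/rowP => j; rewrite mxE /= coef0_polyC.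
exists D, N; split; last by rewrite -vE addrC subrK.
by apply: fps_scale_eq0; rewrite scalemxAl -vE mulmxBl vG -mulmxA G'G mulmx0 subrr.
Qed.

Lemma fps_resolution l :
  (forall p q (G : 'M[R]_(p, q)), resolution zero_ideal l G) ->
  forall p q (G : 'M[fps R]_(p, q)), resolution zero_ideal l.+1 G.
Proof.
move=> res; apply: (resolution_step (@zero_idealP _) (x := t)).
- by move=> a ta; apply: fpsX_reg; rewrite ta mulr0.
- exact: fps_kernel_fg.
- move=> p q G p' G' /mx_in_zero G'G h c /mx_in_zero cG.
  have [|d ->] := @fps_kernel_nakayama _ _ G _ G' G'G _ c cG.
    move=> {cG}c /mx_in_zero/h[d [c' [/mx_in_zero c'G /mx_in_zero e]]].
    by exists d, c'; split=> //; apply/eqP; rewrite addrC -subr_eq -subr_eq0; apply/eqP.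
  by exists d; apply/mx_in_zero; rewrite subrr.
- move=> p q G; apply: (resolution_pullback (f := fps_coef0)) => //.
    exact: coef0_ker.
  exact: coef0_surj.
Qed.

End PowerSeries.

(** * Stably free modules *)

Section StablyFree.
Variable A : comPzRingType.

(** [x] and [y] identify the image of [e] with that of 1 - b a, a complement of the free summand A^m
    of A^q. *)
Definition stably_free_idem n (e : 'M[A]_n) :=
  exists m q (a : 'M[A]_(m, q)) (b : 'M[A]_(q, m)) (x : 'M[A]_(n, q)) (y : 'M[A]_(q, n)),
    [/\ a *m b = 1%:M, x *m y = e & y *m x = 1%:M - b *m a].

Lemma compl_idem m q (a : 'M[A]_(m, q)) (b : 'M[A]_(q, m)) (g := 1%:M - b *m a) :
  a *m b = 1%:M -> [/\ g *m g = g, g *m b = 0 & a *m g = 0].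
Proof.
move=> ab; have gb : g *m b = 0 by rewrite mulmxBl -mulmxA ab mulmx1 mul1mx subrr.
split=> //; last by rewrite mulmxBr mulmxA ab mulmx1 mul1mx subrr.
by rewrite {2}/g mulmxBr mulmx1 mulmxA gb mul0mx subr0.
Qed.

Lemma normalize_equiv n q (e : 'M[A]_n) (g : 'M[A]_q) x y :
  e *m e = e -> g *m g = g -> x *m y = e -> y *m x = g ->
  exists x' y', [/\ x' *m y' = e, y' *m x' = g, x' *m g = x' & g *m y' = y'].
Proof.
move=> ee gg xy yx; exists (x *m g), (g *m y); split.
- by rewrite mulmxA -(mulmxA x) gg -yx !mulmxA xy -mulmxA xy.
- by rewrite mulmxA -(mulmxA g) yx gg gg.
- by rewrite -mulmxA gg.
- by rewrite mulmxA gg.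
Qed.

(** If the image of 1 - e plus A^m is A^q, then the image of e plus A^q is A^(n + m). *)
Lemma stably_free_compl n (e : 'M[A]_n) :
  e *m e = e -> stably_free_idem (1%:M - e) -> stably_free_idem e.
Proof.
move=> ee [m [q [a [b [x0 [y0 [ab xy0 yx0]]]]]]].
have [gg gb ag] := compl_idem ab.
have ff : (1%:M - e) *m (1%:M - e) = 1%:M - e.
  by rewrite mulmxBr mulmx1 mulmxBl mul1mx ee subrr subr0.
have [x [y [xy yx xg gy]]] := normalize_equiv ff gg xy0 yx0.
exists q, (n + m)%N, (row_mx y b), (col_mx x a), (row_mx e 0), (col_mx e 0); split.
- by rewrite mul_row_col yx subrK.
- by rewrite mul_row_col ee mulmx0 addr0.
rewrite !mul_col_row xy ab ee !mulmx0 !mul0mx.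
have -> : x *m b = 0 by rewrite -xg -mulmxA gb mulmx0.
have -> : a *m y = 0 by rewrite -gy mulmxA ag mul0mx.
by rewrite scalar_mx_block opp_block_mx add_block_mx !subrr subKr.
Qed.

Lemma stably_free_equiv n n' (e : 'M[A]_n) (e' : 'M[A]_n') u v :
  e *m e = e -> u *m v = e -> v *m u = e' -> stably_free_idem e' -> stably_free_idem e.
Proof.
move=> ee uv vu [m [q [a [b [x [y [ab xy yx]]]]]]].
have [gg _ _] := compl_idem ab.
exists m, q, a, b, (u *m x), (y *m v); split=> //.
  by rewrite mulmxA -(mulmxA u) xy -vu !mulmxA uv -mulmxA uv.
by rewrite mulmxA -(mulmxA y) vu -xy !mulmxA yx -mulmxA yx.
Qed.

(* [G *m X *m G = G] says that the row space of [G] is a projective module. *)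
Lemma split_resolution_stably_free l p q (G : 'M[A]_(p, q)) (X : 'M[A]_(q, p)) :
  resolution zero_ideal l G -> G *m X *m G = G -> stably_free_idem (G *m X).
Proof.
elim: l p q G X => [|l IH] p q G X.
  move=> /= inj GXG; have -> : G *m X = 1%:M.
    apply/esym/eqP; rewrite -subr_eq0; apply/eqP/row_matrixP => i; rewrite row0.
    apply/mx_in_zero/inj/mx_in_zero; rewrite -row_mul.
    by rewrite mulmxBl mul1mx GXG subrr row0.
  exists 0, p, 0, 0, 1%:M, 1%:M; split; rewrite ?mul1mx ?mul0mx ?subr0 //.
  by apply/matrixP => -[].
move=> [p' [G' [[/mx_in_zero G'G span] res]]] GXG; pose e := G *m X.
have ee : e *m e = e by rewrite /e mulmxA GXG.
have [Z ZE] : exists Z, Z *m G' = 1%:M - e.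
  have /choice[Z ZE] i : exists d : 'rV_p', row i (1%:M - e) = d *m G'.
    have [|d /mx_in_zero d0] := span (row i (1%:M - e)).
      by apply/mx_in_zero; rewrite -row_mul mulmxBl mul1mx GXG subrr row0.
    by exists d; apply/eqP; rewrite -subr_eq0 d0.
  by exists (\matrix_i Z i); apply/row_matrixP => i; rewrite row_mul rowK ZE.
have G'ZG' : G' *m Z *m G' = G'.
  by rewrite -mulmxA ZE mulmxBr mulmx1 mulmxA G'G mul0mx subr0.
(* 1 - e presents the row space of [G'], which is projective again, so the induction applies to
   [G']. *)
apply: stably_free_compl => //; apply: (stably_free_equiv _ ZE erefl); last exact: IH.
by rewrite mulmxBr mulmx1 mulmxBl mul1mx ee subrr subr0.
Qed.

Hypothesis unimodular_free : forall n (a : 'rV[A]_n) (b : 'cV[A]_n),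
  a *m b = 1%:M -> free_idem (1%:M - b *m a).

(** One free summand is removed at a time: the first row [a0] of [a] is unimodular, its complement
    is free of rank r, and in the coordinates of A^r the m remaining rows are [a1 *m u]. *)
Lemma stably_free_free n (e : 'M[A]_n) : e *m e = e -> stably_free_idem e -> free_idem e.
Proof.
move=> ee [m [q [a [b [x [y [ab xy yx]]]]]]].
elim: m q a b x y ab xy yx => [|m IH] q a b x0 y0 ab xy0 yx0.
  exists q, x0, y0; split=> //; rewrite yx0 (_ : b = 0) ?mul0mx ?subr0 //.
  by apply/matrixP => ? [].
have [gg gb _] := compl_idem ab.
have [x [y [xy yx xg gy]]] := normalize_equiv ee gg xy0 yx0.
pose a0 := usubmx (a : 'M_(1 + m, q)); pose a1 := dsubmx (a : 'M_(1 + m, q)).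
pose b0 := lsubmx (b : 'M_(q, 1 + m)); pose b1 := rsubmx (b : 'M_(q, 1 + m)).
have aE : a = col_mx a0 a1 by rewrite vsubmxK.
have bE : b = row_mx b0 b1 by rewrite hsubmxK.
have baE : b *m a = b0 *m a0 + b1 *m a1 by rewrite aE bE (@mul_row_col _ q 1 m q).
have : col_mx a0 a1 *m row_mx b0 b1 = (1%:M : 'M_(1 + m)) by rewrite -aE -bE.
rewrite mul_col_row scalar_mx_block => /eq_block_mx[ab00 ab01 ab10 ab11].
have xb0 : x *m b0 = 0.
  have : x *m b = 0 by rewrite -xg -mulmxA gb mulmx0.
  rewrite bE (@mul_mx_row _ n q 1 m) => e0.
  by have [] := @eq_row_mx _ n 1 m _ _ 0 0 (etrans e0 (esym (row_mx0 _ n 1 m))).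
have [r [u [v [uv vu]]]] := unimodular_free ab00.
apply: (IH r (a1 *m u) (v *m b1) (x *m u) (v *m y)).
- by rewrite mulmxA -(mulmxA a1) uv mulmxBr mulmx1 mulmxA ab10 mul0mx subr0.
- by rewrite mulmxA -(mulmxA x) uv mulmxBr mulmx1 mulmxA xb0 mul0mx subr0.
- rewrite mulmxA -(mulmxA v) yx baE opprD addrA mulmxBr -uv mulmxBl !mulmxA vu.
  by rewrite mul1mx vu.
Qed.

End StablyFree.

(** * Localization: extension of maps, common denominators, transfer of resolutions *)

Section Localization.
Variables (A : comPzRingType) (S : mulrClosed A).
Implicit Types x : localization S.

Lemma loc_extend (B : comPzRingType) (f : {rmorphism A -> B}) :
  (forall s, s \in S -> exists v, f s * v = 1) ->
  exists g : {rmorphism localization S -> B}, forall a, g (toloc S a) = f a.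
Proof.
move=> funit.
have cancel s b c : s \in S -> f s * b = f s * c -> b = c.
  move=> /funit[v sv] e; rewrite -[b]mul1r -[c]mul1r -sv ![f s * v]mulrC.
  by rewrite -!mulrA e.
have /choice[g gP] x : exists y, forall a s, s \in S -> x * toloc S s = toloc S a -> y * f s = f a.
  have [a0 [s0 s0S xs0]] := toloc_frac x; have [v0 sv0] := funit _ s0S.
  exists (f a0 * v0) => a s sS xs.
  have /toloc_eq[u uS e] : toloc S (a * s0) = toloc S (a0 * s).
    by rewrite !rmorphM /= -xs -xs0 mulrAC.
  apply: (cancel s0) => //; apply: (cancel u) => //.
  have {}e : f u * (f a * f s0) = f u * (f a0 * f s) by rewrite -!rmorphM e.
  rewrite [f s0 * f a]mulrC e; congr (_ * _).
  by rewrite mulrA [f s0 * _]mulrCA sv0 mulr1.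
have gE x a s : s \in S -> x * toloc S s = toloc S a -> forall y, y * f s = f a -> g x = y.
  by move=> sS xs y e; apply: (cancel s) => //; rewrite ![f s * _]mulrC e; exact: gP.
have gT a : g (toloc S a) = f a.
  by apply: (gE _ a 1); rewrite ?rpred1 ?rmorph1 ?mulr1.
have gB : zmod_morphism g.
  move=> x y; have [a [s sS xs]] := toloc_frac x; have [b [u uS yu]] := toloc_frac y.
  apply: (gE _ (a * u - b * s) (s * u)); first exact: rpredM.
    by rewrite rmorphB !rmorphM /= -xs -yu; ring.
  by rewrite rmorphB !rmorphM /= -(gP x a s) // -(gP y b u) //; ring.
have gM : monoid_morphism g.
  split=> [|x y]; first by rewrite -(rmorph1 (toloc S)) gT rmorph1.
  have [a [s sS xs]] := toloc_frac x; have [b [u uS yu]] := toloc_frac y.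
  apply: (gE _ (a * b) (s * u)); first exact: rpredM.
    by rewrite !rmorphM /= -xs -yu; ring.
  by rewrite !rmorphM /= -(gP x a s) // -(gP y b u) //; ring.
by exists (HB.pack_for {rmorphism localization S -> B} g
  (GRing.isZmodMorphism.Build _ _ g gB) (GRing.isMonoidMorphism.Build _ _ g gM)).
Qed.

Lemma common_denominator p q (M : 'M[localization S]_(p, q)) :
  exists2 s, s \in S & exists N, toloc S s *: M = map_mx (toloc S) N.
Proof.
have /choice[a /choice[s P]] (ij : 'I_p * 'I_q) :
    exists a s, s \in S /\ M ij.1 ij.2 * toloc S s = toloc S a.
  by have [a [s sS e]] := toloc_frac (M ij.1 ij.2); exists a, s.
exists (\prod_ij s ij); first by apply: rpred_prod => ij _; case: (P ij).
exists (\matrix_(i, j) (a (i, j) * \prod_(k | k != (i, j)) s k)).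
apply/matrixP => i j; rewrite !mxE (bigD1 (i, j)) //= !rmorphM /=.
by rewrite -(P (i, j)).2 /=; ring.
Qed.

Hypothesis S_regular : forall s a b, s \in S -> s * a = s * b -> a = b.

Lemma toloc_inj : injective (toloc S).
Proof. by move=> a b /toloc_eq[s sS]; exact: S_regular. Qed.

Lemma map_toloc_inj p q : injective (map_mx (toloc S) : 'M_(p, q) -> _).
Proof.
move=> M N /matrixP e; apply/matrixP => i j; apply: toloc_inj.
by have := e i j; rewrite !mxE.
Qed.

Lemma loc_resolution l p q (G : 'M[A]_(p, q)) :
  resolution zero_ideal l G -> resolution zero_ideal l (map_mx (toloc S) G).
Proof.
have clear r r' (N : 'M[A]_(r, r')) (c : 'rV[localization S]_r) :
    c *m map_mx (toloc S) N = 0 -> exists v c',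
    c = v *: map_mx (toloc S) c' /\ c' *m N = 0.
  move=> cN; have [s sS [c' sc]] := common_denominator c; have [v sv] := toloc_inv sS.
  exists v, c'; split; first by rewrite -sc scalerA mulrC sv scale1r.
  by apply: map_toloc_inj; rewrite map_mxM -sc -scalemxAl cN scaler0 map_mx0.
elim: l p q G => [|l IH] p q G /=.
  move=> inj c /mx_in_zero/clear[v [c' [-> c'G]]]; apply/mx_in_zero.
  suff -> : c' = 0 by rewrite map_mx0 scaler0.
  exact/mx_in_zero/inj/mx_in_zero.
move=> [p' [G' [[/mx_in_zero G'G span] res]]].
exists p', (map_mx (toloc S) G'); split; last exact: IH.
split=> [|c /mx_in_zero/clear[v [c' [-> c'G]]]].
  by apply/mx_in_zero; rewrite -map_mxM G'G map_mx0.
have [|d /mx_in_zero/eqP] := span c'; first exact/mx_in_zero.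
rewrite subr_eq0 => /eqP->; exists (v *: map_mx (toloc S) d); apply/mx_in_zero.
by rewrite map_mxM scalemxAl subrr.
Qed.

(** A multiple of [e] by a denominator is a matrix [E] over A. Its resolution localizes, and [e]
    times the inverse denominator splits it. *)
Lemma loc_idem_stably_free l :
  (forall p q (G : 'M[A]_(p, q)), resolution zero_ideal l G) ->
  forall n (e : 'M[localization S]_n), e *m e = e -> stably_free_idem e.
Proof.
move=> res n e ee; have [s sS [E se]] := common_denominator e.
have [v sv] := toloc_inv sS.
have eE : map_mx (toloc S) E *m (v *: e) = e.
  by rewrite -se -scalemxAl -scalemxAr scalerA sv ee scale1r.
rewrite -{1}eE; apply: split_resolution_stably_free (loc_resolution (res _ _ E)) _.
by rewrite eE -se -scalemxAr ee.
Qed.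

End Localization.

(** * Division by monic polynomials and ideals that contain one *)

Lemma monic_divide (R : comNzRingType) (k : fieldType) (f : {rmorphism R -> k})
    (d p : {poly R}) : d \is monic ->
  exists q r : {poly R}, [/\ p = q * d + r, (size r < size d)%N
    & map_poly f p = 0 -> map_poly f q = 0 /\ map_poly f r = 0].
Proof.
move=> dm; exists (Pdiv.Ring.rdivp p d), (Pdiv.Ring.rmodp p d).
have e := Pdiv.RingMonic.rdivp_eq dm p.
have lt : (size (Pdiv.Ring.rmodp p d) < size d)%N.
  by rewrite Pdiv.Ring.ltn_rmodp monic_neq0.
split=> // p0; move: e lt; set q := Pdiv.Ring.rdivp _ _; set r := Pdiv.Ring.rmodp _ _.
move=> e lt; have fdm : map_poly f d \is monic by exact: monic_map.
have szd : size (map_poly f d) = size d.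
  by apply: size_map_poly_id0; rewrite (monicP dm) rmorph1 oner_eq0.
have fe : map_poly f q * map_poly f d = - map_poly f r.
  by apply/eqP; rewrite -addr_eq0 -rmorphM -rmorphD /= -e p0.
have q0 : map_poly f q = 0.
  apply/eqP/contraT => q0; have := congr1 (fun x : {poly k} => size x) fe.
  rewrite size_Mmonic // size_polyN szd => sz.
  have : (size (map_poly f r) < size d)%N by rewrite (leq_ltn_trans _ lt) ?size_poly.
  rewrite -sz -(prednK (_ : 0 < size (map_poly f q)))%N ?lt0n ?size_poly_eq0 //.
  by rewrite addSn ltnNge leq_addl.
by split=> //; apply/eqP; rewrite -oppr_eq0 -fe q0 mul0r.
Qed.

Section LocalPoly.
Variables (R : comNzRingType) (m : R -> Prop) (mloc : local_at m).
Variables (k : fieldType) (f : {rmorphism R -> k}) (fP : residue_map m f).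

Lemma residue_poly_eq0 (p : {poly R}) : map_poly f p = 0 <-> forall i, m p`_i.
Proof.
split=> [/polyP h i|h]; first by apply/fP.1; have := h i; rewrite coef_map coef0.
by apply/polyP => i; rewrite coef_map coef0; apply/fP.1.
Qed.

(** As J contains a monic polynomial of degree n, R[X]/J is generated over R by the X^i with i < n.
    Modulo J each X^i equals X^i (1 - j), whose remainder has coefficients in m, so R[X]/J vanishes
    by Nakayama's lemma. *)
Lemma monic_ideal_comaximal (J : {poly R} -> Prop) (d j : {poly R}) :
  idealP J -> d \is monic -> J d -> J j -> map_poly f j = 1 -> J 1.
Proof.
move=> JI dm Jd Jj fj; have [J0 JD JM] := JI.
have [[m0 mD mM] _ _] := mloc.1.
have [d1|d1] := leqP (size d) 1.
  move: Jd; rewrite [d]size1_polyC //; move: dm; rewrite monicE lead_coefE.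
  have -> : (size d).-1 = 0%N by case: (size d) d1 => [|[]].
  by move/eqP->.
pose n := (size d).-1.
have dn : size d = n.+1 by rewrite prednK // ltnW.
have /choice[M MP] (i : 'I_n) : exists M : 'I_n -> R,
    (forall l, m (M l)) /\ J ('X^i - \sum_l (M l)%:P * 'X^l).
  have [q [r [e lt h]]] := monic_divide f ('X^i * (1 - j)) dm.
  have [|q0 /residue_poly_eq0 mr] := h.
    by rewrite rmorphM rmorphB /= fj rmorph1 subrr mulr0.
  exists (fun l => r`_l); split=> //.
  have -> : \sum_(l < n) (r`_l)%:P * 'X^l = r.
    under eq_bigr do rewrite mul_polyC; rewrite -poly_def; apply/polyP => l.
    rewrite coef_poly; case: ltnP => // nl; rewrite nth_default //.
    by apply: leq_trans nl; rewrite -ltnS -dn.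
  rewrite (_ : _ - _ = 'X^i * j + q * d); first by apply: JD; exact: JM.
  by rewrite (_ : r = 'X^i * (1 - j) - q * d); [ring | rewrite e; ring].
have n0 : (0 < n)%N by rewrite -ltnS -dn.
suff : J 'X^(Ordinal n0) by rewrite expr0.
apply: (@nakayama R {poly R} polyC {poly R}^o J J0 JD _ m m0 mD mM (local_rad mloc) 'I_n
  (fun i => 'X^i) M).
- by move=> a x; exact: JM.
- by move=> i; exact: (MP i).1.
- by move=> i; exact: (MP i).2.
Qed.

End LocalPoly.

(** * Laurent series *)

Lemma poly_hom_exists (R : comNzRingType) (B : comPzRingType)
    (g : {rmorphism R -> B}) (v : B) : (1 : B) != 0 ->
  exists h : {rmorphism {poly R} -> B}, (forall c, h c%:P = g c) /\ h 'X = v.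
Proof.
move=> B1; pose B' : comNzRingType :=
  HB.pack_for comNzRingType B (GRing.PzSemiRing_isNonZero.Build B B1).
pose g' : {rmorphism R -> B'} := g.
have cg : commr_rmorph g' v by move=> x; exact: mulrC.
exists (horner_morph cg : {rmorphism {poly R} -> B'}); split=> [c|].
  exact: (horner_morphC cg).
exact: (horner_morphX cg).
Qed.

Section LaurentSeries.
Variable R : comNzRingType.
Local Notation t := (fpsX R).
Local Notation L := (localization (powers t)).
Local Notation tl := (toloc (powers t)).

Lemma powers_fpsX_regular (s a b : fps R) : s \in powers t -> s * a = s * b -> a = b.
Proof. by move=> /asboolP[n ->]; exact: fpsXn_reg. Qed.

Lemma mem_powers (A : comPzRingType) (x : A) n : x ^+ n \in powers x.
Proof. by apply/asboolP; exists n. Qed.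

Lemma laurent_inj : injective tl.
Proof. exact: toloc_inj powers_fpsX_regular. Qed.

Lemma laurent_one_neq0 : (1 : L) != 0.
Proof.
apply/eqP; rewrite -(rmorph1 tl) -(rmorph0 tl) => /laurent_inj/eqP.
by rewrite oner_eq0.
Qed.

(** The variable of [{poly R}] stands here for s = 1/t, and [f] is the expansion at infinity of
    polynomials in s. *)
Lemma laurent_at_infinity : exists f : {rmorphism {poly R} -> L},
  (forall c, f c%:P = tl (fps_poly c%:P)) /\ f 'X * tl t = 1.
Proof.
have [v tv] := toloc_inv (mem_powers t 1).
have [f [fC fX]] := poly_hom_exists (tl \o @fps_poly R \o polyC) v laurent_one_neq0.
by exists f; split=> //; rewrite fX mulrC.
Qed.

(** This is X^N p(1/X) when p has degree at most N. *)
Definition poly_rev N (p : {poly R}) := \poly_(i < N.+1) p`_(N - i).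

Lemma poly_revK N (p : {poly R}) : (size p <= N.+1)%N -> poly_rev N (poly_rev N p) = p.
Proof.
move=> sz; apply/polyP => i; rewrite coef_poly; case: ltnP => h.
  by rewrite coef_poly ltnS leq_subr subKn.
by rewrite nth_default // (leq_trans sz).
Qed.

Section AtInfinity.
Variable f : {rmorphism {poly R} -> L}.
Hypothesis fC : forall c, f c%:P = tl (fps_poly c%:P).
Hypothesis fX : f 'X * tl t = 1.

Lemma at_infinity_Xn i N : (i <= N)%N -> tl t ^+ N * f 'X ^+ i = tl t ^+ (N - i).
Proof.
move=> iN; rewrite -{1}(subnK iN) exprD -mulrA -exprMn [tl t * _]mulrC fX.
by rewrite expr1n mulr1.
Qed.

Lemma at_infinity_rev N (p : {poly R}) : (size p <= N.+1)%N ->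
  tl (fps_poly (poly_rev N p)) = tl t ^+ N * f p.
Proof.
move=> sz; rewrite -[p in RHS]coefK poly_def.
rewrite (big_ord_widen N.+1 (fun i => p`_i *: 'X^i)) // big_mkcond.
rewrite rmorph_sum mulr_sumr /poly_rev poly_def !rmorph_sum.
rewrite (reindex_inj rev_ord_inj); apply: eq_bigr => i _ /=.
rewrite subSS subKn; last by rewrite -ltnS.
have iN : (i <= N)%N by rewrite -ltnS.
rewrite -mul_polyC !rmorphM /= rmorphXn /= fps_polyX rmorphXn /= -(at_infinity_Xn iN).
case: ltnP => h; first by rewrite -mul_polyC rmorphM /= fC rmorphXn; ring.
by rewrite nth_default // rmorph0 !raddf0 /=; ring.
Qed.

Lemma at_infinity_inj : injective f.
Proof.
move=> p q e; pose N := maxn (size p) (size q).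
have revE (x : {poly R}) : (size x <= N)%N -> tl (fps_poly (poly_rev N x)) = tl t ^+ N * f x.
  by move=> h; apply: at_infinity_rev; exact: leqW.
have /laurent_inj/fps_poly_inj e' :
    tl (fps_poly (poly_rev N p)) = tl (fps_poly (poly_rev N q)).
  by rewrite !revE ?leq_maxl ?leq_maxr // e.
by rewrite -(@poly_revK N p) ?e' ?poly_revK // leqW // ?leq_maxl ?leq_maxr.
Qed.

End AtInfinity.
End LaurentSeries.

(** * Unimodular rows over Laurent series *)

Section Unimodular.
Variable A : comPzRingType.

Lemma free_idem_equiv n n' (e : 'M[A]_n) (g : 'M[A]_n') x y :
  e *m e = e -> x *m y = e -> y *m x = g -> free_idem g -> free_idem e.
Proof.
move=> ee xy yx [r [u [v [uv vu]]]]; exists r, (x *m u), (v *m y); split.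
  by rewrite mulmxA -(mulmxA x) uv -yx !mulmxA xy -mulmxA xy.
by rewrite mulmxA -(mulmxA v) yx -uv mulmxA vu mul1mx vu.
Qed.

Definition unimodular_free n (a : 'rV[A]_n) :=
  forall b : 'cV_n, a *m b = 1%:M -> free_idem (1%:M - b *m a).

(** Up to the change of coordinates [G], both idempotents present the quotient of A^n by the line of
    the row, so the choice of the right inverse does not matter. *)
Lemma unimodular_free_mul n (a : 'rV[A]_n) (b : 'cV_n) (G G' : 'M_n) :
  G *m G' = 1%:M -> a *m G *m b = 1%:M -> free_idem (1%:M - b *m (a *m G)) ->
  unimodular_free a.
Proof.
move=> GG' aGb fr c ac.
have [ee _ ae] := compl_idem ac; have [gg gb ag] := compl_idem aGb.
set e := 1%:M - c *m a in ee ae *; set g := 1%:M - _ in gg gb ag fr.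
have G'G := mulmx1C GG'.
have gG'e : g *m G' *m e = G' *m e.
  by rewrite mulmxBl mul1mx mulmxBl -!mulmxA (mulmxA G) GG' mul1mx ae mulmx0 subr0.
have eGg : e *m G *m g = G *m g.
  by rewrite mulmxBl mul1mx mulmxBl -!mulmxA (mulmxA a) ag mulmx0 subr0.
apply: (free_idem_equiv (x := G *m g) (y := G' *m e) (g := g)) => //.
  by rewrite mulmxA -(mulmxA G) -mulmxA gG'e mulmxA GG' mul1mx.
by rewrite mulmxA -(mulmxA G') -mulmxA eGg mulmxA G'G mul1mx.
Qed.

Lemma unimodular_free_step n (a : 'rV[A]_n) (G G' : 'M_n) :
  G *m G' = 1%:M -> unimodular_free (a *m G) -> unimodular_free a.
Proof.
move=> GG' fr c ac; have aGc : a *m G *m (G' *m c) = 1%:M.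
  by rewrite mulmxA -(mulmxA a) GG' mulmx1.
exact: (unimodular_free_mul GG' aGc (fr _ aGc)).
Qed.

Lemma unimodular_free_scale n (a : 'rV[A]_n) u v :
  u * v = 1 -> unimodular_free (u *: a) -> unimodular_free a.
Proof.
move=> uv; rewrite -mul_mx_scalar; apply: (unimodular_free_step (G' := v%:M)).
by rewrite -scalar_mxM uv.
Qed.

Lemma unimodular_free_small n (a : 'rV[A]_n) : (n < 2)%N -> unimodular_free a.
Proof.
case: n a => [|[]] // a _ b ab; last first.
  exists 0%N, 0, 0; split; last by apply/matrixP => -[].
  have ba : b *m a = 1%:M by exact: mulmx1C.
  by rewrite mulmx0 ba subrr.
exists 0%N, 0, 0; split; last by apply/matrixP => -[].
by apply/matrixP => -[].
Qed.

End Unimodular.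

Lemma map_free_idem (A B : comPzRingType) (f : {rmorphism A -> B}) n (e : 'M[A]_n) :
  free_idem e -> free_idem (map_mx f e).
Proof.
move=> [r [u [v [uv vu]]]]; exists r, (map_mx f u), (map_mx f v).
by rewrite -!map_mxM uv vu map_mx1.
Qed.

Section Spans.
Variable A : comNzRingType.

Definition span_of n (p : 'I_n -> A) := fun x => exists c : 'I_n -> A, x = \sum_i p i * c i.

Lemma span_of_ideal n (p : 'I_n -> A) : idealP (span_of p).
Proof.
split; first by exists (fun=> 0); rewrite big1 // => i _; rewrite mulr0.
  move=> _ _ [c ->] [d ->]; exists (fun i => c i + d i).
  by rewrite -big_split /=; apply: eq_bigr => i _; rewrite mulrDr.
move=> a _ [c ->]; exists (fun i => a * c i).
by rewrite mulr_sumr; apply: eq_bigr => i _; rewrite mulrCA.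
Qed.

Lemma mem_span_of n (p : 'I_n -> A) i : span_of p (p i).
Proof.
exists (fun j => (j == i)%:R); rewrite (bigD1 i) //= eqxx mulr1 big1 ?addr0 // => j.
by move/negbTE->; rewrite mulr0.
Qed.

Lemma ideal_comaximal_power (J : A -> Prop) x y e :
  idealP J -> J (x ^+ e) -> J (1 + x * y) -> J 1.
Proof.
move=> JI xe h; have [_ JD JM] := JI; elim: e xe => [|e IH]; first by rewrite expr0.
move=> xe; apply: IH; rewrite (_ : x ^+ e = x ^+ e * (1 + x * y) - y * x ^+ e.+1).
  by apply: idealB => //; exact: JM.
by rewrite exprS; ring.
Qed.

End Spans.

(** * Unimodular rows over R((t)) for a local ring R *)

Section LocalUnimodular.
Variables (R : comNzRingType) (m : R -> Prop) (mloc : local_at m).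
Variables (k : fieldType) (pi : {rmorphism R -> k}) (piP : residue_map m pi).
Local Notation t := (fpsX R).
Local Notation L := (localization (powers t)).
Local Notation tl := (toloc (powers t)).

(** The ideal of the p l contains a monic polynomial and is comaximal with m once 1 + X w is added.
    So 1 + X w is invertible modulo it, and X^d lies in it; reversal turns this into a relation over
    R[s]. *)
Lemma unimodular_reverse n (p c : 'I_n -> {poly R}) (w : {poly R}) N d i j :
  (forall l, (size (p l) <= N.+1)%N) -> (p j)`_N = 1 -> map_poly pi (p i) = 'X^N ->
  \sum_l p l * c l = 'X^d * (1 + 'X * w) ->
  exists c' : 'I_n -> {poly R}, \sum_l poly_rev N (p l) * c' l = 1.
Proof.
move=> sz pj1 piX pc; have JI := span_of_ideal p; have [_ JD JM] := JI.
have pjm : p j \is monic.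
  rewrite monicE lead_coefE (_ : (size (p j)).-1 = N) ?pj1 //.
  apply/eqP; rewrite -eqSS prednK.
    rewrite eqn_leq sz ltnNge; apply/negP => h; move: pj1.
    by rewrite nth_default // => /esym/eqP; rewrite oner_eq0.
  by rewrite lt0n size_poly_eq0; apply/eqP => p0; move: pj1; rewrite p0 coef0 => /esym/eqP; rewrite oner_eq0.
pose J' := add_principal (span_of p) (1 + 'X * w).
have J'I : idealP J' by exact: add_principal_ideal.
have J'p l : J' (p l) by apply: sub_add_principal; exact: mem_span_of.
(* Modulo m the ideal [J'] contains X^N, from [p i], and 1 + X w, hence everything. *)
have [j0 J'j0 j01] : exists2 j0, J' j0 & map_poly pi j0 = map_poly pi 1.
  apply: (@ideal_comaximal_power _ (fun x => exists2 j0, J' j0 & map_poly pi j0 = map_poly pi x) 'X w N).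
  - have [J'0 J'D J'M] := J'I; split; first by exists 0.
      by move=> x y [a Ja ax] [b Jb byy]; exists (a + b); [exact: J'D | rewrite !rmorphD /= ax byy].
    by move=> x y [a Ja ax]; exists (x * a); [exact: J'M | rewrite !rmorphM /= ax].
  - by exists (p i) => //; rewrite piX map_polyXn.
  - by exists (1 + 'X * w) => //; exact: mem_add_principal.
have [x [r [Jx e1]]] : J' 1.
  apply: (monic_ideal_comaximal mloc piP J'I pjm (J'p j) J'j0).
  by rewrite j01 rmorph1.
have [c2 Xd] : span_of p 'X^d.
  rewrite -[X in span_of _ X]mulr1 e1 mulrDr; apply: JD; first exact: JM.
  by rewrite mulrCA -pc; apply: JM; exists c.
have [f [fC fX]] := laurent_at_infinity R.
(* [M] bounds the degrees of the [c2 l]; the summand d keeps the exponent N + M - d from being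
   truncated. *)
pose M := (d + \max_l size (c2 l))%N.
have szc l : (size (c2 l) <= M.+1)%N.
  by apply: leqW; apply: (@leq_trans (\max_l0 size (c2 l0))); [exact: (leq_bigmax l) | exact: leq_addl].
have f_rev K (q : {poly R}) : (size q <= K.+1)%N -> tl (fps_poly q) = tl t ^+ K * f (poly_rev K q).
  move=> szq; rewrite -{1}(poly_revK szq); apply: at_infinity_rev => //.
  exact: size_poly.
have eqf : \sum_l poly_rev N (p l) * poly_rev M (c2 l) = 'X^(N + M - d).
  apply: (at_infinity_inj fC fX); rewrite rmorph_sum rmorphXn /=.
  have [v tv] := toloc_inv (mem_powers t (N + M)); rewrite rmorphXn /= in tv.
  have tcancel (x1 y1 : L) : tl t ^+ (N + M) * x1 = tl t ^+ (N + M) * y1 -> x1 = y1.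
    by move=> e; rewrite -[x1]mul1r -[y1]mul1r -tv mulrAC e mulrAC.
  apply: tcancel; rewrite (at_infinity_Xn fX) ?leq_subr // subKn; last first.
    by rewrite /M addnCA leq_addr.
  transitivity (tl (fps_poly 'X^d)); last by rewrite !rmorphXn /= fps_polyX.
  rewrite Xd !rmorph_sum mulr_sumr; apply: eq_bigr => l _.
  by rewrite !rmorphM /= (f_rev N) // (f_rev M) // exprD; ring.
have [c' c'1] : span_of (fun l => poly_rev N (p l)) 1; last by exists c'.
(* The leading coefficient 1 of [p j] becomes the constant coefficient after reversal. *)
apply: (@ideal_comaximal_power _ _ 'X (drop_poly 1 (poly_rev N (p j))) (N + M - d)).
- exact: span_of_ideal.
- by rewrite -eqf; exists (fun l => poly_rev M (c2 l)).
- rewrite (_ : 1 + _ = poly_rev N (p j)); first exact: mem_span_of.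
  rewrite -[RHS](poly_take_drop 1) expr1 mulrC; congr (_ + _).
  by apply/polyP => -[|l]; rewrite coef_poly coefC // coef_poly subn0 pj1.
Qed.

Hypothesis poly_free : idem_free {poly R}.

Lemma laurent_small_entry_free n (a : 'rV[fps R]_n) (b : 'cV[fps R]_n) d i j :
  i != j -> a *m b = (t ^+ d)%:M -> (forall l, m (coefs (a 0 i) l)) ->
  unimodular_free (map_mx tl a).
Proof.
(* With N = d + 1, the relation a b = t^d gives a (1 + t b c) = a + t^N c: passing from [a] to the
   row [p] is multiplication by an invertible matrix. *)
move=> ij ab ai; pose N := d.+1.
pose p (l : 'I_n) : {poly R} := fps_trunc N (a 0 l) + ((l == i) || (l == j))%:R * 'X^N.
have trunc_coef (l : 'I_n) : (fps_trunc N (a 0 l))`_N = 0 by rewrite coef_poly ltnn.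
have szt (l : 'I_n) : (size (fps_trunc N (a 0%R l)) <= N.+1)%N.
  by rewrite (leq_trans (size_poly _ _)).
have szp (l : 'I_n) : (size (p l) <= N.+1)%N.
  rewrite (leq_trans (size_polyD _ _)) // geq_max szt /=.
  by case: (_ || _); rewrite ?mul1r ?size_polyXn // mul0r size_poly0.
pose c (l : 'I_n) : fps R := (((l == i) || (l == j))%:R - fps_shift N (a 0 l)).
have pE l : fps_poly (p l) = a 0 l + t ^+ N * c l.
  rewrite /p /c; move: (fps_truncP N (a 0 l)); move: (fps_trunc N _) (fps_shift N _) => T U ->.
  by rewrite rmorphD rmorphM rmorph_nat rmorphXn /= fps_polyX; ring.
have ab1 : \sum_l a 0 l * b l 0 = t ^+ d.
  by have /matrixP/(_ 0 0) := ab; rewrite !mxE eqxx mulr1n.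
pose q (l : 'I_n) := fps_trunc N (b l 0).
have [w pq] : exists w, \sum_l p l * q l = 'X^d * (1 + 'X * w).
  pose s := \sum_l p l * q l.
  have sE : fps_poly s = t ^+ d + t ^+ N * (\sum_l (c l * b l 0 - fps_poly (p l) * fps_shift N (b l 0))).
    rewrite -ab1 mulr_sumr -big_split rmorph_sum; apply: eq_bigr => l _ /=.
    rewrite rmorphM /= /q.
    have /eqP := fps_truncP N (b l 0); rewrite -subr_eq => /eqP <-.
    by rewrite pE; ring.
  exists (drop_poly N s); rewrite -/s -[LHS](poly_take_drop N).
  rewrite mulrDr mulr1 mulrA -exprSr [_ * drop_poly _ _]mulrC; congr (_ + _).
  apply/polyP => l; rewrite coef_take_poly coefXn.
  have := congr1 (fun h => coefs h l) sE; rewrite coefsD coefsXnM /= => ->.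
  rewrite ltnS; case: ltngtP => h //.
  - by rewrite addr0 -[t ^+ d]mulr1 coefsXnM h.
  - by rewrite addr0 h -[t ^+ d]mulr1 coefsXnM ltnn subnn.
have [c' pc'] : exists c' : 'I_n -> {poly R}, \sum_l poly_rev N (p l) * c' l = 1.
  apply: (@unimodular_reverse _ p q w N d i j szp _ _ pq).
    by rewrite coefD trunc_coef add0r eqxx orbT mul1r coefXn eqxx.
  rewrite rmorphD rmorphM rmorph_nat eqxx mul1r /= map_polyXn (_ : map_poly _ _ = 0) ?add0r //.
  apply/(residue_poly_eq0 piP) => l; rewrite coef_poly; case: ifP => // _.
  by case: mloc => -[[]].
have [f [fC fX]] := laurent_at_infinity R.
pose G0 : 'M[fps R]_n := 1%:M + t *: (b *m \row_l c l).
have aG0 : a *m G0 = \row_l fps_poly (p l).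
  rewrite mulmxDr mulmx1 -scalemxAr mulmxA ab mul_scalar_mx scalerA -exprS.
  by apply/rowP => l; rewrite !mxE pE.
have [g gG0] : exists g, g * \det G0 = 1.
  apply: (@fps_inverse _ _ 1); rewrite mul1r -det_map_mx map_mxD map_mx1 map_mxZ /=.
  by rewrite scale0r addr0 det1.
pose alpha := \row_l f (poly_rev N (p l)).
have alphaE : map_mx tl (a *m G0) = (tl t ^+ N) *: alpha.
  rewrite aG0; apply/rowP => l; rewrite !mxE -at_infinity_rev ?poly_revK //.
  exact: size_poly.
have [v tv] := toloc_inv (mem_powers t N); rewrite rmorphXn /= in tv.
apply: (@unimodular_free_step _ _ _ (map_mx tl G0) (map_mx tl (g *: \adj G0))).
  rewrite -map_mxM -scalemxAr mul_mx_adj scale_scalar_mx gG0; exact: map_mx1.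
rewrite -map_mxM; apply: (unimodular_free_scale (u := v) (v := tl t ^+ N)); first by rewrite mulrC.
rewrite alphaE scalerA [v * _]mulrC tv scale1r.
pose alpha0 := \row_l poly_rev N (p l); pose beta0 := \col_l c' l.
have ab0 : alpha0 *m beta0 = 1%:M.
  apply/matrixP => x y; rewrite !ord1 !mxE eqxx -pc'.
  by apply: eq_bigr => l _; rewrite !mxE.
have alphaM : alpha = map_mx f alpha0 by apply/rowP => l; rewrite !mxE.
have [ee _ _] := compl_idem ab0.
have := map_free_idem f (poly_free ee); rewrite map_mxB map_mx1 map_mxM -alphaM => fr.
apply: (unimodular_free_mul (b := map_mx f beta0) (G := 1%:M) (G' := 1%:M)); rewrite ?mulmx1 //.
  by rewrite alphaM -map_mxM ab0 map_mx1.
Qed.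

Definition fps_over (I : R -> Prop) (g : fps R) := forall n, I (coefs g n).

Lemma fps_over_ideal I : idealP I -> idealP (fps_over I).
Proof.
move=> II; have [I0 ID IM] := II; split=> // [x y Ix Iy n|x y Iy n].
  by rewrite coefsD; exact: ID.
rewrite coefsM; elim/big_ind: _ => // i _; exact: IM.
Qed.

Lemma laurent_unimodular_free n (a : 'rV[L]_n) : unimodular_free a.
Proof.
have [|] := ltnP n 2; first exact: unimodular_free_small.
case: n a => [|[|n]] // a _ b ab; suff h : unimodular_free a by exact: h ab.
have [_ /asboolP[d1 ->] [a0 a0E]] := common_denominator a.
have [_ /asboolP[d2 ->] [b0 b0E]] := common_denominator b.
have inj := @map_toloc_inj _ (powers t) (@powers_fpsX_regular R).
have ab0 : a0 *m b0 = (t ^+ (d1 + d2))%:M.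
  apply: inj; rewrite map_mxM -a0E -b0E -scalemxAl -scalemxAr ab scalerA -rmorphM -exprD.
  by rewrite scalemx1 map_scalar_mx.
have [v tv] := toloc_inv (mem_powers t d1).
apply: (unimodular_free_scale tv); rewrite {}a0E.
have [mI _ _] := mloc.1; have fI := fps_over_ideal mI.
(* [l] is the least t-order modulo m of an entry; it exists because a0 b0 is a power of t, which is
   nonzero modulo m. *)
have [l /asboolP[j mj] lmin] : exists2 l, `[< exists j, ~ m (coefs (a0 0 j) l) >]
    & forall l', `[< exists j, ~ m (coefs (a0 0 j) l') >] -> (l <= l')%N.
  have /ex_minnP[l l1 l2] : exists l, `[< exists j, ~ m (coefs (a0 0 j) l) >]; last by exists l.
  apply: contrapT => h; have am j : fps_over m (a0 0 j).
    by move=> l; apply: contrapT => nm; apply: h; exists l; apply/asboolP; exists j.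
  have : fps_over m (t ^+ (d1 + d2)).
    have /matrixP/(_ 0 0) := ab0; rewrite !mxE eqxx mulr1n => <-.
    have [f0 fD fM] := fI; elim/big_ind: _ => // j _.
    by rewrite mulrC; exact: fM.
  move/(_ (d1 + d2)%N); rewrite -[t ^+ _]mulr1 coefsXnM ltnn subnn.
  by case: mloc => -[].
have small j' l' : (l' < l)%N -> m (coefs (a0 0 j') l').
  move=> ll; apply: contrapT => nm; have := lmin l' _; rewrite leqNgt ll /=.
  by move=> h; have /h : `[< exists j, ~ m (coefs (a0 0 j) l') >] by apply/asboolP; exists j'.
have [i ij] : exists i : 'I_n.+2, i != j.
  have [->|j0] := eqVneq j ord0; first by exists ord_max.
  by exists ord0; rewrite eq_sym.
have [u uc] := mloc.2 _ mj.
have [g gc] : exists g, g * fps_shift l (a0 0 j) = 1.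
  by apply: (@fps_inverse _ _ u); rewrite /fps_coef0 /= addn0.
(* Subtracting x times entry j from entry i cancels the terms divisible by t^l, and leaves a
   combination of truncations below t^l, whose coefficients lie in m. *)
pose x := g * fps_shift l (a0 0 i).
have dd : delta_mx j i *m delta_mx j i = 0 :> 'M[fps R]_n.+2 by rewrite mul_delta_mx_0.
pose E : 'M[fps R]_n.+2 := 1%:M - x *: delta_mx j i.
pose E' : 'M[fps R]_n.+2 := 1%:M + x *: delta_mx j i.
have EE' : E *m E' = 1%:M.
  rewrite mulmxDr mulmx1 mulmxBl mul1mx -scalemxAr -scalemxAl dd !scaler0 subr0.
  by rewrite subrK.
apply: (@unimodular_free_step _ _ _ (map_mx tl E) (map_mx tl E')).
  by rewrite -map_mxM EE' map_mx1.
rewrite -map_mxM.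
apply: (@laurent_small_entry_free _ (a0 *m E) (E' *m b0) (d1 + d2) i j) => //.
  by rewrite mulmxA -(mulmxA a0) EE' mulmx1.
have -> : (a0 *m E) 0 i = a0 0 i - x * a0 0 j.
  rewrite mulmxBr mulmx1 -scalemxAr !mxE; congr (_ - x * _).
  rewrite (bigD1 j) //= mxE !eqxx mulr1 big1 ?addr0 // => l' /negbTE l'j.
  by rewrite mxE l'j mulr0.
have Tm j' : fps_over m (fps_poly (fps_trunc l (a0 0 j'))).
  by move=> l' /=; rewrite coef_poly; case: ltnP => [/small//|_]; case: fI => + _ _; exact.
rewrite -/(fps_over m _) (_ : _ - _ = fps_poly (fps_trunc l (a0 0 i)) - x * fps_poly (fps_trunc l (a0 0 j))).
  by apply: (idealB fI); [exact: Tm | have [_ _ fM] := fI; apply: fM; exact: Tm].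
rewrite /x; move: (fps_truncP l (a0 0 i)) (fps_truncP l (a0 0 j)) gc.
set Ai := fps_poly _; set Bi := fps_shift _ _.
set Aj := fps_poly _; set Bj := fps_shift _ _ => -> -> gc.
apply/eqP; rewrite -subr_eq0; apply/eqP.
transitivity (t ^+ l * Bi * (1 - g * Bj)); first by ring.
by rewrite gc subrr mulr0.
Qed.

End LocalUnimodular.

(** * Descent from Laurent series *)

Lemma map_mx_inj_rmorph (A B : comPzRingType) (f : {rmorphism A -> B}) p q :
  injective f -> injective (map_mx f : 'M_(p, q) -> 'M_(p, q)).
Proof.
move=> fi M N /matrixP e; apply/matrixP => i j; apply: fi.
by have := e i j; rewrite !mxE.
Qed.

Lemma poly_hom_ext (R : comNzRingType) (B : comPzRingType) (f g : {rmorphism {poly R} -> B}) :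
  (forall c, f c%:P = g c%:P) -> f 'X = g 'X -> f =1 g.
Proof.
move=> eC eX; elim/poly_ind => [|p c IH]; first by rewrite !rmorph0.
by rewrite !rmorphD !rmorphM /= IH eC eX.
Qed.

Lemma loc_extend_inj (A B : comPzRingType) (S : mulrClosed A)
    (g : {rmorphism localization S -> B}) :
  injective (g \o toloc S) -> injective g.
Proof.
move=> inj x y exy; apply/eqP; rewrite -subr_eq0; apply/eqP; move: (x - y) (rmorphB g x y) => z.
rewrite exy subrr => gz; have [a [s sS e]] := toloc_frac z.
have a0 : a = 0 by apply: inj; rewrite /= -e rmorphM gz mul0r !rmorph0.
have [v sv] := toloc_inv sS.
by rewrite -[z]mulr1 -sv mulrA e a0 rmorph0 mul0r.
Qed.

(** Both [h] and [g] are invertible, so g (h g)^-1 h = 1; the adjugate clears the determinant. *)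
Lemma adj_sandwich (B : comPzRingType) r (h g : 'M[B]_r) c :
  \det (h *m g) * c = 1 -> g *m \adj (h *m g) *m h = (\det (h *m g))%:M.
Proof.
move=> dc; have hgK : h *m (g *m \adj (h *m g) *m h) = \det (h *m g) *: h.
  by rewrite !mulmxA mul_mx_adj mul_scalar_mx.
have cgh : c * \det g * \det h = 1 by rewrite -dc det_mulmx; ring.
move/(congr1 (fun M => (c * \det g) *: (\adj h *m M))): hgK.
rewrite (mulmxA (\adj h) h) mul_adj_mx mul_scalar_mx -scalemxAr mul_adj_mx !scalerA cgh scale1r => ->.
by rewrite scale_scalar_mx mulrAC cgh mul1r.
Qed.

(* Over a ring where [e] becomes free with basis [u], an approximation of [u] and of
   its dual basis [v] cut out all of [e] as soon as their pairing is invertible there. *)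
Lemma approximate_basis (A B : comPzRingType) (f : {rmorphism A -> B}) n r
    (e : 'M[A]_n) (u : 'M[B]_(n, r)) (v : 'M[B]_(r, n)) (u' : 'M[A]_(n, r)) (v' : 'M[A]_(r, n))
    (D := v' *m e *m u') c :
  injective f -> e *m e = e -> u *m v = map_mx f e -> v *m u = 1%:M -> f (\det D) * c = 1 ->
  e *m u' *m (\adj D *m v' *m e) = \det D *: e /\
  \adj D *m v' *m e *m (e *m u') = (\det D)%:M.
Proof.
move=> fi ee uv vu dc; split; last first.
  by rewrite mulmxA -(mulmxA (\adj D *m v')) ee -!mulmxA (mulmxA v') mul_adj_mx.
apply: (map_mx_inj_rmorph fi); rewrite map_mxZ -uv !map_mxM -uv.
pose h := map_mx f v' *m u; pose g := v *m map_mx f u'.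
have DE : map_mx f D = h *m g by rewrite !map_mxM -uv /h /g !mulmxA.
have adjE : map_mx f (\adj D) = \adj (h *m g) by rewrite -DE map_mx_adj.
have detE : f (\det D) = \det (h *m g) by rewrite -det_map_mx DE.
transitivity (u *m (g *m \adj (h *m g) *m h) *m v).
  by rewrite adjE /g /h !mulmxA.
rewrite (adj_sandwich (c := c)); last by rewrite -detE.
by rewrite mul_mx_scalar -scalemxAl detE.
Qed.

Section Descent.
Variable R : comNzRingType.
Local Notation t := (fpsX R).
Local Notation L := (localization (powers t)).
Local Notation tl := (toloc (powers t)).

Lemma laurent_approx n r (u : 'M[L]_(n, r)) : exists d (u0 : 'M[fps R]_(n, r)),
  tl t ^+ d *: u = map_mx tl u0 /\ forall N, exists (P : 'M[{poly R}]_(n, r)) G,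
    u0 = map_mx (@fps_poly R) P + t ^+ N *: G.
Proof.
have [_ /asboolP[d ->] [u0 u0E]] := common_denominator u.
exists d, u0; split; first by rewrite -u0E rmorphXn.
move=> N; exists (map_mx (fps_trunc N) u0), (map_mx (fps_shift N) u0).
by apply/matrixP => i j; rewrite !mxE -fps_truncP.
Qed.

(** [A] lies between R[t,1/t] and R((t)). It will be R<s>, where [d] turns out to be a unit, or
    R[t,1/t], where [d] is a polynomial with constant term 1. *)
Lemma descend_free_idem (A : comPzRingType) (f : {rmorphism A -> L})
    (g : {rmorphism {poly R} -> A}) n (e : 'M[A]_n) :
  injective f -> (forall p, f (g p) = tl (fps_poly p)) ->
  (exists w, g 'X * w = 1) -> e *m e = e -> free_idem (map_mx f e) ->
  exists r (u : 'M[A]_(n, r)) (v : 'M[A]_(r, n)) d x,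
    [/\ u *m v = d *: e, v *m u = d%:M, e *m u = u, v *m e = v
      & f d = tl x /\ fps_coef0 x = 1].
Proof.
move=> fi fg [w Xw] ee [r [u [v [uv vu]]]].
have [d1 [u0 [u0E approx_u]]] := laurent_approx u.
have [d2 [v0 [v0E approx_v]]] := laurent_approx v.
(* The scaled bases pair to t^(d1 + d2), so errors of one order higher change the pairing only by
   the matrix [X] below, which is 1 modulo t. *)
pose N := (d1 + d2).+1.
have [P [G PG]] := approx_u N; have [Q [H QH]] := approx_v N.
pose u' := map_mx g P; pose v' := w ^+ (d1 + d2) *: map_mx g Q.
pose D := v' *m e *m u'.
pose X := (1%:M - t *: (H *m u0)) *m (1%:M - t *: (v0 *m G)).
have fX : f (g 'X) = tl t by rewrite fg fps_polyX.
pose dd := (d1 + d2)%N.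
have fw : tl t ^+ dd * f w ^+ dd = 1.
  by rewrite -exprMn -fX -rmorphM Xw rmorph1 expr1n.
have v0u0 : v0 *m u0 = (t ^+ dd)%:M.
  apply: (map_mx_inj_rmorph (@laurent_inj R)).
  rewrite map_mxM -v0E -u0E -scalemxAl -scalemxAr vu scalerA -exprD addnC.
  rewrite scalemx1 map_scalar_mx; congr (scalar_mx _); by rewrite rmorphXn.
pose U' := u0 - t ^+ N *: G; pose V' := v0 - t ^+ N *: H.
have V'u : tl t ^+ d1 *: (map_mx tl V' *m u) = tl t ^+ dd *: map_mx tl (1%:M - t *: (H *m u0)).
  rewrite scalemxAr u0E -map_mxM -rmorphXn -map_mxZ; congr (map_mx _ _).
  by rewrite mulmxBl v0u0 scalerBr scalemx1 -scalemxAl scalerA -exprSr.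
have vU' : tl t ^+ d2 *: (v *m map_mx tl U') = tl t ^+ dd *: map_mx tl (1%:M - t *: (v0 *m G)).
  rewrite [LHS]scalemxAl v0E -map_mxM -rmorphXn -map_mxZ; congr (map_mx _ _).
  by rewrite mulmxBr v0u0 scalerBr scalemx1 -scalemxAr scalerA -exprSr.
have DX : map_mx f D = map_mx tl X.
  have fu' : map_mx f u' = map_mx tl U'.
    by rewrite /U' {1}PG addrK; apply/matrixP => i j; rewrite !mxE; exact: fg.
  have fv' : map_mx f v' = f w ^+ dd *: map_mx tl V'.
    rewrite /V' {1}QH addrK map_mxZ rmorphXn; congr (_ *: _).
    by apply/matrixP => i j; rewrite !mxE; exact: fg.
  have -> : map_mx f D = f w ^+ dd *: (map_mx tl V' *m u *m (v *m map_mx tl U')).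
    by rewrite !map_mxM -uv fu' fv' -!scalemxAl !mulmxA.
  have : (tl t ^+ d1 *: (map_mx tl V' *m u)) *m (tl t ^+ d2 *: (v *m map_mx tl U'))
      = tl t ^+ dd *: (tl t ^+ dd *: map_mx tl X).
    by rewrite V'u vU' -scalemxAl -scalemxAr -map_mxM.
  rewrite -scalemxAl -scalemxAr [LHS]scalerA -exprD -/dd; move: (_ *m _) => M MX.
  have wt : f w ^+ dd * tl t ^+ dd = 1 by rewrite mulrC fw.
  rewrite -[M]scale1r -[in LHS]wt -scalerA MX !scalerA.
  by rewrite mulrACA wt mul1r scale1r.
have detX : fps_coef0 (\det X) = 1.
  rewrite -det_map_mx map_mxM !map_mxB !map_mx1 !map_mxZ /=.
  by rewrite !scale0r subr0 mulmx1 det1.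
have [c cX] : exists c, c * \det X = 1 by apply: (@fps_inverse _ _ 1); rewrite detX mulr1.
have fdet : f (\det D) = tl (\det X) by rewrite -!det_map_mx DX.
have [|e1 e2] := @approximate_basis _ _ f _ _ e u v u' v' (tl c) fi ee uv vu.
  by rewrite fdet mulrC -rmorphM cX rmorph1.
exists r, (e *m u'), (\adj D *m v' *m e), (\det D), (\det X); split=> //.
- by rewrite (mulmxA e e) ee.
- by rewrite -(mulmxA _ e e) ee.
Qed.

End Descent.

(** * Comparison of R<s> and R[t,1/t] with R((t)) *)

Section MonicAndLaurent.
Variable R : comNzRingType.
Local Notation t := (fpsX R).
Local Notation L := (localization (powers t)).
Local Notation tl := (toloc (powers t)).
Local Notation S := (@monic_pred R : {pred {poly R}}).
Local Notation W := (localization S).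
Local Notation tw := (toloc S).
Local Notation T := (localization (powers ('X : {poly R}))).
Local Notation tt := (toloc (powers ('X : {poly R}))).

Lemma monic_regular (s a b : {poly R}) : s \in S -> s * a = s * b -> a = b.
Proof. by move=> /monic_lreg; exact. Qed.

Lemma monic_inj : injective tw.
Proof. exact: toloc_inj monic_regular. Qed.

Lemma monic_one_neq0 : (1 : W) != 0.
Proof.
apply/eqP; rewrite -(rmorph1 tw) -(rmorph0 tw) => /monic_inj/eqP.
by rewrite oner_eq0.
Qed.

Lemma powersX_regular (s a b : {poly R}) : s \in powers 'X -> s * a = s * b -> a = b.
Proof. by move=> /asboolP[n ->]; apply: monic_regular; exact: monicXn. Qed.

Lemma laurent_poly_inj : injective tt.
Proof. exact: toloc_inj powersX_regular. Qed.

Section AtInfinity.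
Variable f : {rmorphism {poly R} -> L}.
Hypothesis fC : forall c, f c%:P = tl (fps_poly c%:P).
Hypothesis fX : f 'X * tl t = 1.

(** The reversal of a monic polynomial has constant term 1, hence is an invertible series. *)
Lemma at_infinity_monic_unit s : s \in S -> exists v, f s * v = 1.
Proof.
move=> sm; pose N := (size s).-1.
have szs : size s = N.+1 by rewrite prednK // lt0n size_poly_eq0 monic_neq0.
have [g gs] : exists g, g * fps_poly (poly_rev N s) = 1.
  apply: (@fps_inverse _ _ 1); rewrite mul1r /fps_coef0 /= coef_poly subn0.
  exact/eqP.
exists (tl t ^+ N * tl g); rewrite mulrA mulrC [f s * _]mulrC -at_infinity_rev ?szs //.
by rewrite -rmorphM gs rmorph1.
Qed.

(** A factor with constant term 1 does not change the leading term at infinity, so [a] inherits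
    degree and leading coefficient from [s]. *)
Lemma at_infinity_quotient_monic (s a : {poly R}) x :
  s \is monic -> f a = f s * tl x -> fps_coef0 x = 1 -> a \is monic.
Proof.
move=> sm fa x1; pose N := maxn (size a) (size s); pose e := (size s).-1.
have szs : size s = e.+1 by rewrite prednK // lt0n size_poly_eq0 monic_neq0.
have eN : (e < N)%N by rewrite -szs leq_maxr.
have rev_a : fps_poly (poly_rev N a) = fps_poly (poly_rev N s) * x.
  apply: (@laurent_inj R); rewrite rmorphM /= !(at_infinity_rev fC fX) ?leqW ?leq_maxl ?leq_maxr //.
  by rewrite fa mulrA.
have coef_a i : (i <= N)%N -> a`_i = \sum_(l < (N - i).+1) s`_(N - l) * coefs x (N - i - l).
  move=> iN; have := congr1 (fun h => coefs h (N - i)) rev_a.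
  rewrite coefsM /= coef_poly ltnS leq_subr subKn // => ->.
  apply: eq_bigr => l _; rewrite coef_poly ltnS (leq_trans _ (leq_subr i N)) //.
  by rewrite -ltnS.
have ae : a`_e = 1.
  rewrite coef_a ?(ltnW eN) // big_ord_recr /= subKn ?(ltnW eN) // subnn.
  rewrite (_ : coefs x 0 = 1) // mulr1 big1 ?add0r => [|l _]; first exact: (monicP sm).
  rewrite nth_default ?mul0r // szs ltn_subRL addnC -ltn_subRL; exact: ltn_ord.
have sza : (size a <= e.+1)%N.
  apply/leq_sizeP => i ei; have [iN|iN] := leqP i N; last first.
    by rewrite nth_default // (leq_trans _ (ltnW iN)) // leq_maxl.
  rewrite coef_a // big1 // => l _; rewrite nth_default ?mul0r // szs ltn_subRL.
  have := ltn_ord l; rewrite ltnS => h; rewrite addnC.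
  rewrite -ltn_subRL; apply: leq_ltn_trans h _.
  by rewrite ltn_sub2l.
have sza' : size a = e.+1.
  apply/eqP; rewrite eqn_leq sza ltnNge; apply/negP => h; move: ae.
  by rewrite nth_default // => /esym/eqP; rewrite oner_eq0.
by rewrite monicE lead_coefE sza' ae.
Qed.

End AtInfinity.

(** The variable of R<t> is read as s = 1/t. The [d] of [descend_free_idem] is a fraction with monic
    numerator, hence a unit, and can be divided out. *)
Lemma idem_free_laurent_monic : idem_free L -> idem_free W.
Proof.
move=> Lfree n e ee.
have [f [fC fX]] := laurent_at_infinity R.
have [g gE] := loc_extend (at_infinity_monic_unit fC fX).
have [w Xw] := toloc_inv (monicX R : 'X \in S).
have [h [hC hX]] := @poly_hom_exists R W (tw \o polyC) w monic_one_neq0.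
have gi : injective g.
  by apply: loc_extend_inj => x y; rewrite /= !gE; exact: at_infinity_inj.
have gh p : g (h p) = tl (fps_poly p).
  pose g1 : {rmorphism {poly R} -> L} := g \o h.
  pose g2 : {rmorphism {poly R} -> L} := tl \o @fps_poly R.
  apply: (@poly_hom_ext _ _ g1 g2) => [c|] /=; first by rewrite hC /= gE fC.
  rewrite fps_polyX hX -[LHS]mulr1 -fX mulrA -gE -rmorphM mulrC [w * _]mulrC Xw.
  by rewrite rmorph1 mulr1.
have [||r [u [v [d [x [uv vu eu ve [gd x1]]]]]]] := descend_free_idem gi gh _ ee.
- by exists (tw 'X); rewrite hX mulrC.
- by apply: Lfree; rewrite -map_mxM ee.
have [a [s sS ds]] := toloc_frac d.
have am : a \is monic.
  apply: (at_infinity_quotient_monic fC fX sS _ x1).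
  by rewrite -gE -ds rmorphM gE gd mulrC.
have [c ac] := toloc_inv (am : a \in S).
have dc : (tw s * c) * d = 1 by rewrite mulrAC [tw s * d]mulrC ds.
exists r, ((tw s * c) *: u), v; split; first by rewrite -scalemxAl uv scalerA dc scale1r.
by rewrite -scalemxAr vu scale_scalar_mx dc.
Qed.

Lemma free_laurent_poly_monic n (e : 'M[{poly R}]_n) :
  free_idem (map_mx tt e) -> free_idem (map_mx tw e).
Proof.
have [g gE] : exists g : {rmorphism T -> W}, forall a, g (tt a) = tw a.
  apply: loc_extend => _ /asboolP[d ->].
  by apply: toloc_inv; exact: monicXn.
move=> /(map_free_idem g); rewrite -map_mx_comp (_ : map_mx (g \o tt) e = map_mx tw e) //.
by apply/matrixP => i j; rewrite !mxE /= gE.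
Qed.

(* [e] is patched with the free module on [u], which agrees with it where [g] is invertible. *)
Lemma patch_free_idem n r (e : 'M[T]_n) (u : 'M[T]_(n, r)) (v : 'M[T]_(r, n)) (g : {poly R}) :
  idem_free {poly R} -> e *m e = e -> u *m v = tt g *: e -> v *m u = (tt g)%:M ->
  e *m u = u -> v *m e = v -> g`_0 = 1 -> free_idem e.
Proof.
move=> pfree ee uv vu eu ve g1.
have [_ /asboolP[d1 ->] [E EE]] := common_denominator e.
have [_ /asboolP[d2 ->] [U UE]] := common_denominator u.
have [_ /asboolP[d3 ->] [V VE]] := common_denominator v.
pose M := (d1 + d2 + d3)%N.
have [w Xw] : exists w, tt 'X^d2 * w = 1 by apply: toloc_inv; exact: mem_powers.
(* A partition of unity 1 = alpha X^(2M) + beta g, available because g is 1 modulo X. *)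
have [_ [beta [[_ [alpha [-> ->]]] /esym ab1]]] :
    add_principal (add_principal zero_ideal 'X^(M + M)) g 1.
  have JI : idealP (add_principal (add_principal zero_ideal 'X^(M + M)) g).
    by do 2!apply: add_principal_ideal; exact: zero_idealP.
  apply: (@ideal_comaximal_power _ _ 'X (drop_poly 1 g) (M + M) JI).
    by apply: sub_add_principal; apply: mem_add_principal; exact: zero_idealP.
  rewrite (_ : 1 + _ = g); first by apply: mem_add_principal; apply: add_principal_ideal; exact: zero_idealP.
  rewrite -[RHS](poly_take_drop 1) expr1 mulrC; congr (_ + _).
  by apply/polyP => -[|l]; rewrite coef_take_poly coefC //= g1.
rewrite add0r in ab1.
have [u1 u1E] : exists u1, u1 = tt 'X^d2 *: u by exists (tt 'X^d2 *: u).
have [v1 v1E] : exists v1, v1 = w *: v by exists (w *: v).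
have u1v1 : u1 *m v1 = tt g *: e by rewrite u1E v1E -scalemxAl -scalemxAr uv !scalerA Xw mul1r.
have v1u1 : v1 *m u1 = (tt g)%:M.
  by rewrite u1E v1E -scalemxAl -scalemxAr vu scalerA [w * _]mulrC Xw scale1r.
have eu1 : e *m u1 = u1 by rewrite u1E -scalemxAr eu.
have v1e : v1 *m e = v1 by rewrite v1E -scalemxAl ve.
have [E' E'E] : exists E', map_mx tt E' = tt 'X^M *: e.
  exists ('X^(d2 + d3) *: E).
  rewrite map_mxZ -EE scalerA -rmorphM -exprD; congr (tt 'X^_ *: _).
  by rewrite addnC addnA.
have [V' V'E] : exists V', map_mx tt V' = tt 'X^M *: v1.
  exists ('X^d1 *: V).
  rewrite map_mxZ -VE v1E !scalerA -[tt _ * tt _]mulr1 -Xw mulrA -!rmorphM -!exprD.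
  by congr (tt 'X^_ * _ *: _); rewrite /M addnAC.
(* Over R[t,1/t] this is [X *m Y] with [Y *m X = e], so [F] is idempotent and presents the same
   module as [e]; the powers of the variable absorbed in [E'], [U] and [V'] make it polynomial. *)
pose F : 'M[{poly R}]_(n + r) := block_mx (alpha * 'X^M *: E') (alpha * 'X^M *: U)
  (beta *: V') (beta * g)%:M.
pose X : 'M_(n + r, n) := col_mx (tt (alpha * 'X^M) *: e) (tt beta *: v1).
pose Y : 'M_(n, n + r) := row_mx (tt 'X^M *: e) u1.
have YX : Y *m X = e.
  rewrite mul_row_col -!scalemxAl -!scalemxAr ee u1v1 !scalerA -scalerDl -!rmorphM -rmorphD.
  rewrite (_ : _ + _ = 1) ?rmorph1 ?scale1r // -ab1 exprD; ring.
have FE : map_mx tt F = X *m Y.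
  rewrite map_block_mx mul_col_row !map_mxZ E'E V'E -UE -u1E map_scalar_mx; congr block_mx.
  - by rewrite -scalemxAl -scalemxAr ee.
  - by rewrite -scalemxAl eu1.
  - by rewrite -scalemxAl -scalemxAr v1e.
  - by rewrite -scalemxAl v1u1 rmorphM scale_scalar_mx.
have FF : F *m F = F.
  apply: (map_mx_inj_rmorph laurent_poly_inj); rewrite map_mxM FE.
  rewrite mulmxA -(mulmxA X) YX; congr (_ *m _).
  by rewrite mul_col_mx -!scalemxAl ee v1e.
apply: (free_idem_equiv ee YX erefl); rewrite -FE.
exact: map_free_idem (pfree _ _ FF).
Qed.

Lemma idem_free_laurent_poly : idem_free {poly R} -> idem_free L -> idem_free T.
Proof.
move=> pfree Lfree n e ee.
have [|f fE] := @loc_extend _ (powers ('X : {poly R})) L (tl \o @fps_poly R).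
  move=> _ /asboolP[d ->]; rewrite /= (rmorphXn (@fps_poly R)) /= fps_polyX.
  exact: toloc_inv (mem_powers t d).
have {}fE p : f (tt p) = tl (fps_poly p) by exact: fE.
have fi : injective f.
  by apply: loc_extend_inj => x y; rewrite /= !fE => /laurent_inj/fps_poly_inj.
have [||r [u [v [d [x [uv vu eu ve [fd x1]]]]]]] := descend_free_idem fi fE _ ee.
- by apply: toloc_inv; exact: (mem_powers _ 1).
- by apply: Lfree; rewrite -map_mxM ee.
have [a [_ /asboolP[j ->] da]] := toloc_frac d.
have ax : fps_poly a = t ^+ j * x.
  apply: (@laurent_inj R); rewrite -fE -da rmorphM fE /= fd -rmorphM mulrC.
  by rewrite rmorphXn /= fps_polyX.
(* As a series [a] is t^j x, so its coefficients below j vanish and [d] is a polynomial with the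
   constant term 1 of [x]. *)
have aE : a = drop_poly j a * 'X^j.
  rewrite -[LHS](poly_take_drop j) (_ : take_poly j a = 0) ?add0r //.
  apply/polyP => i; rewrite coef_take_poly coef0; case: ifP => // ij.
  by have := congr1 (fun h => coefs h i) ax; rewrite coefsXnM ij.
have dE : d = tt (drop_poly j a).
  have [w Xw] : exists w, tt 'X^j * w = 1 by apply: toloc_inv; exact: mem_powers.
  by rewrite -[d]mulr1 -Xw mulrA da aE rmorphM -mulrA Xw mulr1 -aE.
rewrite dE in uv vu; apply: (patch_free_idem pfree ee uv vu eu ve).
rewrite coef_drop_poly add0n.
by have := congr1 (fun h => coefs h j) ax; rewrite coefsXnM ltnn subnn /= => ->.
Qed.

End MonicAndLaurent.

(** * Horrocks' theorem *)

Section PolyField.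
Variable k : fieldType.

(** [c *m a] is a nonzero combination of least degree; Euclidean division shows that it divides all
    entries. *)
Lemma poly_column_gcd m (a : 'cV[{poly k}]_m) :
  exists (c : 'rV_m) (b : 'cV_m), a = b *m (c *m a).
Proof.
have [->|a0] := eqVneq a 0; first by exists 0, 0; rewrite mul0mx.
have [i0 ai0] : exists i, a i 0 != 0.
  apply/existsP; apply: contraR a0 => /existsPn h; apply/eqP/colP => i.
  by rewrite mxE; apply/eqP; have := h i; rewrite negbK.
pose val (c : 'rV_m) := (c *m a) 0 0.
have /ex_minnP[l /asboolP[c [c0 sc]] lmin] :
    exists l, `[< exists c : 'rV_m, val c != 0 /\ size (val c) = l >].
  exists (size (a i0 0)); apply/asboolP; exists (delta_mx 0 i0).
  by rewrite /val -rowE mxE.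
exists c, (\col_i (a i 0 %/ val c)); apply/colP => i.
rewrite !mxE big_ord1 mxE -/(val c).
apply/eqP; rewrite -subr_eq0; apply: contraT => r0.
pose c' := delta_mx 0 i - (a i 0 %/ val c) *: c.
have c'E : val c' = a i 0 - a i 0 %/ val c * val c.
  by rewrite /c' /val mulmxBl -rowE -scalemxAl; move: (c *m a) => ca; rewrite !mxE.
have := lmin (size (val c')) _; rewrite leqNgt -sc.
have -> : (size (val c') < size (val c))%N.
  rewrite c'E {1}(divp_eq (a i 0) (val c)) addrAC subrr add0r.
  by rewrite ltn_modp.
by apply; apply/asboolP; exists c'; rewrite c'E.
Qed.

(** Hermite reduction, column by column: if the first column is nonzero, its gcd is the pivot of the
    new basis row [y], and the rest has zero first column. *)
Lemma poly_row_basis m n (M : 'M[{poly k}]_(m, n)) :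
  exists r (X : 'M_(m, r)) (Y : 'M_(r, n)) (Z : 'M_(r, m)),
    [/\ M = X *m Y, Y = Z *m M & forall c : 'rV_r, c *m Y = 0 -> c = 0].
Proof.
elim: n m M => [|n IH] m M.
  by exists 0, 0, 0, 0; split=> [||c _]; apply/matrixP => i [].
pose L := lsubmx (M : 'M_(m, 1 + n)).
have ext r (Y : 'M[{poly k}]_(r, n)) : (forall c : 'rV_r, c *m Y = 0 -> c = 0) ->
    forall c : 'rV_r, c *m row_mx (0 : 'cV_r) Y = 0 -> c = 0.
  move=> ind c; rewrite mul_mx_row mulmx0 => e; apply: ind.
  by have := congr1 (fun w : 'rV_(1 + n) => rsubmx w) e; rewrite row_mxKr linear0.
have [L0|L0] := eqVneq L 0.
  have [r [X [Y [Z [ME YE ind]]]]] := IH m (rsubmx (M : 'M_(m, 1 + n))).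
  have M0 : M = row_mx 0 (rsubmx (M : 'M_(m, 1 + n))) :> 'M_(m, 1 + n).
    by rewrite -{1}(hsubmxK (M : 'M_(m, 1 + n))) -/L L0.
  exists r, X, (row_mx (0 : 'cV_r) Y), Z; split; last exact: ext.
    by rewrite {1}M0 (@mul_mx_row _ m r 1 n) mulmx0 -ME.
  by rewrite M0 (@mul_mx_row _ r m 1 n) mulmx0 -YE.
have [c [b LE]] := poly_column_gcd L.
pose y := c *m (M : 'M_(m, 1 + n)); pose M' : 'M_(m, 1 + n) := M - b *m y.
have yL : lsubmx y = c *m L by rewrite /y -mulmx_lsub.
have [r [X [Y [Z [M'E YE ind]]]]] := IH m (rsubmx M').
have M'row : M' = row_mx 0 (rsubmx M').
  rewrite -{1}(hsubmxK M'); congr row_mx; rewrite /M' linearB /=.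
  by rewrite -mulmx_lsub yL -LE subrr.
have M'X : M' = X *m row_mx 0 Y by rewrite mul_mx_row mulmx0 -M'E.
have YZ : row_mx 0 Y = (Z *m (1%:M - b *m c)) *m (M : 'M_(m, 1 + n)).
  rewrite -mulmxA mulmxBl mul1mx -mulmxA -/y -/M' M'row mul_mx_row mulmx0.
  by rewrite -YE.
have ME : M = b *m y + X *m row_mx 0 Y :> 'M_(m, 1 + n) by rewrite -M'X addrC subrK.
have d0 : (c *m L) 0 0 != 0.
  apply: contraNneq L0 => d0; rewrite LE (_ : c *m L = 0) ?mulmx0 //.
  by apply/matrixP => i j; rewrite !ord1 d0 mxE.
exists (1 + r)%N, (row_mx b X), (col_mx y (row_mx (0 : 'cV_r) Y)), (col_mx c (Z *m (1%:M - b *m c))).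
split.
- by rewrite (@mul_row_col _ m 1 r).
- by rewrite (@mul_col_mx _ 1 r) -YZ.
move=> v; rewrite -(hsubmxK (v : 'rV_(1 + r))) mul_row_col => v0.
have v1 : lsubmx (v : 'rV_(1 + r)) = 0.
  have := congr1 (fun w : 'rV_(1 + n) => lsubmx w) v0.
  rewrite linearD /= -(mulmx_lsub _ y) -(mulmx_lsub _ (row_mx _ _)) row_mxKl mulmx0 addr0 yL linear0.
  move/matrixP/(_ 0 0); rewrite !mxE big_ord1 => /eqP; rewrite mulf_eq0 (negbTE d0) orbF => /eqP v00.
  by apply/matrixP => i j; rewrite !ord1 v00 mxE.
move: v0; rewrite v1 mul0mx add0r => /(ext _ _ ind)->; exact: row_mx0.
Qed.

Lemma idem_free_poly_field : idem_free {poly k}.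
Proof.
move=> n e ee; have [r [X [Y [Z [eE YE ind]]]]] := poly_row_basis e.
exists r, X, Y; split; first by [].
have YXY : Y *m X *m Y = Y by rewrite -mulmxA -eE {1}YE -mulmxA ee -YE.
apply/eqP; rewrite -subr_eq0; apply/eqP/row_matrixP => i; rewrite row0; apply: ind.
by rewrite -row_mul mulmxBl YXY mul1mx subrr row0.
Qed.

End PolyField.

(** In an LUP decomposition each factor lifts to an invertible matrix: the permutation, the
    unitriangular factor, and the upper triangular one, whose diagonal entries lift to units. *)
Lemma lift_unit_mx (B : comPzRingType) (K : fieldType) (f : {rmorphism B -> K}) r (g : 'M[K]_r) :
  (forall y, exists x, f x = y) ->
  (forall y, y != 0 -> exists x x', f x = y /\ x * x' = 1) ->
  \det g != 0 -> exists h h' : 'M[B]_r, h *m h' = 1%:M /\ map_mx f h = g.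
Proof.
move=> /choice[s sK] unit_lift; case: r g => [|r] g g0.
  by exists 0, 0; split; apply/matrixP => -[].
have det_inv (M : 'M[B]_r.+1) c : \det M * c = 1 -> M *m (c *: \adj M) = 1%:M.
  by move=> Mc; rewrite -scalemxAr mul_mx_adj scale_scalar_mx mulrC Mc.
have := cormen_lup_correct g; have := cormen_lup_perm g; have := cormen_lup_detL g.
have := @cormen_lup_lower _ _ g; have := @cormen_lup_upper _ _ g.
case: (cormen_lup g) => [[P D] U] /= Uup Dlow detD /is_perm_mxP[w ->] PDU {P}.
pose D' : 'M[B]_r.+1 := \matrix_(i, j) if (i <= j)%N then (i == j)%:R else s (D i j).
have D'D : map_mx f D' = D.
  apply/matrixP => i j; rewrite !mxE; case: ifP => ij; last exact: sK.
  by rewrite Dlow // rmorph_nat.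
have detD' : \det D' = 1.
  rewrite det_trig.
    by rewrite big1 // => i _; rewrite mxE leqnn eqxx.
  by apply/is_trig_mxP => i j ij; rewrite mxE (ltnW ij) -val_eqE /= (ltn_eqF ij).
have detU : \det U = \prod_i U i i.
  rewrite -det_tr det_trig; first by apply: eq_bigr => i _; rewrite mxE.
  by apply/is_trig_mxP => i j ij; rewrite mxE Uup.
have Uii i : U i i != 0.
  have : \det (perm_mx w *m g) != 0.
    by rewrite det_mulmx det_perm mulf_neq0 // signr_eq0.
  rewrite (PDU : perm_mx w *m g = D *m U) det_mulmx detD mul1r detU.
  by move/prodf_neq0; apply.
have /choice[x /choice[x' xP]] i := unit_lift _ (Uii i).
pose U' : 'M[B]_r.+1 := \matrix_(i, j) if i == j then x i else if (j < i)%N then 0 else s (U i j).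
have U'U : map_mx f U' = U.
  apply/matrixP => i j; rewrite !mxE; case: eqP => [<-|_]; first exact: (xP i).1.
  by case: ifP => ij; rewrite ?sK // rmorph0 Uup.
have detU' : \det U' * \prod_i x' i = 1.
  rewrite -det_tr det_trig; last first.
    by apply/is_trig_mxP => i j ij; rewrite !mxE ij -val_eqE /= gtn_eqF.
  rewrite -big_split big1 // => i _; rewrite !mxE eqxx; exact: (xP i).2.
exists (perm_mx w^-1 *m D' *m U'), (((\prod_i x' i) *: \adj U') *m (1 *: \adj D') *m perm_mx w).
split.
  rewrite !mulmxA -(mulmxA _ U') det_inv // mulmx1 -(mulmxA _ D') det_inv ?mulmx1 ?detD' ?mul1r //.
  by rewrite -perm_mxM mulVg perm_mx1.
rewrite !map_mxM D'D U'U map_perm_mx -mulmxA -(PDU : perm_mx w *m g = D *m U).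
by rewrite mulmxA -perm_mxM mulVg perm_mx1 mul1mx.
Qed.

(** * Fractions filtered by degree, and Horrocks' theorem over a local ring *)

Section Horrocks.
Variables (R : comNzRingType) (m : R -> Prop) (mloc : local_at m).
Variables (k : fieldType) (pi : {rmorphism R -> k}) (piP : residue_map m pi).
Local Notation S := (@monic_pred R : {pred {poly R}}).
Local Notation W := (localization S).
Local Notation tw := (toloc S).
Local Notation K := {fraction {poly k}}.
Local Notation tk := (@tofrac {poly k}).
Local Notation red := (map_poly pi).

(* [degree_lt 0] and [degree_lt 1] are the fractions of negative
   and of nonpositive degree. *)
Definition degree_lt (d : nat) (x : W) := exists p s : {poly R},
  [/\ s \is monic, (size p < size s + d)%N & x * tw s = tw p].

Local Notation neg := (degree_lt 0).
Local Notation npos := (degree_lt 1).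

Lemma size_monic_gt0 (s : {poly R}) : s \is monic -> (0 < size s)%N.
Proof. by move=> sm; rewrite lt0n size_poly_eq0 monic_neq0. Qed.

Lemma npos_mul_neg x y : npos x -> neg y -> neg (x * y).
Proof.
move=> [p [s [sm ps xs]]] [q [u [um qu yu]]]; exists (p * q), (s * u); split.
- exact: rpredM.
- rewrite (@size_Mmonic _ s u) ?monic_neq0 //; have := size_polyMleq p q.
  have := size_monic_gt0 sm; have := size_monic_gt0 um; lia.
- by rewrite !rmorphM /= -xs -yu; ring.
Qed.

Lemma npos_mul x y : npos x -> npos y -> npos (x * y).
Proof.
move=> [p [s [sm ps xs]]] [q [u [um qu yu]]]; exists (p * q), (s * u); split.
- exact: rpredM.
- rewrite (@size_Mmonic _ s u) ?monic_neq0 //; have := size_polyMleq p q.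
  have := size_monic_gt0 sm; have := size_monic_gt0 um; lia.
- by rewrite !rmorphM /= -xs -yu; ring.
Qed.

Lemma degree_lt_add d x y : degree_lt d x -> degree_lt d y -> degree_lt d (x + y).
Proof.
move=> [p [s [sm ps xs]]] [q [u [um qu yu]]]; exists (p * u + q * s), (s * u); split.
- exact: rpredM.
- apply: leq_ltn_trans (size_polyD _ _) _; rewrite (@size_Mmonic _ s u) ?monic_neq0 //.
  have := size_polyMleq p u; have := size_polyMleq q s.
  have := size_monic_gt0 sm; have := size_monic_gt0 um; lia.
- by rewrite rmorphD !rmorphM /= -xs -yu; ring.
Qed.

Lemma degree_lt_opp d x : degree_lt d x -> degree_lt d (- x).
Proof.
move=> [p [s [sm ps xs]]]; exists (- p), s; split=> //; first by rewrite size_polyN.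
by rewrite rmorphN mulNr xs.
Qed.

Lemma npos_const c : npos (tw c%:P).
Proof.
exists c%:P, 1; split; [exact: monic1 | | by rewrite rmorph1 mulr1].
by rewrite size_poly1 (leq_ltn_trans (size_polyC_leq1 _)).
Qed.

Lemma neg0 : neg 0.
Proof.
by exists 0, 1; split; [exact: monic1 | rewrite size_poly0 size_poly1 | rewrite mul0r rmorph0].
Qed.

Lemma neg_npos x : neg x -> npos x.
Proof. by move=> [p [s [sm ps xs]]]; exists p, s; split=> //; lia. Qed.

Lemma one_add_neg_unit x : neg (x - 1) -> exists y, x * y = 1.
Proof.
move=> [p [s [sm ps xs]]]; have am : s + p \is monic.
  by rewrite monicE lead_coefDl -?monicE //; move: ps; rewrite addn0.
have [v sv] := toloc_inv (am : s + p \in S).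
exists (tw s * v); rewrite mulrA (_ : x * tw s = tw (s + p)) //.
by rewrite rmorphD /= -xs; ring.
Qed.

Lemma det_one_add_neg r (B : 'M[W]_r) : (forall i j, neg (B i j - (i == j)%:R)) ->
  exists B', B *m B' = 1%:M.
Proof.
move=> Bneg; have id_npos i j : npos (1%:M i j : W).
  by rewrite mxE -(rmorph_nat tw) -(rmorph_nat polyC); exact: npos_const.
have : neg (\det B - 1).
  rewrite -(det1 W r); apply: (@det_congr _ npos) => //.
  - by rewrite -(rmorph1 tw) -(rmorph1 polyC); exact: npos_const.
  - exact: npos_mul.
  - exact: neg0.
  - exact: degree_lt_add.
  - exact: degree_lt_opp.
  - exact: npos_mul_neg.
  - move=> i j; rewrite -(subrK (1%:M i j) (B i j)); apply: degree_lt_add => //.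
    by apply: neg_npos; rewrite mxE.
  - by move=> i j; rewrite mxE; exact: Bneg.
move=> /one_add_neg_unit[c Bc]; exists (c *: \adj B).
by rewrite -scalemxAr mul_mx_adj scale_scalar_mx mulrC Bc.
Qed.

Lemma residue_fraction_map : exists f : {rmorphism W -> K}, forall p, f (tw p) = tk (red p).
Proof.
have [|f fE] := @loc_extend _ S K (tk \o red); last by exists f.
move=> s sm; exists ((tk (red s))^-1); rewrite /= mulfV // tofrac_eq0.
by apply: monic_neq0; exact: monic_map.
Qed.

Section Reduction.
Variable f : {rmorphism W -> K}.
Hypothesis fE : forall p, f (tw p) = tk (red p).

Lemma tk_inj : injective tk.
Proof. by move=> p q /eqP; rewrite tofrac_eq => /eqP. Qed.

Lemma map_f_tw p q (M : 'M[{poly R}]_(p, q)) :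
  map_mx f (map_mx tw M) = map_mx tk (map_mx red M).
Proof. by apply/matrixP => i j; rewrite !mxE fE. Qed.

Lemma red_lift p q (M : 'M[{poly k}]_(p, q)) : exists N, map_mx red N = M.
Proof.
have [_ /choice[s sK]] := piP.
exists (map_mx (fun p : {poly k} => \poly_(i < size p) s p`_i) M); apply/matrixP => i j; rewrite !mxE.
apply/polyP => l; rewrite coef_map coef_poly; case: ltnP => h; first by rewrite /= sK.
by rewrite /= rmorph0 nth_default.
Qed.

Lemma fraction_ratio (y : K) : exists a b : {poly k}, b != 0 /\ y * tk b = tk a.
Proof.
elim/quotW: y => x; exists \n_x, \d_x; split; first exact: denom_ratioP.
unlock FracField.tofrac; rewrite -[LHS]FracField.pi_mul; apply/eqP.
rewrite FracField.equivf_def /FracField.mulf !numden_Ratio ?mulf_neq0 ?oner_eq0 ?denom_ratioP //.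
by rewrite !mulr1 mulrC.
Qed.

Lemma monic_ratio (y : K) : exists a s : {poly k}, s \is monic /\ y * tk s = tk a.
Proof.
have [a [b [b0 yb]]] := fraction_ratio y; pose c := (lead_coef b)^-1.
exists (c *: a), (c *: b); split.
  by rewrite monicE lead_coefZ mulVf // lead_coef_eq0.
by rewrite -!mul_polyC !rmorphM /= -yb mulrCA.
Qed.

Lemma red_monic_lift (s : {poly k}) : s \is monic -> exists2 s', s' \is monic & red s' = s.
Proof.
move=> sm; have [_ /choice[l lK]] := piP; pose n := (size s).-1.
have szs : size s = n.+1 by rewrite prednK // lt0n size_poly_eq0 monic_neq0.
exists ('X^n + \poly_(i < n) l s`_i).
  by rewrite monicE lead_coefDl ?lead_coefXn // size_polyXn ltnS size_poly.
apply/polyP => i; rewrite coef_map coefD coefXn coef_poly /= rmorphD rmorph_nat.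
case: ltngtP => h; rewrite ?rmorph0 ?addr0 ?add0r ?lK //.
  by rewrite nth_default // szs.
by rewrite h; apply/esym/eqP.
Qed.

Lemma f_ratio_lift (a s : {poly k}) y : s \is monic -> y * tk s = tk a ->
  forall a', red a' = a -> exists x s', [/\ s' \is monic, x * tw s' = tw a' & f x = y].
Proof.
move=> sm ys a' a'E; have [s' s'm s'E] := red_monic_lift sm.
have [v sv] := toloc_inv (s'm : s' \in S).
have xs : tw a' * v * tw s' = tw a' by rewrite -mulrA [v * _]mulrC sv mulr1.
exists (tw a' * v), s'; split=> //.
have : tk s != 0 by rewrite tofrac_eq0 monic_neq0.
move/mulIf; apply; rewrite ys -s'E -fE -rmorphM xs fE a'E //.
Qed.

Lemma f_surj y : exists x, f x = y.
Proof.
have [a [s [sm ys]]] := monic_ratio y.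
have [A AE] := red_lift (\col_(_ < 1) a).
have a'E : red (A 0 0) = a by have /matrixP/(_ 0 0) := AE; rewrite !mxE.
by have [x [s' [_ _ fx]]] := f_ratio_lift sm ys a'E; exists x.
Qed.

Lemma f_unit_lift y : y != 0 -> exists x x', f x = y /\ x * x' = 1.
Proof.
move=> y0; have [a [s [sm ys]]] := monic_ratio y.
have a0 : a != 0.
  have ts : tk s != 0 by rewrite tofrac_eq0 monic_neq0.
  apply/eqP => a0; have := mulf_neq0 y0 ts.
  by rewrite ys a0 rmorph0 eqxx.
pose c := lead_coef a; have c0 : c != 0 by rewrite lead_coef_eq0.
have am : c^-1 *: a \is monic by rewrite monicE lead_coefZ mulVf.
have [b bm bE] := red_monic_lift am.
have [u uc] := piP.2 c.
have [w wu] : exists w, w * u = 1.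
  by apply: mloc.2 => /piP.1; rewrite uc => /eqP; rewrite (negbTE c0).
have aE : red (u *: b) = a by rewrite map_polyZ /= uc bE scalerA mulfV // scale1r.
have [x [s' [s'm xs fx]]] := f_ratio_lift sm ys aE.
have [v bv] := toloc_inv (bm : b \in S).
exists x, (tw s' * (v * tw w%:P)); split=> //.
rewrite mulrA xs -mul_polyC rmorphM /= [v * _]mulrC mulrACA bv mulr1 -rmorphM -polyCM.
by rewrite [u * w]mulrC wu !rmorph1.
Qed.

(** The vanishing of the global sections of O(-1) on the projective line over k. *)
Lemma neg_residue_poly x p : neg x -> f x = tk p -> p = 0.
Proof.
move=> [q [s [sm qs xs]]] fx; have := congr1 f xs; rewrite rmorphM !fE fx -rmorphM => /tk_inj e.
apply/eqP; apply: contraT => p0.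
have sz : size (red s) = size s.
  by apply: size_map_poly_id0; rewrite (monicP sm) rmorph1 oner_eq0.
have := congr1 (fun x : {poly k} => size x) e.
rewrite size_Mmonic ?monic_map // sz => e2.
have rq : (size (red q) <= size q)%N by exact: size_poly.
have s0 := size_monic_gt0 sm; rewrite -size_poly_gt0 in p0.
move: e2 rq s0 p0 qs; move: (size (red q)) (size p) (size s) (size q) => A B C D; lia.
Qed.

(** Polynomial part plus negative part: the vanishing of the first cohomology of O(-1). The second
    clause makes the splitting compatible with reduction. *)
Lemma fraction_split x : exists p, neg (x - tw p) /\ (f x = 0 -> red p = 0).
Proof.
have [a [s sm xs]] := toloc_frac x.
have [q [r [aE rs h]]] := monic_divide pi a sm; exists q; split.
  exists r, s; split=> //; first by rewrite addn0.
  by rewrite mulrBl xs aE rmorphD rmorphM; ring.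
move=> fx; have [] := h _; last by [].
by apply: tk_inj; rewrite -fE -xs rmorphM fx mul0r rmorph0.
Qed.

Definition mx_neg p q (M : 'M[W]_(p, q)) := forall i j, neg (M i j).

Lemma mx_negD p q (M N : 'M[W]_(p, q)) : mx_neg M -> mx_neg N -> mx_neg (M + N).
Proof. by move=> nM nN i j; rewrite mxE; exact: degree_lt_add. Qed.

(** Modulo negative columns and multiples of [d], only finitely many monomial columns remain over R;
    this is the finiteness that Nakayama's lemma needs. *)
Lemma column_split r (d : {poly R}) (x : 'cV[W]_r) : d \is monic ->
  exists (M : 'I_(size d) * 'I_r -> R) (q : 'cV[{poly R}]_r),
    mx_neg (x - map_mx tw (d *: q)
            - \sum_ji tw (M ji)%:P *: (tw 'X^(ji.1) *: delta_mx ji.2 0))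
    /\ (map_mx f x = 0 -> forall ji, m (M ji)).
Proof.
move=> dm.
have /choice[p pP] i : exists p, neg (x i 0 - tw p) /\ (f (x i 0) = 0 -> red p = 0).
  exact: fraction_split.
have /choice[q /choice[s qs]] i : exists q s, [/\ p i = q * d + s, (size s < size d)%N
    & red (p i) = 0 -> red q = 0 /\ red s = 0] by exact: monic_divide.
exists (fun ji : 'I_(size d) * 'I_r => (s ji.2)`_ji.1), (\col_i q i); split; last first.
  move=> /matrixP fx [j i] /=; have [_ _ h] := qs i.
  have [|_ /(residue_poly_eq0 piP)] := h _; last exact.
  by apply: (pP i).2; have := fx i 0; rewrite !mxE.
have -> : \sum_(ji : 'I_(size d) * 'I_r) tw ((s ji.2)`_ji.1)%:P *: (tw 'X^(ji.1) *: delta_mx ji.2 0)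
    = \col_i tw (s i) :> 'cV[W]_r.
  rewrite -(pair_bigA _ (fun (j : 'I_(size d)) i => tw ((s i)`_j)%:P *: (tw 'X^j *: delta_mx i 0))) /=.
  rewrite exchange_big /=; apply/colP => i; rewrite summxE (bigD1 i) //= [X in _ + X]big1 ?addr0.
    rewrite summxE mxE [in RHS](_ : s i = \sum_(j < size d) ((s i)`_j)%:P * 'X^j).
      rewrite rmorph_sum; apply: eq_bigr => j _.
      by rewrite !mxE !eqxx mulr1 rmorphM.
    have [_ lt _] := qs i; under eq_bigr do rewrite mul_polyC.
    rewrite -poly_def; apply/polyP => l; rewrite coef_poly; case: ltnP => // h.
    by rewrite nth_default // (leq_trans _ h) // ltnW.
  move=> l li; rewrite summxE big1 // => j _.
  by rewrite !mxE eq_sym (negbTE li) !mulr0.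
move=> i j; rewrite (ord1 j) !mxE; have [pE _ _] := qs i.
rewrite (_ : _ - _ = x i 0 - tw (p i)); first exact: (pP i).1.
by rewrite pE rmorphD !rmorphM /=; ring.
Qed.

(* [v] glues the projective module to the trivial module at infinity; the resulting bundle
   on the projective line is trivial on the closed fibre, so that its twist by -1 has no
   first cohomology there, hence none at all by Nakayama. *)
Lemma lattice_complement n r (u : 'M[W]_(n, r)) (v : 'M[W]_(r, n))
    (w : 'M[{poly k}]_(r, n)) (z : 'M[{poly k}]_(n, r)) :
  v *m u = 1%:M -> map_mx f v = map_mx tk w -> w *m z = 1%:M ->
  forall x : 'cV[W]_r, exists y : 'cV[{poly R}]_n, mx_neg (x - v *m map_mx tw y).
Proof.
move=> vu vw wz; pose N (x : 'cV[W]_r) := exists y, mx_neg (x - v *m map_mx tw y).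
have N0 : N 0.
  by exists 0 => i j; rewrite map_mx0 mulmx0 subrr mxE; exact: neg0.
have ND x y : N x -> N y -> N (x + y).
  move=> [a xa] [b yb]; exists (a + b).
  rewrite map_mxD mulmxDr opprD addrACA.
  exact: (mx_negD xa yb).
have NZ (a : R) x : N x -> N ((tw \o polyC) a *: x).
  move=> [b xb]; exists (a%:P *: b) => i j.
  rewrite map_mxZ -scalemxAr -scalerBr mxE; apply: npos_mul_neg => //.
  exact: npos_const.
have Nneg x : mx_neg x -> N x.
  by move=> nx; exists 0; rewrite map_mx0 mulmx0 subr0.
have Nv y : N (v *m map_mx tw y).
  by exists y; rewrite subrr => i j; rewrite mxE; exact: neg0.
have [d dm [U UE]] := common_denominator u.
(* [d] times [u] is a polynomial matrix [U], and v U q = d q since v u = 1. *)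
have Nd q : N (map_mx tw (d *: q)).
  rewrite (_ : map_mx tw (d *: q) = v *m map_mx tw (U *m q)); first exact: Nv.
  by rewrite map_mxM -UE -scalemxAl -scalemxAr mulmxA vu mul1mx map_mxZ.
pose y (ji : 'I_(size d) * 'I_r) : 'cV[W]_r := tw 'X^(ji.1) *: delta_mx ji.2 0.
have Nsplit x : exists M : 'I_(size d) * 'I_r -> R,
    N (x - \sum_ji (tw \o polyC) (M ji) *: y ji) /\ (map_mx f x = 0 -> forall ji, m (M ji)).
  have [M [q [/Nneg h hm]]] := column_split x dm; exists M; split=> //.
  rewrite (_ : x - _ = (x - map_mx tw (d *: q) - \sum_ji tw (M ji)%:P *: y ji) + map_mx tw (d *: q)).
    exact: ND.
  by rewrite addrAC subrK.
have [Z ZE] := red_lift z.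
have Ny ji : N (y ji).
  have /choice[M MP] i : exists M : 'I_(size d) * 'I_r -> R, (forall j, m (M j))
      /\ N (y i - \sum_j (tw \o polyC) (M j) *: y j).
    (* As w z = 1, the column y i - v Z y0 reduces to 0, so the coefficients that [Nsplit] gives for
       it lie in m. *)
    pose y0 : 'cV[{poly R}]_r := 'X^(i.1) *: delta_mx i.2 0.
    have yE : y i = map_mx tw y0 by rewrite map_mxZ map_delta_mx.
    have [M [NM mM]] := Nsplit (y i - v *m map_mx tw (Z *m y0)); exists M; split.
      apply: mM; rewrite map_mxB map_mxM vw yE !map_f_tw -map_mxM.
      by rewrite (map_mxM red) ZE mulmxA wz mul1mx subrr.
    rewrite (_ : y i - _ = (y i - v *m map_mx tw (Z *m y0)
        - \sum_j (tw \o polyC) (M j) *: y j) + v *m map_mx tw (Z *m y0)).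
      exact: ND.
    by rewrite addrAC subrK.
  have [[m0 mD mM] _ _] := mloc.1.
  apply: (@nakayama R W (tw \o polyC) 'cV[W]_r N N0 ND NZ m m0 mD mM (local_rad mloc) _ y M).
    by move=> i; exact: (MP i).1.
  by move=> i; exact: (MP i).2.
move=> x; have [M [NM _]] := Nsplit x.
have Nsum : N (\sum_ji (tw \o polyC) (M ji) *: y ji).
  by apply: big_ind => // ji _; exact: NZ.
by have := ND _ _ NM Nsum; rewrite subrK.
Qed.

Lemma horrocks_reduced n (e : 'M[{poly R}]_n) : e *m e = e ->
  free_idem (map_mx tw e) -> free_idem e.
Proof.
move=> ee [r [u [v [uv vu]]]].
have [|r' [z [w [zw wz]]]] := idem_free_poly_field (e := map_mx red e).
  by rewrite -map_mxM ee.
(* [g] compares, over k(s), the reduced R<s>-basis with the k[s]-basis of the reduced module.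
   Multiplying [v] by a lift of [g] makes its reduction equal to the polynomial matrix [w]. *)
pose g : 'M[K]_(r', r) := map_mx tk w *m map_mx f u.
pose g' : 'M[K]_(r, r') := map_mx f v *m map_mx tk z.
have fuv : map_mx f u *m map_mx f v = map_mx tk z *m map_mx tk w.
  by rewrite -!map_mxM uv zw map_f_tw.
have gg' : g *m g' = 1%:M.
  rewrite /g /g' mulmxA -(mulmxA (map_mx tk w)) fuv -!map_mxM !mulmxA wz mul1mx wz.
  exact: map_mx1.
have g'g : g' *m g = 1%:M.
  rewrite /g /g' mulmxA -(mulmxA (map_mx f v)) -fuv -!map_mxM !mulmxA vu mul1mx vu.
  exact: map_mx1.
have rr : r' = r.
  by apply/eqP; rewrite eqn_leq (mulmx1_min gg') (mulmx1_min g'g).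
subst r'.
have g0 : \det g != 0.
  by apply/eqP => g0; have /eqP := congr1 determinant gg'; rewrite det_mulmx g0 mul0r det1 eq_sym oner_eq0.
have [h [h' [hh' fh]]] := lift_unit_mx f_surj f_unit_lift g0.
have h'h := mulmx1C hh'.
have [v1 v1E] : exists v1, v1 = h *m v by exists (h *m v).
have [u1 u1E] : exists u1, u1 = u *m h' by exists (u *m h').
have vu1 : v1 *m u1 = 1%:M by rewrite v1E u1E mulmxA -(mulmxA h) vu mulmx1.
have uv1 : u1 *m v1 = map_mx tw e by rewrite v1E u1E mulmxA -(mulmxA u) h'h mulmx1.
have fv1 : map_mx f v1 = map_mx tk w.
  rewrite v1E map_mxM fh /g -mulmxA fuv mulmxA -map_mxM wz map_mx1 mul1mx.
  by [].
have [Z ZE] := red_lift z.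
pose X := v1 *m map_mx tw Z - 1%:M.
(* The error v1 Z - 1 is corrected by v1 Y up to negative degree. So B = v1 q is 1 plus a negative
   matrix, hence invertible over R<s>, and the columns of e q are the candidate basis. *)
have /choice[y yP] j := lattice_complement vu1 fv1 wz (col j X).
pose Y := \matrix_(i, j) y j i 0; pose q := Z - Y; pose B := v1 *m map_mx tw q.
have YX : mx_neg (X - v1 *m map_mx tw Y).
  move=> i j; have := yP j i 0; congr (neg _).
  rewrite mxE [RHS]mxE; congr (_ + _); first by rewrite mxE.
  by rewrite mxE [RHS]mxE; congr (- _); rewrite !mxE; apply: eq_bigr => l _; rewrite !mxE.
have BE : B - 1%:M = X - v1 *m map_mx tw Y.
  by rewrite /B /q /X map_mxB mulmxBr addrAC.
have [i j|B' BB'] := @det_one_add_neg _ B.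
  by have := YX i j; rewrite -BE !mxE.
have B'B := mulmx1C BB'.
(* This difference reduces to -w Y, which is both polynomial and of negative degree. *)
have wY : w *m map_mx red Y = 0.
  apply/matrixP => i j; rewrite [RHS]mxE -[LHS]opprK; apply/eqP; rewrite oppr_eq0; apply/eqP.
  apply: (neg_residue_poly (YX i j)).
  have fX : map_mx f (X - v1 *m map_mx tw Y) = - map_mx tk (w *m map_mx red Y).
    rewrite /X !map_mxB !map_mxM fv1 !map_f_tw ZE -!map_mxM wz !map_mx1 subrr sub0r.
    by [].
  by move/matrixP/(_ i j): fX; rewrite mxE => ->; rewrite !mxE rmorphN.
have fB : map_mx f B = 1%:M.
  rewrite /B map_mxM fv1 map_f_tw -map_mxM /q map_mxB mulmxBr ZE wz wY subr0.
  exact: map_mx1.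
have fB' : map_mx f B' = 1%:M.
  by have := congr1 (map_mx f) BB'; rewrite map_mxM fB mul1mx map_mx1.
pose U := e *m q; pose v2 := B' *m v1.
have UE : map_mx tw U = u1 *m B by rewrite map_mxM -uv1 -mulmxA.
have v2U : v2 *m map_mx tw U = 1%:M.
  by rewrite UE /v2 mulmxA -(mulmxA B') vu1 mulmx1.
have Uv2 : map_mx tw U *m v2 = map_mx tw e.
  by rewrite UE /v2 mulmxA -(mulmxA u1) BB' mulmx1.
have eU : e *m U = U by rewrite /U mulmxA ee.
have red_e : map_mx red e = map_mx red U *m w.
  have fv2 : map_mx f v2 = map_mx tk w by rewrite /v2 map_mxM fB' mul1mx fv1.
  apply: (map_mx_inj_rmorph tk_inj); rewrite -map_f_tw -Uv2 map_mxM fv2 map_f_tw.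
  by rewrite -map_mxM.
have [w0 w0E] := red_lift w.
pose C := e - U *m w0.
have eC : e *m C = C by rewrite /C mulmxBr mulmxA ee eU.
have red_C : map_mx red C = 0 by rewrite map_mxB map_mxM red_e w0E subrr.
have [d dm [V VE]] := common_denominator v2.
have eUV : d *: e = U *m V.
  apply: (map_mx_inj_rmorph (@monic_inj R)).
  by rewrite map_mxZ map_mxM -VE -scalemxAr Uv2.
(* [J] measures how far the columns of [U] are from generating the image of [e]. It contains the
   monic [d], because U is a basis over R<s>, and the determinant of 1 - C, which is 1 modulo m. *)
pose J (a : {poly R}) := exists Y0, a *: e = U *m Y0.
have JI : idealP J.
  split; first by exists 0; rewrite scale0r mulmx0.
    by move=> a b [A aA] [D bD]; exists (A + D); rewrite scalerDl mulmxDr aA bD.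
  by move=> a b [A bA]; exists (a *: A); rewrite -scalerA bA scalemxAr.
have [Y1] : J 1.
  apply: (monic_ideal_comaximal mloc piP JI dm (j := \det (1%:M - C))).
  - by exists V.
  - exists (w0 *m \adj (1%:M - C)); rewrite mulmxA.
    rewrite (_ : U *m w0 = e *m (1%:M - C)); last by rewrite mulmxBr mulmx1 eC subKr.
    by rewrite -mulmxA mul_mx_adj mul_mx_scalar.
  - by rewrite -det_map_mx map_mxB map_mx1 red_C subr0 det1.
rewrite scale1r => eY1; exists r, U, Y1; split=> //.
apply: (map_mx_inj_rmorph (@monic_inj R)); rewrite map_mxM map_mx1.
have -> : map_mx tw Y1 = v2.
  have v2e : v2 *m map_mx tw e = v2 by rewrite -Uv2 mulmxA v2U mul1mx.
  by rewrite -v2e eY1 map_mxM mulmxA v2U mul1mx.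
exact: v2U.
Qed.

End Reduction.
Lemma horrocks n (e : 'M[{poly R}]_n) : e *m e = e ->
  free_idem (map_mx tw e) -> free_idem e.
Proof. by move=> ee; have [f fE] := residue_fraction_map; apply: (horrocks_reduced fE ee). Qed.

End Horrocks.

(** * The theorem *)

Lemma idem_free_fgP (A : comPzRingType) : idem_free A <-> fg_projectives_free A.
Proof. by split; [exact: idem_free_fg | exact: fg_idem_free]. Qed.

Section Equivalence.
Variables (R : comNzRingType) (hR : regular_local R).
Local Notation L := (localization (powers (fpsX R))).
Local Notation T := (localization (powers ('X : {poly R}))).
Local Notation W := (localization (@monic_pred R : {pred {poly R}})).

Lemma poly_to_laurent_series : idem_free {poly R} -> idem_free L.
Proof.
move=> pfree n e ee.
have [noeth [m [mloc [xs reg]]]] := regular_local_sequence hR.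
have [k [pi piP]] := residue_field mloc.
apply: stably_free_free => //.
  by move=> *; apply: (laurent_unimodular_free mloc piP pfree).
apply: loc_idem_stably_free ee; first exact: powers_fpsX_regular.
apply: (fps_resolution noeth).
exact: (regular_sequence_resolution noeth mloc (zero_idealP R) reg).
Qed.

Lemma monic_to_poly n (e : 'M[{poly R}]_n) :
  e *m e = e -> free_idem (map_mx (toloc (@monic_pred R : {pred {poly R}})) e) -> free_idem e.
Proof.
have [noeth [m [mloc [xs reg]]]] := regular_local_sequence hR.
have [k [pi piP]] := residue_field mloc.
exact: (horrocks mloc piP).
Qed.

Lemma monic_loc_to_poly : idem_free W -> idem_free {poly R}.
Proof. by move=> Wfree n e ee; apply: monic_to_poly => //; apply: Wfree; rewrite -map_mxM ee. Qed.

Lemma laurent_poly_to_poly : idem_free T -> idem_free {poly R}.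
Proof.
move=> Tfree n e ee; apply: monic_to_poly => //; apply: free_laurent_poly_monic.
by apply: Tfree; rewrite -map_mxM ee.
Qed.

End Equivalence.

Theorem theorem1p1 (R : comNzRingType) (hR : regular_local R) :
  [<-> fg_projectives_free {poly R};
       fg_projectives_free (laurent_poly R);
       fg_projectives_free (monic_loc R);
       fg_projectives_free (laurent_series R)].
Proof.
have poly_series := @poly_to_laurent_series R hR.
tfae.
- move=> /idem_free_fgP p; apply/idem_free_fgP.
  exact: (idem_free_laurent_poly p (poly_series p)).
- move=> /idem_free_fgP/(laurent_poly_to_poly hR)/poly_series p; apply/idem_free_fgP.
  exact: idem_free_laurent_monic p.
- move=> /idem_free_fgP/(monic_loc_to_poly hR)/poly_series p; apply/idem_free_fgP.
  exact: p.
- move=> /idem_free_fgP p; apply/idem_free_fgP.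
  exact: (monic_loc_to_poly hR (idem_free_laurent_monic p)).
Qed.
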